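(* For $(p,p')=(3,8)$ (level $N=2/3$) and $r\in\{0,1,2,3\}$, \begin{align*} (q)_{\infty}^3\,\mathcal{C}_{2,2r}^{2/3}(q) &=(-1)^{\lfloor (r+1)/2\rfloor}\cdot \frac{q^{3-2r}}{2}\,\frac{J_{1}^2J_{2}}{J_{4}^2J_{32}}\,j(q^{2+4r};q^{32})\,j(q^{7-2r};q^{16})\\ &\quad - q^{3-2r}\,\frac{j(q^{7-2r};q^{16})\,j(q^{30-4r};q^{32})}{J_{32}}\left (1- \frac{1}{2}f_{3}(q^4) \right ) \\ &\quad + q^{1-r}\,\frac{j(q^{1+2r};q^{16})\,j(q^{18+4r};q^{32})}{J_{32}}\left (1-q^2\omega_{3}(-q^{2}) \right ). \end{align*}
   Context: Throughout $q=e^{2\pi i\tau}$ with $\operatorname{Im}\tau>0$, $q^{a}:=e^{2\pi i a\tau}$ for rational $a$, and $z=e^{2\pi i w}$, $z^{a}:=e^{2\pi i a w}$. Notation: $(x;q)_n=\prod_{i=0}^{n-1}(1-q^ix)$, $(x)_n=(x;q)_n$, $(q)_\infty=\prod_{n\ge1}(1-q^n)$, $J_a=\prod_{i\ge1}(1-q^{ai})$, $j(x;q):=\sum_{n\in\mathbb{Z}}(-1)^nq^{n(n-1)/2}x^n$, and $\lfloor\cdot\rfloor$ is the floor function. Ramanujan's third-order mock theta functions are $$f_3(q)=\sum_{n\ge0}\frac{q^{n^2}}{(-q)_n^2},\qquad \omega_3(q)=\sum_{n\ge0}\frac{q^{2n(n+1)}}{(q;q^2)_{n+1}^2}.$$ Characters: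 for coprime integers $p\ge1$, $p'\ge 2$ put $N=p'/p-2$, and let $0\le\ell\le p'-2$. The character of the admissible irreducible highest weight $A_1^{(1)}$-module of level $N$ and spin $\ell$ is (Weyl–Kac formula) $$\chi_{\ell}^{N}(z;q)=\chi_{\ell}^{(p,p')}(z;q)=\frac{\Theta_{\ell+1,p'}(z;q^p)-\Theta_{-(\ell+1),p'}(z;q^p)}{\Theta_{1,2}(z;q)-\Theta_{-1,2}(z;q)},\qquad \Theta_{n,m}(z;q)=\sum_{k\in\mathbb{Z}+n/(2m)}q^{mk^2}z^{-mk}.$$ It is holomorphic in the annulus $|q|<|z|<|q|^{-1}$. String functions: for $N\neq0$ and $m\in2\mathbb{Z}+\ell$, $C^N_{m,\ell}(q)$ is defined by the expansion in that annulus $$\chi_\ell^{N}(z;q)=\sum_{m\in2\mathbb{Z}+\ell}C_{m,\ell}^{N}(q)\,q^{\frac{m^2}{4N}}z^{-\frac m2},$$ and the normalized string function is $$\mathcal{C}_{m,\ell}^{N}(q):=q^{-s_{\lambda,\mu}}C_{m,\ell}^{N}(q),\qquad s_{\lambda,\mu}=-\frac18+\frac{p(\ell+1)^2}{4p'}-\frac{m^2}{4N}.$$ *)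

(* Defs.v *)
From Stdlib Require Export Reals ZArith.
From Coquelicot Require Export Coquelicot.

Open Scope C_scope.

Definition Cexp (x : C) : C :=
  (exp (Re x) * cos (Im x), exp (Re x) * sin (Im x))%R.

(* [epow t a] is q^a when t = tau and z^a when t = w: fractional powers of
   q and z depend on tau and w, not only on q and z. *)
Definition epow (t : C) (a : R) : C :=
  Cexp (2 * RtoC PI * Ci * RtoC a * t).

Definition Cpowz (x : C) (n : Z) : C :=
  match n with
  | Z0 => 1
  | Zpos k => x ^ Pos.to_nat k
  | Zneg k => / x ^ Pos.to_nat k
  end.

Notation "x ^^ n" := (Cpowz x n%Z) (at level 30, right associativity) : C_scope.

(* Total sum and limit operators, taken componentwise: they return the actual
   value whenever the series or the sequence converges in C. *)
Definition CSeries (a : nat -> C) : C :=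
  (Series (fun n => Re (a n)), Series (fun n => Im (a n))).

Definition CLim_seq (u : nat -> C) : C :=
  (real (Lim_seq (fun n => Re (u n))), real (Lim_seq (fun n => Im (u n)))).

Definition CZSeries (a : Z -> C) : C :=
  CSeries (fun n => a (Z.of_nat n)) + CSeries (fun n => a (- Z.of_nat (S n))%Z).

Definition is_CZseries (a : Z -> C) (l : C) : Prop :=
  exists l1 l2 : C,
    @is_series C_AbsRing C_NormedModule (fun n => a (Z.of_nat n)) l1 /\
    @is_series C_AbsRing C_NormedModule (fun n => a (- Z.of_nat (S n))%Z) l2 /\
    l = l1 + l2.

Fixpoint Cprod (f : nat -> C) (n : nat) : C :=
  match n with
  | O => 1
  | S k => Cprod f k * f k
  end.

Definition Cprod_inf (f : nat -> C) : C := CLim_seq (Cprod f).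

Definition qpoch (x q : C) (n : nat) : C := Cprod (fun i => 1 - q ^ i * x) n.

Definition qinf (q : C) : C := Cprod_inf (fun i => 1 - q ^ S i).

Definition J (a : nat) (q : C) : C := Cprod_inf (fun i => 1 - q ^ (a * S i)).

(* j(x; q); the division by 2 is exact *)
Definition jtheta (x q : C) : C :=
  CZSeries (fun n => (-1) ^^ n * q ^^ (n * (n - 1) / 2) * x ^^ n).

Definition f3 (q : C) : C :=
  CSeries (fun n => q ^ (n * n) / qpoch (- q) q n ^ 2).

Definition omega3 (q : C) : C :=
  CSeries (fun n => q ^ (2 * n * (n + 1)) / qpoch q (q ^ 2) (n + 1) ^ 2).

(* Theta_{n,m}(z; q), the summation variable being k = i + n / (2 m) *)
Definition Theta (n m : Z) (w tau : C) : C :=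
  CZSeries (fun i =>
    let k := (IZR i + IZR n / (2 * IZR m))%R in
    epow tau (IZR m * k ^ 2) * epow w (- (IZR m * k))).

Definition weyl_denominator (w tau : C) : C :=
  Theta 1 2 w tau - Theta (-1) 2 w tau.

(* Replacing q by q^p amounts to replacing tau by p tau. *)
Definition chi (p p' l : Z) (w tau : C) : C :=
  (Theta (l + 1) p' w (RtoC (IZR p) * tau)
     - Theta (- (l + 1)) p' w (RtoC (IZR p) * tau))
  / weyl_denominator w tau.

Definition level (p p' : Z) : R := (IZR p' / IZR p - 2)%R.

(* [c m] is C^N_{m,l}(q) for m in 2Z + l (the values of c at the other integers
   are irrelevant).  The zeros of the denominator in the annulus |q| < |z| < 1/|q|
   are removable singularities of chi (only z = 1); there Rocq's quotient is not
   the value of the character, so they are left out; the coefficients are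
   nevertheless uniquely determined. *)
Definition is_string_functions (p p' l : Z) (tau : C) (c : Z -> C) : Prop :=
  forall w : C,
    (Cmod (epow tau 1) < Cmod (epow w 1) < / Cmod (epow tau 1))%R ->
    weyl_denominator w tau <> 0 ->
    is_CZseries
      (fun i =>
         let m := (2 * i + l)%Z in
         c m * epow tau (IZR m ^ 2 / (4 * level p p')) * epow w (- (IZR m / 2)))
      (chi p p' l w tau).

Definition s_exponent (p p' l m : Z) : R :=
  (- (1 / 8) + IZR p * (IZR l + 1) ^ 2 / (4 * IZR p')
     - IZR m ^ 2 / (4 * level p p'))%R.

Definition normalized_string (p p' l : Z) (tau : C) (c : Z -> C) (m : Z) : C :=
  epow tau (- s_exponent p p' l m) * c m.

(* Main.v *)
(* The coefficient of [z^n] in the character is, up to [(q)^3], a Hecke-type sum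
   [g_n = sum_e p_e u_(n-e)], where the [p_e] are the coefficients of the numerator and
   the partial theta functions [u_k] those of [(q)^3 / j(z; q)], read off the partial
   fraction expansion of the latter.  The relation [u_(k-1) = 1 - q^k u_k] and the symmetry
   of the numerator express [g_1] through [g_0] (for spin [3 - r]) and give a recursion
   from [g_n] to [g_(n+2)], whose inhomogeneous terms involve only the values [A], [B] of
   the numerator at [q] and [q^2].  The even part of the series at [z = i q], which needs
   regularisation since [i q] lies on the boundary of the annulus, is computed from the
   values of [(q)^3 / j(z; q)] at [z = i] and [z = -i].  Solving the recursion turns the
   same quantity into [2 J_4 g_0] plus double sums multiplying [A] and [B].  Watson's
   Appell-type expansions of [f_3] and [omega_3], which follow from Bailey's lemma, are
   matched with these double sums by an antisymmetry argument; this determines [g_0].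
   Finally, the quintuple product identity factors [A] and [B]. *)

Require Import Defs.
From Stdlib Require Import List Lia Lra ClassicalEpsilon FunctionalExtensionality.
Import ListNotations.

Open Scope C_scope.

(** * Unconditional sums *)

(** Why the recursion closes: the spins [2 r] and [2 (3 - r)] are exchanged by ell -> p' - 2 - ell,
    which multiplies p_e by q^(3 e) and shifts e by 4, up to a constant. Absorbing this weight takes
    exactly three uses of the relation between consecutive u_k, and each leaves a value of the
    numerator at a power of q. The value at q^3 vanishes together with the one at 1, so only those
    at q and q^2 remain. The recursion leaves its initial value g_0 free, so one more linear
    equation is needed. The point z = i q is chosen because it gives the even coefficients the
    weights (-1)^k q^(2 k), which turn the homogeneous solution q^(6 k^2) into the pentagonal series
    for J_4. There the terms tend to A up to sign as k -> -oo; the divergent alternating sum is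
    replaced by a sum of consecutive differences, which doubles it, hence the factor 2. All sums are
    unconditional sums over arbitrary index types, so that reindexing and exchange of summation need
    only summability, and this is mostly a comparison of integer exponents of q. *)

Definition rsum {I : Type} (f : I -> R) (l : list I) : R :=
  fold_right (fun i s => (f i + s)%R) 0%R l.

Definition lsum {I : Type} (f : I -> C) (l : list I) : C :=
  fold_right (fun i s => f i + s) 0 l.

Definition rsummable {I : Type} (g : I -> R) : Prop :=
  exists B : R, forall l, NoDup l -> (rsum g l <= B)%R.

Definition summable {I : Type} (f : I -> C) : Prop := rsummable (fun i => Cmod (f i)).

(** Finite subsets are duplicate-free lists, so this is convergence along the directed set of finite
    subsets; no enumeration of the index type is involved. *)
Definition has_sum {I : Type} (f : I -> C) (s : C) : Prop :=
  forall eps : R, (0 < eps)%R ->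
  exists l0, forall l, NoDup l -> incl l0 l -> (Cmod (lsum f l - s) < eps)%R.

(* Unspecified unless [f] has a sum, in particular for non-summable [f]. *)
Definition csum {I : Type} (f : I -> C) : C := epsilon (inhabits (0 : C)) (has_sum f).

Definition cv (u : nat -> C) (l : C) : Prop :=
  forall eps : R, (0 < eps)%R ->
  exists N, forall n, (N <= n)%nat -> (Cmod (u n - l) < eps)%R.

(** Classical, so that [nodup] and [in_dec] apply to lists over any index type. *)
Definition ceq_dec {I : Type} (x y : I) : {x = y} + {x <> y} :=
  excluded_middle_informative (x = y).

Lemma rsum_app {I} (f : I -> R) l m : rsum f (l ++ m) = (rsum f l + rsum f m)%R.
Proof. induction l; simpl; [ring | rewrite IHl; ring]. Qed.

Lemma lsum_app {I} (f : I -> C) l m : lsum f (l ++ m) = lsum f l + lsum f m.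
Proof. induction l; simpl; [ring | rewrite IHl; ring]. Qed.

Lemma rsum_nonneg {I} (f : I -> R) l : (forall i, (0 <= f i)%R) -> (0 <= rsum f l)%R.
Proof. intros H; induction l; simpl; [lra | specialize (H a); lra]. Qed.

Lemma rsum_le {I} (f g : I -> R) l :
  (forall i, (f i <= g i)%R) -> (rsum f l <= rsum g l)%R.
Proof. intros H; induction l; simpl; [lra | specialize (H a); lra]. Qed.

Lemma rsum_incl {I} (g : I -> R) (l m : list I) :
  (forall i, (0 <= g i)%R) -> NoDup l -> incl l m -> (rsum g l <= rsum g m)%R.
Proof.
  intros Hg; revert m; induction l as [|a l IH]; intros m Hl Hi.
  - apply rsum_nonneg, Hg.
  - destruct (in_split a m) as [m1 [m2 ->]]; [apply Hi; left; auto|].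
    inversion_clear Hl as [|? ? Hn Hl'].
    assert (rsum g l <= rsum g (m1 ++ m2))%R.
    { apply IH; auto. intros x Hx. specialize (Hi x (or_intror Hx)).
      apply in_app_iff in Hi; apply in_app_iff; simpl in Hi.
      destruct Hi as [|[->|]]; auto. contradiction. }
    rewrite rsum_app in *; simpl. lra.
Qed.

Lemma lsum_plus {I} (f g : I -> C) l : lsum (fun i => f i + g i) l = lsum f l + lsum g l.
Proof. induction l; simpl; [ring | rewrite IHl; ring]. Qed.

Lemma lsum_scal {I} c (f : I -> C) l : lsum (fun i => c * f i) l = c * lsum f l.
Proof. induction l; simpl; [ring | rewrite IHl; ring]. Qed.

Lemma lsum_norm {I} (f : I -> C) l : (Cmod (lsum f l) <= rsum (fun i => Cmod (f i)) l)%R.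
Proof.
  induction l; simpl; [rewrite Cmod_0; lra|].
  eapply Rle_trans; [apply Cmod_triangle|]. lra.
Qed.

Lemma lsum_RtoC {I} (g : I -> R) l : lsum (fun i => RtoC (g i)) l = RtoC (rsum g l).
Proof. induction l; simpl; auto. rewrite IHl, RtoC_plus; auto. Qed.

Lemma has_sum_unique {I} (f : I -> C) s t : has_sum f s -> has_sum f t -> s = t.
Proof.
  intros Hs Ht.
  destruct (Req_dec (Cmod (s - t)) 0) as [H|H].
  { apply Cmod_eq_0 in H. replace s with (s - t + t) by ring. rewrite H; ring. }
  exfalso. pose proof (Cmod_ge_0 (s - t)) as H0.
  destruct (Hs (Cmod (s - t) / 2)%R) as [l1 H1]; [lra|].
  destruct (Ht (Cmod (s - t) / 2)%R) as [l2 H2]; [lra|].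
  pose (l := nodup ceq_dec (l1 ++ l2)).
  assert (Hl : NoDup l) by apply NoDup_nodup.
  assert (incl l1 l) by (intros x Hx; apply nodup_In, in_app_iff; auto).
  assert (incl l2 l) by (intros x Hx; apply nodup_In, in_app_iff; auto).
  specialize (H1 l Hl H3). specialize (H2 l Hl H4).
  assert (Cmod (s - t) <= Cmod (lsum f l - t) + Cmod (lsum f l - s))%R.
  { replace (s - t) with ((lsum f l - t) + - (lsum f l - s)) by ring.
    eapply Rle_trans; [apply Cmod_triangle|]. rewrite Cmod_opp. lra. }
  lra.
Qed.

Lemma csum_eq {I} (f : I -> C) s : has_sum f s -> csum f = s.
Proof.
  intros H. apply (has_sum_unique f); auto.
  unfold csum. apply epsilon_spec. exists s; auto.
Qed.

Lemma has_sum_plus {I} (f g : I -> C) s t :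
  has_sum f s -> has_sum g t -> has_sum (fun i => f i + g i) (s + t).
Proof.
  intros Hf Hg eps He.
  destruct (Hf (eps / 2)%R) as [l1 H1]; [lra|].
  destruct (Hg (eps / 2)%R) as [l2 H2]; [lra|].
  exists (l1 ++ l2). intros l Hl Hi.
  specialize (H1 l Hl (fun x Hx => Hi x (in_or_app _ _ _ (or_introl Hx)))).
  specialize (H2 l Hl (fun x Hx => Hi x (in_or_app _ _ _ (or_intror Hx)))).
  rewrite lsum_plus.
  replace (lsum f l + lsum g l - (s + t)) with ((lsum f l - s) + (lsum g l - t)) by ring.
  eapply Rle_lt_trans; [apply Cmod_triangle|]. lra.
Qed.

Lemma has_sum_scal {I} c (f : I -> C) s : has_sum f s -> has_sum (fun i => c * f i) (c * s).
Proof.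
  intros Hf eps He.
  pose proof (Cmod_ge_0 c).
  destruct (Hf (eps / (Cmod c + 1))%R) as [l0 H0]; [apply Rdiv_lt_0_compat; lra|].
  exists l0. intros l Hl Hi. specialize (H0 l Hl Hi).
  rewrite lsum_scal. replace (c * lsum f l - c * s) with (c * (lsum f l - s)) by ring.
  rewrite Cmod_mult.
  pose proof (Cmod_ge_0 (lsum f l - s)).
  assert (H2 : ((Cmod c + 1) * Cmod (lsum f l - s) < (Cmod c + 1) * (eps / (Cmod c + 1)))%R)
    by (apply Rmult_lt_compat_l; lra).
  replace ((Cmod c + 1) * (eps / (Cmod c + 1)))%R with eps in H2 by (field; lra). nra.
Qed.

Lemma has_sum_nonneg {I} (g : I -> R) :
  (forall i, (0 <= g i)%R) -> rsummable g -> exists S : R, has_sum (fun i => RtoC (g i)) S.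
Proof.
  intros Hg [B HB].
  destruct (completeness (fun x => exists l, NoDup l /\ x = rsum g l)) as [S [HS1 HS2]].
  - exists B. intros x [l [Hl ->]]; auto.
  - exists 0%R, nil. split; [constructor | auto].
  - exists S. intros eps He.
    destruct (classic (exists l, NoDup l /\ (S - eps < rsum g l)%R)) as [[l0 [Hl0 H0]]|Hn].
    + exists l0. intros l Hl Hi. rewrite lsum_RtoC, <- RtoC_minus, Cmod_R.
      assert (rsum g l0 <= rsum g l)%R by (apply rsum_incl; auto).
      assert (rsum g l <= S)%R by (apply HS1; exists l; auto).
      apply Rabs_def1; lra.
    + exfalso. assert (S <= S - eps)%R; [|lra].
      apply HS2. intros x [l [Hl ->]].
      apply Rnot_lt_le. intros H. apply Hn. exists l; auto.
Qed.

Lemma rsummable_le {I} (f g : I -> R) :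
  (forall i, (f i <= g i)%R) -> rsummable g -> rsummable f.
Proof.
  intros H [B HB]. exists B. intros l Hl.
  eapply Rle_trans; [apply rsum_le, H | auto].
Qed.

(** The family splits into the positive and negative parts of its real and imaginary parts. Each is
    nonnegative and dominated by the modulus, so the supremum of its finite sums is its sum. *)
Lemma summable_has_sum {I} (f : I -> C) : summable f -> exists s, has_sum f s.
Proof.
  intros Hf.
  assert (H : forall h : C -> R, (forall x, Rabs (h x) <= Cmod x)%R ->
              exists S : R, has_sum (fun i => RtoC (Rmax (h (f i)) 0)) S).
  { intros h Hh. apply has_sum_nonneg.
    - intros i. apply Rmax_r.
    - eapply rsummable_le; [|exact Hf]. intros i; simpl.
      specialize (Hh (f i)). apply Rmax_lub; [|apply Cmod_ge_0].
      pose proof (Rle_abs (h (f i))); lra. }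
  assert (Hre : forall x, (Rabs (Re x) <= Cmod x)%R).
  { intros x. eapply Rle_trans; [apply Rmax_l | apply Rmax_Cmod]. }
  assert (Him : forall x, (Rabs (Im x) <= Cmod x)%R).
  { intros x. eapply Rle_trans; [apply Rmax_r | apply Rmax_Cmod]. }
  destruct (H (fun x => Re x)) as [a Ha]; auto.
  destruct (H (fun x => - Re x)%R) as [b Hb]; [intros; rewrite Rabs_Ropp; auto|].
  destruct (H (fun x => Im x)) as [c Hc]; auto.
  destruct (H (fun x => - Im x)%R) as [d Hd]; [intros; rewrite Rabs_Ropp; auto|].
  exists ((a + (-1) * b) + Ci * (c + (-1) * d)).
  replace f with (fun i => (RtoC (Rmax (Re (f i)) 0) + (-1) * RtoC (Rmax (- Re (f i)) 0))
     + Ci * (RtoC (Rmax (Im (f i)) 0) + (-1) * RtoC (Rmax (- Im (f i)) 0))).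
  - apply has_sum_plus; [|apply has_sum_scal]; apply has_sum_plus; auto; apply has_sum_scal; auto.
  - apply functional_extensionality. intros i. destruct (f i) as [x y].
    assert (E : forall t, (Rmax t 0 - Rmax (- t) 0 = t)%R).
    { intros t. unfold Rmax. destruct (Rle_dec t 0), (Rle_dec (- t) 0); lra. }
    pose proof (E x); pose proof (E y).
    apply injective_projections; simpl; lra.
Qed.

Lemma csum_spec {I} (f : I -> C) : summable f -> has_sum f (csum f).
Proof. intros H. unfold csum. apply epsilon_spec, summable_has_sum, H. Qed.

Lemma summable_le {I} (f : I -> C) (g : I -> R) :
  (forall i, (Cmod (f i) <= g i)%R) -> rsummable g -> summable f.
Proof. intros H Hg. eapply rsummable_le; [|exact Hg]. exact H. Qed.

Lemma csum_ext {I} (f g : I -> C) : (forall i, f i = g i) -> csum f = csum g.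
Proof. intros H. f_equal. apply functional_extensionality, H. Qed.

Lemma summable_ext {I} (f g : I -> C) : (forall i, f i = g i) -> summable f -> summable g.
Proof. intros H Hf. replace g with f; auto. apply functional_extensionality, H. Qed.

Lemma rsum_plus {I} (f g : I -> R) l :
  rsum (fun i => f i + g i)%R l = (rsum f l + rsum g l)%R.
Proof. induction l; simpl; [ring | rewrite IHl; ring]. Qed.

Lemma rsum_scal {I} c (f : I -> R) l : rsum (fun i => c * f i)%R l = (c * rsum f l)%R.
Proof. induction l; simpl; [ring | rewrite IHl; ring]. Qed.

Lemma rsummable_plus {I} (f g : I -> R) :
  rsummable f -> rsummable g -> rsummable (fun i => f i + g i)%R.
Proof.
  intros [A HA] [B HB]. exists (A + B)%R. intros l Hl. rewrite rsum_plus.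
  specialize (HA l Hl); specialize (HB l Hl); lra.
Qed.

Lemma rsummable_scal {I} c (f : I -> R) :
  (0 <= c)%R -> rsummable f -> rsummable (fun i => c * f i)%R.
Proof.
  intros Hc [A HA]. exists (c * A)%R. intros l Hl. rewrite rsum_scal.
  apply Rmult_le_compat_l; auto.
Qed.

Lemma summable_plus {I} (f g : I -> C) :
  summable f -> summable g -> summable (fun i => f i + g i).
Proof.
  intros Hf Hg. eapply summable_le; [|apply (rsummable_plus _ _ Hf Hg)].
  intros i; apply Cmod_triangle.
Qed.

Lemma summable_scal {I} c (f : I -> C) : summable f -> summable (fun i => c * f i).
Proof.
  intros Hf. eapply summable_le; [|apply (rsummable_scal (Cmod c) _ (Cmod_ge_0 c) Hf)].
  intros i; simpl. rewrite Cmod_mult; lra.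
Qed.

Lemma summable_minus {I} (f g : I -> C) :
  summable f -> summable g -> summable (fun i => f i - g i).
Proof.
  intros Hf Hg. apply summable_ext with (fun i => f i + (-1) * g i); [intros; ring|].
  apply summable_plus, summable_scal; auto.
Qed.

Lemma summable_bounded {I} (f x : I -> C) M :
  (forall i, (Cmod (x i) <= M)%R) -> summable f -> summable (fun i => x i * f i).
Proof.
  intros HM Hf. apply summable_le with (fun i => (Rmax M 0 * Cmod (f i))%R).
  - intros i. rewrite Cmod_mult. apply Rmult_le_compat_r; [apply Cmod_ge_0|].
    eapply Rle_trans; [apply HM | apply Rmax_l].
  - apply rsummable_scal; auto. apply Rmax_r.
Qed.

Lemma csum_plus {I} (f g : I -> C) :
  summable f -> summable g -> csum (fun i => f i + g i) = csum f + csum g.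
Proof. intros Hf Hg. apply csum_eq, has_sum_plus; apply csum_spec; auto. Qed.

Lemma csum_scal {I} c (f : I -> C) : summable f -> csum (fun i => c * f i) = c * csum f.
Proof. intros Hf. apply csum_eq, has_sum_scal, csum_spec; auto. Qed.

Lemma csum_minus {I} (f g : I -> C) :
  summable f -> summable g -> csum (fun i => f i - g i) = csum f - csum g.
Proof.
  intros Hf Hg. rewrite (csum_ext _ (fun i => f i + (-1) * g i)) by (intros; ring).
  rewrite csum_plus, csum_scal; auto; [ring | apply summable_scal; auto].
Qed.

Lemma csum_opp {I} (f : I -> C) : summable f -> csum (fun i => - f i) = - csum f.
Proof.
  intros Hf. rewrite (csum_ext _ (fun i => (-1) * f i)) by (intros; ring).
  rewrite csum_scal; auto; ring.
Qed.

Lemma has_sum_norm {I} (f : I -> C) s B : has_sum f s ->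
  (forall l, NoDup l -> (rsum (fun i => Cmod (f i)) l <= B)%R) -> (Cmod s <= B)%R.
Proof.
  intros Hs HB. apply Rnot_lt_le. intros H.
  destruct (Hs (Cmod s - B)%R) as [l0 H0]; [lra|].
  specialize (H0 (nodup ceq_dec l0) (NoDup_nodup _ _)
     (fun x Hx => proj2 (nodup_In ceq_dec l0 x) Hx)).
  specialize (HB (nodup ceq_dec l0) (NoDup_nodup _ _)).
  pose proof (lsum_norm f (nodup ceq_dec l0)).
  assert (Cmod s <= Cmod (lsum f (nodup ceq_dec l0))
            + Cmod (lsum f (nodup ceq_dec l0) - s))%R.
  { replace s with (lsum f (nodup ceq_dec l0) + - (lsum f (nodup ceq_dec l0) - s)) at 1 by ring.
    eapply Rle_trans; [apply Cmod_triangle|]. rewrite Cmod_opp; lra. }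
  lra.
Qed.

Lemma csum_norm {I} (f : I -> C) (g : I -> R) B :
  (forall i, (Cmod (f i) <= g i)%R) -> (forall l, NoDup l -> (rsum g l <= B)%R) ->
  (Cmod (csum f) <= B)%R.
Proof.
  intros Hfg HB.
  apply has_sum_norm with f.
  - apply csum_spec, summable_le with g; auto. exists B; auto.
  - intros l Hl. eapply Rle_trans; [apply rsum_le, Hfg | auto].
Qed.

Lemma lsum_map {I J} (f : I -> C) (phi : J -> I) l :
  lsum f (map phi l) = lsum (fun j => f (phi j)) l.
Proof. induction l; simpl; congruence. Qed.

Lemma rsum_map {I J} (f : I -> R) (phi : J -> I) l :
  rsum f (map phi l) = rsum (fun j => f (phi j)) l.
Proof. induction l; simpl; congruence. Qed.

Lemma lsum_zero {I} (f : I -> C) l : (forall i, In i l -> f i = 0) -> lsum f l = 0.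
Proof.
  induction l; simpl; intros H; auto.
  rewrite IHl, H; auto. ring.
Qed.

Lemma NoDup_map_inj {I J} (phi : J -> I) l :
  (forall x y, phi x = phi y -> x = y) -> NoDup l -> NoDup (map phi l).
Proof.
  intros Hi H; induction H; simpl; constructor; auto.
  intros Hx. apply in_map_iff in Hx. destruct Hx as [y [Hy Hl]].
  apply Hi in Hy; subst; contradiction.
Qed.

Lemma rsummable_inj {I J} (g : I -> R) (phi : J -> I) :
  (forall x y, phi x = phi y -> x = y) -> rsummable g -> rsummable (fun j => g (phi j)).
Proof.
  intros Hi [B HB]. exists B. intros l Hl.
  rewrite <- rsum_map. apply HB, NoDup_map_inj; auto.
Qed.

Lemma summable_inj {I J} (f : I -> C) (phi : J -> I) :
  (forall x y, phi x = phi y -> x = y) -> summable f -> summable (fun j => f (phi j)).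
Proof. intros Hi Hf. apply (rsummable_inj (fun i => Cmod (f i)) phi Hi Hf). Qed.

Lemma has_sum_inj {I J} (f : I -> C) (phi : J -> I) s :
  (forall x y, phi x = phi y -> x = y) ->
  (forall i, f i <> 0 -> exists j, phi j = i) ->
  has_sum f s -> has_sum (fun j => f (phi j)) s.
Proof.
  intros Hi Hs Hf eps He. destruct (Hf eps He) as [l0 H0].
  assert (Hm : exists m0 : list J, forall j, In (phi j) l0 -> In j m0).
  { clear H0. induction l0 as [|a l0 [m0 Hm0]].
    - exists nil. simpl; auto.
    - destruct (classic (exists j, phi j = a)) as [[j Hj]|Hn].
      + exists (j :: m0). intros k [Hk|Hk]; [left; apply Hi; congruence | right; auto].
      + exists m0. intros k [Hk|Hk]; [exfalso; apply Hn; exists k; auto | auto]. }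
  destruct Hm as [m0 Hm0]. exists m0. intros m Hm Hinc.
  (* [rest] completes the image of [m] to a list that contains [l0]. The terms on it vanish: a
     nonzero one has a preimage, which lies in [m0] and hence in [m]. *)
  pose (rest := filter (fun i => if in_dec ceq_dec i (map phi m) then false else true)
                  (nodup ceq_dec l0)).
  assert (Hr : forall i, In i rest <-> (In i l0 /\ ~ In i (map phi m))).
  { intros i. unfold rest. rewrite filter_In, nodup_In.
    destruct (in_dec ceq_dec i (map phi m)); intuition discriminate. }
  specialize (H0 (map phi m ++ rest)). rewrite lsum_app, lsum_map in H0.
  rewrite (lsum_zero f rest) in H0.
  - rewrite Cplus_0_r in H0. apply H0.
    + apply NoDup_app.
      * apply NoDup_map_inj; auto.
      * apply NoDup_filter, NoDup_nodup.
      * intros i H1 H2. apply Hr in H2. tauto.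
    + intros i Hil. apply in_app_iff.
      destruct (in_dec ceq_dec i (map phi m)); [left; auto | right; apply Hr; auto].
  - intros i Hir. apply Hr in Hir. destruct Hir as [H1 H2].
    destruct (classic (f i = 0)) as [|Hne]; auto. exfalso.
    destruct (Hs i Hne) as [j <-]. apply H2, in_map, Hinc, Hm0; auto.
Qed.

Lemma csum_inj {I J} (f : I -> C) (phi : J -> I) :
  (forall x y, phi x = phi y -> x = y) ->
  (forall i, f i <> 0 -> exists j, phi j = i) ->
  summable f -> csum (fun j => f (phi j)) = csum f.
Proof. intros Hi Hs Hf. apply csum_eq, has_sum_inj; auto. apply csum_spec; auto. Qed.

Lemma csum_bij {I J} (f : I -> C) (phi : J -> I) (psi : I -> J) :
  (forall j, psi (phi j) = j) -> (forall i, phi (psi i) = i) ->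
  summable f -> csum (fun j => f (phi j)) = csum f.
Proof.
  intros H1 H2 Hf. apply csum_inj; auto.
  - intros x y H. rewrite <- (H1 x), <- (H1 y); congruence.
  - intros i _. exists (psi i); auto.
Qed.

Definition restrict {I} (P : I -> bool) (f : I -> C) (i : I) : C := if P i then f i else 0.

Lemma summable_restrict {I} (P : I -> bool) (f : I -> C) : summable f -> summable (restrict P f).
Proof.
  intros Hf. eapply summable_le; [|exact Hf]. intros i; unfold restrict; simpl.
  destruct (P i); [lra|]. rewrite Cmod_0; apply Cmod_ge_0.
Qed.

Lemma csum_split {I} (P : I -> bool) (f : I -> C) : summable f ->
  csum f = csum (restrict P f) + csum (restrict (fun i => negb (P i)) f).
Proof.
  intros Hf. rewrite <- csum_plus by (apply summable_restrict; auto).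
  apply csum_ext. intros i; unfold restrict. destruct (P i); simpl; ring.
Qed.

Lemma csum_restrict_inj {I J} (P : I -> bool) (f : I -> C) (phi : J -> I) :
  (forall x y, phi x = phi y -> x = y) -> (forall j, P (phi j) = true) ->
  (forall i, P i = true -> f i <> 0 -> exists j, phi j = i) -> summable f ->
  csum (restrict P f) = csum (fun j => f (phi j)).
Proof.
  intros Hi H1 H2 Hf. rewrite <- (csum_inj (restrict P f) phi); auto.
  - apply csum_ext. intros j; unfold restrict. rewrite H1; auto.
  - intros i; unfold restrict. destruct (P i) eqn:E; [auto | tauto].
  - apply summable_restrict; auto.
Qed.

Lemma summable_zero {I} : summable (fun _ : I => 0).
Proof.
  exists 0%R. intros l _. rewrite Cmod_0. induction l; simpl; lra.
Qed.

Lemma csum_zero {I} : csum (fun _ : I => 0) = 0.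
Proof.
  apply csum_eq. intros eps He. exists nil. intros l _ _.
  rewrite lsum_zero by auto. replace (0 - 0) with (0 : C) by ring. rewrite Cmod_0; auto.
Qed.

Lemma has_sum_single {I} (f : I -> C) i0 : (forall i, i <> i0 -> f i = 0) -> has_sum f (f i0).
Proof.
  intros H eps He. exists [i0]. intros l Hl Hi.
  destruct (in_split i0 l) as [l1 [l2 ->]]; [apply Hi; left; auto|].
  apply NoDup_remove_2 in Hl.
  rewrite lsum_app; simpl. rewrite (lsum_zero f l1), (lsum_zero f l2).
  - replace (0 + (f i0 + 0) - f i0) with (0 : C) by ring. rewrite Cmod_0; auto.
  - intros i Hin. apply H. intros ->. apply Hl, in_app_iff; auto.
  - intros i Hin. apply H. intros ->. apply Hl, in_app_iff; auto.
Qed.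

Lemma summable_single {I} (f : I -> C) i0 : (forall i, i <> i0 -> f i = 0) -> summable f.
Proof.
  intros H. exists (Cmod (f i0)). intros l Hl.
  induction Hl as [|i l Hn Hl IH]; simpl; [apply Cmod_ge_0|].
  destruct (ceq_dec i i0) as [->|Hne].
  - replace (rsum (fun i => Cmod (f i)) l) with 0%R; [lra|]. symmetry.
    clear IH Hl. induction l as [|a l IH]; simpl; auto.
    rewrite H, Cmod_0, IH; [ring| |]; simpl in Hn; intuition.
  - rewrite H, Cmod_0 by auto. lra.
Qed.

Lemma csum_single {I} (f : I -> C) i0 : (forall i, i <> i0 -> f i = 0) -> csum f = f i0.
Proof. intros H. apply csum_eq, has_sum_single; auto. Qed.

(** A single finite set of pairs approximates finitely many row sums at once, and it can be made to
    contain prescribed pairs on these rows. The estimate for the sums gives the value in Fubini's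
    theorem, the one for the moduli gives absolute summability of the row sums. *)
Lemma rows_approx {I J} (f : I * J -> C) (r : I -> C) (l0 : list (I * J)) delta L :
  (forall i, has_sum (fun j => f (i, j)) (r i)) -> (0 < delta)%R -> NoDup L ->
  exists M, NoDup M /\ (forall p, In p M -> In (fst p) L) /\
    (forall p, In p l0 -> In (fst p) L -> In p M) /\
    (Cmod (lsum f M - lsum r L) <= INR (length L) * delta)%R /\
    (rsum (fun i => Cmod (r i)) L
       <= rsum (fun p => Cmod (f p)) M + INR (length L) * delta)%R.
Proof.
  intros Hr Hd HL. induction HL as [|i L Hn HL [M [H1 [H2 [H3 [H4 H5]]]]]].
  - exists nil. simpl. split; [constructor|]. split; [tauto|]. split; [tauto|].
    replace (0 - 0) with (0 : C) by ring. rewrite Cmod_0. lra.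
  - destruct (Hr i delta Hd) as [m0 Hm0].
    pose (m := nodup ceq_dec (m0 ++ map snd l0)).
    assert (Hm : NoDup m) by apply NoDup_nodup.
    specialize (Hm0 m Hm).
    assert (Hin : incl m0 m) by (intros x Hx; apply nodup_In, in_app_iff; auto).
    specialize (Hm0 Hin).
    exists (map (pair i) m ++ M).
    assert (E : lsum f (map (pair i) m) = lsum (fun j => f (i, j)) m) by exact (lsum_map f (pair i) m).
    assert (E' : rsum (fun p => Cmod (f p)) (map (pair i) m)
                 = rsum (fun j => Cmod (f (i, j))) m)
      by exact (rsum_map (fun p => Cmod (f p)) (pair i) m).
    rewrite lsum_app, rsum_app, E, E'. simpl length. rewrite S_INR. simpl lsum; simpl rsum.
    split; [|split; [|split; [|split]]].
    + apply NoDup_app; auto.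
      * apply NoDup_map_inj; auto. intros x y; congruence.
      * intros p Hp HpM. apply in_map_iff in Hp. destruct Hp as [j [<- _]].
        apply H2 in HpM. contradiction.
    + intros p Hp. apply in_app_iff in Hp. destruct Hp as [Hp|Hp].
      * apply in_map_iff in Hp. destruct Hp as [j [<- _]]. left; auto.
      * right; auto.
    + intros [i' j] Hp [Ei|Hi]; apply in_app_iff.
      * simpl in Ei; subst i'. left. apply (in_map (pair i)), nodup_In, in_app_iff. right.
        apply (in_map snd _ _ Hp).
      * right; auto.
    + replace (lsum (fun j => f (i, j)) m + lsum f M - (r i + lsum r L))
        with ((lsum (fun j => f (i, j)) m - r i) + (lsum f M - lsum r L)) by ring.
      eapply Rle_trans; [apply Cmod_triangle|]. lra.
    + pose proof (lsum_norm (fun j => f (i, j)) m) as Hl. simpl in Hl.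
      assert (Cmod (r i) <= Cmod (lsum (fun j => f (i, j)) m)
                + Cmod (lsum (fun j => f (i, j)) m - r i))%R.
      { replace (r i) with (lsum (fun j => f (i, j)) m
            + - (lsum (fun j => f (i, j)) m - r i)) at 1 by ring.
        eapply Rle_trans; [apply Cmod_triangle|]. rewrite Cmod_opp; lra. }
      lra.
Qed.

Lemma has_sum_fubini {I J} (f : I * J -> C) (r : I -> C) s :
  has_sum f s -> (forall i, has_sum (fun j => f (i, j)) (r i)) -> has_sum r s.
Proof.
  intros Hs Hr eps He.
  destruct (Hs (eps / 2)%R) as [l0 H0]; [lra|].
  exists (map fst l0). intros L HL Hi.
  pose proof (pos_INR (length L)) as Hp.
  (* The tolerance is shared among the rows; the added 1 covers the empty list. *)
  destruct (rows_approx f r l0 (eps / 2 / (INR (length L) + 1)) L) as [M [H1 [H2 [H3 [H4 H5]]]]]; auto.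
  { apply Rdiv_lt_0_compat; lra. }
  assert (Hinc : incl l0 M) by (intros p Hp0; apply H3; auto; apply Hi, in_map; auto).
  specialize (H0 M H1 Hinc).
  assert (INR (length L) * (eps / 2 / (INR (length L) + 1)) <= eps / 2)%R.
  { replace (eps / 2)%R with ((INR (length L) + 1) * (eps / 2 / (INR (length L) + 1)))%R at 2
      by (field; lra).
    apply Rmult_le_compat_r; [|lra]. apply Rlt_le, Rdiv_lt_0_compat; lra. }
  replace (lsum r L - s) with ((lsum f M - s) + - (lsum f M - lsum r L)) by ring.
  eapply Rle_lt_trans; [apply Cmod_triangle|]. rewrite Cmod_opp. lra.
Qed.

Lemma summable_row {I J} (f : I * J -> C) i : summable f -> summable (fun j => f (i, j)).
Proof. intros Hf. apply (summable_inj f (pair i)); auto. intros x y; congruence. Qed.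

Lemma summable_rows {I J} (f : I * J -> C) :
  summable f -> summable (fun i => csum (fun j => f (i, j))).
Proof.
  intros [B HB]. exists B. intros L HL.
  apply Rnot_lt_le; intros H.
  pose proof (pos_INR (length L)) as Hp.
  set (S := rsum (fun i => Cmod (csum (fun j => f (i, j)))) L) in *.
  destruct (rows_approx f (fun i => csum (fun j => f (i, j))) nil
              ((S - B) / 2 / (INR (length L) + 1)) L) as [M [H1 [H2 [H3 [H4 H5]]]]]; auto.
  { intros i. apply csum_spec, summable_row. exists B; auto. }
  { apply Rdiv_lt_0_compat; lra. }
  specialize (HB M H1). fold S in H5.
  assert (INR (length L) * ((S - B) / 2 / (INR (length L) + 1)) <= (S - B) / 2)%R.
  { replace ((S - B) / 2)%R with ((INR (length L) + 1) * ((S - B) / 2 / (INR (length L) + 1)))%R at 2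
      by (field; lra).
    apply Rmult_le_compat_r; [|lra]. apply Rlt_le, Rdiv_lt_0_compat; lra. }
  lra.
Qed.

Lemma csum_fubini {I J} (f : I * J -> C) : summable f ->
  csum f = csum (fun i => csum (fun j => f (i, j))).
Proof.
  intros Hf. symmetry. apply csum_eq.
  apply has_sum_fubini with f; [apply csum_spec; auto|].
  intros i. apply csum_spec, summable_row; auto.
Qed.

Lemma summable_swap {I J} (f : I * J -> C) :
  summable f -> summable (fun p : J * I => f (snd p, fst p)).
Proof.
  intros Hf. apply (summable_inj f (fun p : J * I => (snd p, fst p))); auto.
  intros [a b] [c d]; simpl; congruence.
Qed.

Lemma csum_swap {I J} (f : I * J -> C) :
  summable f -> csum (fun p : J * I => f (snd p, fst p)) = csum f.
Proof.
  intros Hf.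
  apply (csum_bij f (fun p : J * I => (snd p, fst p)) (fun p => (snd p, fst p))); auto;
  intros []; auto.
Qed.

Lemma csum_exchange {I J} (f : I -> J -> C) : summable (fun p => f (fst p) (snd p)) ->
  csum (fun i => csum (fun j => f i j)) = csum (fun j => csum (fun i => f i j)).
Proof.
  intros Hf.
  transitivity (csum (fun p : I * J => f (fst p) (snd p))).
  - symmetry. apply (csum_fubini (fun p : I * J => f (fst p) (snd p))); auto.
  - rewrite <- (csum_swap (fun p : I * J => f (fst p) (snd p))) by auto.
    apply (csum_fubini (fun p : J * I => f (snd p) (fst p))).
    apply (summable_swap (fun p => f (fst p) (snd p))); auto.
Qed.

Lemma rsummable_prod {I J} (a : I -> R) (b : J -> R) :
  (forall i, (0 <= a i)%R) -> (forall j, (0 <= b j)%R) ->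
  rsummable a -> rsummable b -> rsummable (fun p => (a (fst p) * b (snd p))%R).
Proof.
  intros Ha Hb [A HA] [B HB]. exists (A * B)%R. intros l Hl.
  pose (l1 := nodup ceq_dec (map fst l)). pose (l2 := nodup ceq_dec (map snd l)).
  assert (H : forall (m1 : list I) (m2 : list J),
             rsum (fun p => (a (fst p) * b (snd p))%R) (list_prod m1 m2)
             = (rsum a m1 * rsum b m2)%R).
  { intros m1 m2; induction m1; simpl; [ring|].
    rewrite rsum_app, IHm1, rsum_map; simpl. rewrite rsum_scal. ring. }
  apply Rle_trans with (rsum a l1 * rsum b l2)%R.
  - rewrite <- H. apply rsum_incl; auto.
    + intros p. apply Rmult_le_pos; auto.
    + intros [i j] Hp. apply in_prod; apply nodup_In.
      * apply (in_map fst _ _ Hp).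
      * apply (in_map snd _ _ Hp).
  - apply Rmult_le_compat; try (apply rsum_nonneg; auto); [apply HA | apply HB]; apply NoDup_nodup.
Qed.

Lemma summable_prod {I J} (f : I -> C) (g : J -> C) :
  summable f -> summable g -> summable (fun p => f (fst p) * g (snd p)).
Proof.
  intros Hf Hg. eapply summable_le.
  - intros p. rewrite Cmod_mult. apply Rle_refl.
  - apply (rsummable_prod (fun i => Cmod (f i)) (fun j => Cmod (g j)));
      auto; intros; apply Cmod_ge_0.
Qed.

Lemma csum_prod {I J} (f : I -> C) (g : J -> C) :
  summable f -> summable g -> csum (fun p => f (fst p) * g (snd p)) = csum f * csum g.
Proof.
  intros Hf Hg. rewrite csum_fubini by (apply summable_prod; auto). simpl.
  rewrite (csum_ext _ (fun i => csum g * f i)).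
  - rewrite csum_scal; auto. ring.
  - intros i. rewrite csum_scal; auto. ring.
Qed.

(** Dominated convergence for series: outside a finite list that carries the sum of [g] up to a
    small remainder, [F n - f] is bounded by [2 g]; on the list pointwise convergence suffices. *)
Lemma tannery {I} (F : nat -> I -> C) (f : I -> C) (g : I -> R) :
  (forall n i, (Cmod (F n i) <= g i)%R) -> rsummable g ->
  (forall i, cv (fun n => F n i) (f i)) -> cv (fun n => csum (F n)) (csum f).
Proof.
  intros HF Hg Hcv eps He.
  assert (Hgp : forall i, (0 <= g i)%R).
  { intros i. eapply Rle_trans; [apply Cmod_ge_0 | apply (HF 0%nat i)]. }
  assert (Hf : forall i, (Cmod (f i) <= g i)%R).
  { intros i. apply Rnot_lt_le; intros H.
    destruct (Hcv i (Cmod (f i) - g i)%R) as [N HN]; [lra|].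
    specialize (HN N (le_n N)). specialize (HF N i).
    assert (Cmod (f i) <= Cmod (F N i) + Cmod (F N i - f i))%R.
    { replace (f i) with (F N i + - (F N i - f i)) at 1 by ring.
      eapply Rle_trans; [apply Cmod_triangle|]. rewrite Cmod_opp; lra. }
    lra. }
  destruct (has_sum_nonneg g Hgp Hg) as [S HS].
  destruct (HS (eps / 8)%R) as [l0 H0]; [lra|].
  pose (l := nodup ceq_dec l0).
  assert (Hl : NoDup l) by apply NoDup_nodup.
  assert (Hil : incl l0 l) by (intros x Hx; apply nodup_In; auto).
  assert (Htail : forall m, NoDup m -> (forall i, In i m -> ~ In i l) -> (rsum g m <= eps / 4)%R).
  { intros m Hm Hd.
    pose proof (H0 l Hl Hil) as E1.
    assert (E2 : (Cmod (lsum (fun i => RtoC (g i)) (m ++ l) - S) < eps / 8)%R).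
    { apply H0; [apply NoDup_app; auto|]. intros x Hx; apply in_app_iff; auto. }
    rewrite lsum_RtoC, <- RtoC_minus, Cmod_R in E1, E2.
    rewrite rsum_app in E2. apply Rabs_def2 in E1. apply Rabs_def2 in E2. lra. }
  assert (HN : exists N, forall n, (N <= n)%nat ->
            (rsum (fun i => Cmod (F n i - f i)) l < eps / 4)%R).
  { assert (forall d, (0 < d)%R -> exists N, forall n, (N <= n)%nat ->
            (rsum (fun i => Cmod (F n i - f i)) l <= d)%R) as H.
    { clear - Hcv. induction l as [|a l IH]; intros d Hd; simpl.
      - exists 0%nat; intros; lra.
      - destruct (IH (d / 2)%R) as [N1 H1]; [lra|].
        destruct (Hcv a (d / 2)%R) as [N2 H2]; [lra|].
        exists (max N1 N2). intros n Hn.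
        specialize (H1 n ltac:(lia)). specialize (H2 n ltac:(lia)). lra. }
    destruct (H (eps / 8)%R) as [N HN]; [lra|]. exists N. intros n Hn.
    specialize (HN n Hn). lra. }
  destruct HN as [N HN]. exists N. intros n Hn. specialize (HN n Hn).
  assert (S1 : summable (F n)) by (apply summable_le with g; auto).
  assert (S2 : summable f) by (apply summable_le with g; auto).
  rewrite <- csum_minus by auto.
  apply Rle_lt_trans with (eps / 2 + rsum (fun i => Cmod (F n i - f i)) l)%R; [|lra].
  apply (csum_norm _ (fun i => Cmod (F n i - f i))); [intros; lra|].
  intros m Hm.
  pose (m1 := filter (fun i => if in_dec ceq_dec i l then true else false) m).
  pose (m2 := filter (fun i => if in_dec ceq_dec i l then false else true) m).
  assert (E : rsum (fun i => Cmod (F n i - f i)) m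
     = (rsum (fun i => Cmod (F n i - f i)) m1 + rsum (fun i => Cmod (F n i - f i)) m2)%R).
  { unfold m1, m2. clear. induction m; simpl; [ring|].
    destruct (in_dec ceq_dec a l); simpl; rewrite IHm; ring. }
  rewrite E, Rplus_comm. apply Rplus_le_compat.
  - apply Rle_trans with (rsum (fun i => (2 * g i)%R) m2).
    + apply rsum_le. intros i. unfold Cminus. eapply Rle_trans; [apply Cmod_triangle|].
      rewrite Cmod_opp. specialize (HF n i). specialize (Hf i). lra.
    + rewrite rsum_scal. assert (rsum g m2 <= eps / 4)%R; [|lra].
      apply Htail.
      * apply NoDup_filter; auto.
      * intros i Hi. apply filter_In in Hi. destruct (in_dec ceq_dec i l); [|auto].
        destruct Hi; discriminate.
  - apply rsum_incl.
    + intros; apply Cmod_ge_0.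
    + apply NoDup_filter; auto.
    + intros i Hi. apply filter_In in Hi. destruct (in_dec ceq_dec i l); [auto|].
      destruct Hi; discriminate.
Qed.

(** * Limits and one-sided series *)

Lemma list_nat_bound (l : list nat) : exists N, forall n, In n l -> (n < N)%nat.
Proof.
  induction l as [|a l [N H]]; [exists 0%nat; simpl; tauto|].
  exists (S (max a N)). intros n [->|Hn]; [lia | specialize (H n Hn); lia].
Qed.

Lemma rsummable_nat (g : nat -> R) B : (forall n, (0 <= g n)%R) ->
  (forall n, (rsum g (seq 0 n) <= B)%R) -> rsummable g.
Proof.
  intros Hg HB. exists B. intros l Hl. destruct (list_nat_bound l) as [N HN].
  apply Rle_trans with (rsum g (seq 0 N)); auto.
  apply rsum_incl; auto. intros n Hn. apply in_seq. specialize (HN n Hn); lia.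
Qed.

Lemma rsummable_geom theta : (0 <= theta < 1)%R -> rsummable (fun n : nat => (theta ^ n)%R).
Proof.
  intros Ht. apply rsummable_nat with (/ (1 - theta))%R.
  - intros n; apply pow_le; lra.
  - intros n.
    assert (H : forall k m, ((1 - theta) * rsum (fun n => theta ^ n) (seq k m)
                   = theta ^ k - theta ^ (k + m))%R).
    { intros k m; revert k; induction m; intros k; simpl.
      - rewrite Nat.add_0_r. ring.
      - rewrite Rmult_plus_distr_l, IHm. rewrite <- plus_n_Sm. simpl. ring. }
    apply Rmult_le_reg_l with (1 - theta)%R; [lra|].
    rewrite H, Rinv_r by lra. simpl.
    assert (0 <= theta ^ n)%R by (apply pow_le; lra). lra.
Qed.

Lemma rsummable_Z (g : Z -> R) : (forall n, (0 <= g n)%R) ->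
  rsummable (fun n => g (Z.of_nat n)) -> rsummable (fun n => g (- Z.of_nat n)%Z) ->
  rsummable g.
Proof.
  intros Hg [A HA] [B HB]. exists (A + B)%R. intros l Hl.
  pose (l1 := filter (fun n => (0 <=? n)%Z) l).
  pose (l2 := filter (fun n => negb (0 <=? n)%Z) l).
  assert (E : rsum g l = (rsum g l1 + rsum g l2)%R).
  { unfold l1, l2. clear. induction l; simpl; [ring|].
    destruct (0 <=? a)%Z; simpl; rewrite IHl; ring. }
  rewrite E. apply Rplus_le_compat.
  - apply Rle_trans with (rsum (fun n => g (Z.of_nat n)) (map Z.to_nat l1)).
    + rewrite rsum_map. apply Req_le. unfold l1. clear. induction l; simpl; auto.
      destruct (Z.leb_spec 0 a); simpl; auto. rewrite IHl, Z2Nat.id; auto.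
    + apply HA. unfold l1. clear - Hl. induction Hl; simpl; [constructor|].
      destruct (Z.leb_spec 0 x); simpl; auto. constructor; auto.
      intros Hx. apply in_map_iff in Hx. destruct Hx as [y [Hy Hin]].
      apply filter_In in Hin. destruct Hin as [Hin Hp]. apply Z.leb_le in Hp.
      apply H. replace x with y by lia. auto.
  - apply Rle_trans with (rsum (fun n => g (- Z.of_nat n)%Z) (map (fun z => Z.to_nat (- z)) l2)).
    + rewrite rsum_map. apply Req_le. unfold l2. clear. induction l; simpl; auto.
      destruct (Z.leb_spec 0 a); simpl; auto. rewrite IHl, Z2Nat.id by lia.
      rewrite Z.opp_involutive; auto.
    + apply HB. unfold l2. clear - Hl. induction Hl; simpl; [constructor|].
      destruct (Z.leb_spec 0 x); simpl; auto. constructor; auto.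
      intros Hx. apply in_map_iff in Hx. destruct Hx as [y [Hy Hin]].
      apply filter_In in Hin. destruct Hin as [Hin Hp].
      destruct (Z.leb_spec 0 y); try discriminate.
      apply H. replace x with y by lia. auto.
Qed.

Lemma rsummable_geomZ theta : (0 <= theta < 1)%R -> rsummable (fun n : Z => (theta ^ Z.abs_nat n)%R).
Proof.
  intros Ht. apply rsummable_Z.
  - intros n; apply pow_le; lra.
  - eapply rsummable_le; [|apply rsummable_geom, Ht].
    intros n; simpl. rewrite Zabs2Nat.id. lra.
  - eapply rsummable_le; [|apply rsummable_geom, Ht].
    intros n; simpl. replace (Z.abs_nat (- Z.of_nat n)) with n by lia. lra.
Qed.

Lemma lsum_seq_S (f : nat -> C) n : lsum f (seq 0 (S n)) = lsum f (seq 0 n) + f n.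
Proof. rewrite seq_S, lsum_app; simpl. ring. Qed.

Lemma csum_cv (f : nat -> C) : summable f -> cv (fun n => lsum f (seq 0 n)) (csum f).
Proof.
  intros Hf eps He. destruct (csum_spec f Hf eps He) as [l0 H0].
  destruct (list_nat_bound l0) as [N HN]. exists N. intros n Hn.
  apply H0; [apply seq_NoDup|]. intros x Hx. apply in_seq. specialize (HN x Hx); lia.
Qed.

Lemma cv_unique u l m : cv u l -> cv u m -> l = m.
Proof.
  intros Hl Hm. destruct (Req_dec (Cmod (l - m)) 0) as [H|H].
  { apply Cmod_eq_0 in H. replace l with (l - m + m) by ring. rewrite H; ring. }
  exfalso. pose proof (Cmod_ge_0 (l - m)).
  destruct (Hl (Cmod (l - m) / 2)%R) as [N1 H1]; [lra|].
  destruct (Hm (Cmod (l - m) / 2)%R) as [N2 H2]; [lra|].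
  specialize (H1 (max N1 N2) ltac:(lia)). specialize (H2 (max N1 N2) ltac:(lia)).
  set (w := u (max N1 N2)) in *.
  assert (Cmod (l - m) <= Cmod (w - m) + Cmod (w - l))%R; [|lra].
  replace (l - m) with ((w - m) + - (w - l)) by ring.
  eapply Rle_trans; [apply Cmod_triangle|]. rewrite Cmod_opp. lra.
Qed.

Lemma cv_const c : cv (fun _ => c) c.
Proof.
  intros eps He. exists 0%nat. intros. replace (c - c) with (0 : C) by ring.
  rewrite Cmod_0; auto.
Qed.

Lemma cv_ext_from u v l N : (forall n, (N <= n)%nat -> u n = v n) -> cv u l -> cv v l.
Proof.
  intros H Hu eps He. destruct (Hu eps He) as [M HM].
  exists (max N M). intros n Hn. rewrite <- H by lia. apply HM; lia.
Qed.

Lemma cv_ext u v l : (forall n, u n = v n) -> cv u l -> cv v l.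
Proof. intros H. apply (cv_ext_from u v l 0); auto. Qed.

Lemma cv_lim u l m : cv u l -> l = m -> cv u m.
Proof. intros H <-; exact H. Qed.

Lemma cv_sub u l (phi : nat -> nat) : (forall n, (n <= phi n)%nat) -> cv u l ->
  cv (fun n => u (phi n)) l.
Proof.
  intros H Hu eps He. destruct (Hu eps He) as [N HN]. exists N. intros n Hn.
  apply HN. specialize (H n); lia.
Qed.

Lemma cv_plus u v l m : cv u l -> cv v m -> cv (fun n => u n + v n) (l + m).
Proof.
  intros Hu Hv eps He.
  destruct (Hu (eps / 2)%R) as [N1 H1]; [lra|]. destruct (Hv (eps / 2)%R) as [N2 H2]; [lra|].
  exists (max N1 N2). intros n Hn. specialize (H1 n ltac:(lia)). specialize (H2 n ltac:(lia)).
  replace (u n + v n - (l + m)) with ((u n - l) + (v n - m)) by ring.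
  eapply Rle_lt_trans; [apply Cmod_triangle|]. lra.
Qed.

Lemma cv_bounded u l : cv u l -> exists M, (0 < M)%R /\ forall n, (Cmod (u n) <= M)%R.
Proof.
  intros Hu. destruct (Hu 1%R) as [N HN]; [lra|].
  assert (H : exists M, (0 < M)%R /\ forall n, (n < N)%nat -> (Cmod (u n) <= M)%R).
  { clear HN. induction N as [|N [M [H0 HM]]]; [exists 1%R; split; [lra | intros; lia]|].
    exists (M + Cmod (u N))%R. pose proof (Cmod_ge_0 (u N)). split; [lra|].
    intros n Hn. destruct (Nat.eq_dec n N) as [->|]; [lra|].
    specialize (HM n ltac:(lia)). lra. }
  destruct H as [M [H0 HM]]. pose proof (Cmod_ge_0 l).
  exists (M + Cmod l + 1)%R. split; [lra|]. intros n.
  destruct (le_lt_dec N n) as [Hn|Hn].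
  - specialize (HN n Hn). replace (u n) with ((u n - l) + l) by ring.
    eapply Rle_trans; [apply Cmod_triangle|]. lra.
  - specialize (HM n Hn). lra.
Qed.

Lemma cv_0_mult u v M : (forall n, (Cmod (u n) <= M)%R) -> cv v 0 -> cv (fun n => u n * v n) 0.
Proof.
  intros HM Hv eps He.
  assert (0 <= M)%R by (eapply Rle_trans; [apply Cmod_ge_0 | apply (HM 0%nat)]).
  destruct (Hv (eps / (M + 1))%R) as [N HN]; [apply Rdiv_lt_0_compat; lra|].
  exists N. intros n Hn. specialize (HN n Hn). specialize (HM n).
  replace (u n * v n - 0) with (u n * v n) by ring. replace (v n - 0) with (v n) in HN by ring.
  rewrite Cmod_mult.
  assert (eps = ((M + 1) * (eps / (M + 1)))%R) by (field; lra).
  pose proof (Cmod_ge_0 (u n)). pose proof (Cmod_ge_0 (v n)). nra.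
Qed.

Lemma cv_shift_0 u l : cv u l -> cv (fun n => u n - l) 0.
Proof. intros H eps He. destruct (H eps He) as [N HN]. exists N. intros n Hn.
  replace (u n - l - 0) with (u n - l) by ring. auto. Qed.

Lemma cv_scal c u l : cv u l -> cv (fun n => c * u n) (c * l).
Proof.
  intros Hu. apply cv_ext with (fun n => c * (u n - l) + c * l); [intros; ring|].
  apply cv_lim with (0 + c * l); [|ring]. apply cv_plus; [|apply cv_const].
  apply (cv_0_mult (fun _ => c) _ (Cmod c)); [intros; lra | apply cv_shift_0; auto].
Qed.

Lemma cv_mult u v l m : cv u l -> cv v m -> cv (fun n => u n * v n) (l * m).
Proof.
  intros Hu Hv. apply cv_ext with (fun n => u n * (v n - m) + m * u n); [intros; ring|].
  apply cv_lim with (0 + m * l); [|ring]. apply cv_plus; [|apply cv_scal; auto].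
  destruct (cv_bounded u l Hu) as [M [_ HM]]. apply cv_0_mult with M; auto.
  apply cv_shift_0; auto.
Qed.

Lemma cv_inv_bounded u l : cv u l -> l <> 0 -> (forall n, u n <> 0) ->
  exists M, (0 < M)%R /\ forall n, (Cmod (/ u n) <= M)%R.
Proof.
  intros Hu Hl Hn. pose proof (proj1 (Cmod_gt_0 l) Hl) as Hp.
  destruct (Hu (Cmod l / 2)%R) as [N HN]; [lra|].
  assert (H : exists M, (0 < M)%R /\ forall n, (n < N)%nat -> (Cmod (/ u n) <= M)%R).
  { clear HN. induction N as [|N [M [H0 HM]]]; [exists 1%R; split; [lra | intros; lia]|].
    exists (M + Cmod (/ u N))%R. pose proof (Cmod_ge_0 (/ u N)). split; [lra|].
    intros n Hn'. destruct (Nat.eq_dec n N) as [->|]; [lra|].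
    specialize (HM n ltac:(lia)). lra. }
  destruct H as [M [H0 HM]].
  exists (M + 2 / Cmod l)%R. pose proof (Rdiv_lt_0_compat 2 (Cmod l) ltac:(lra) Hp).
  split; [lra|]. intros n.
  destruct (le_lt_dec N n) as [Hn'|Hn'].
  - specialize (HN n Hn'). rewrite Cmod_inv by auto.
    assert (Cmod l / 2 <= Cmod (u n))%R.
    { assert (Cmod l <= Cmod (u n) + Cmod (u n - l))%R; [|lra].
      replace l with (u n + - (u n - l)) at 1 by ring.
      eapply Rle_trans; [apply Cmod_triangle|]. rewrite Cmod_opp. lra. }
    assert (/ Cmod (u n) <= 2 / Cmod l)%R; [|lra].
    replace (2 / Cmod l)%R with (/ (Cmod l / 2))%R by (field; lra).
    apply Rinv_le_contravar; lra.
  - specialize (HM n Hn'). lra.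
Qed.

Lemma cv_inv u l : cv u l -> l <> 0 -> (forall n, u n <> 0) -> cv (fun n => / u n) (/ l).
Proof.
  intros Hu Hl Hn. destruct (cv_inv_bounded u l Hu Hl Hn) as [M [_ HM]].
  apply cv_ext with (fun n => / u n * ((-1) * / l * (u n - l)) + / l).
  - intros n. field; auto.
  - apply cv_lim with (0 + / l); [|ring]. apply cv_plus; [|apply cv_const].
    apply cv_0_mult with M; auto.
    apply (cv_0_mult (fun _ => _) _ (Cmod ((-1) * / l))); [intros; lra | apply cv_shift_0; auto].
Qed.

Lemma cv_Re_Im u l : cv u l ->
  is_lim_seq (fun n => Re (u n)) (Re l) /\ is_lim_seq (fun n => Im (u n)) (Im l).
Proof.
  intros Hu. split; apply is_lim_seq_spec; intros [eps He]; destruct (Hu eps He) as [N HN];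
    exists N; intros n Hn; specialize (HN n Hn); simpl.
  - change (Rabs (Re (u n - l)) < eps)%R.
    eapply Rle_lt_trans; [|exact HN]. eapply Rle_trans; [apply Rmax_l | apply Rmax_Cmod].
  - change (Rabs (Im (u n - l)) < eps)%R.
    eapply Rle_lt_trans; [|exact HN]. eapply Rle_trans; [apply Rmax_r | apply Rmax_Cmod].
Qed.

Lemma CLim_seq_cv u l : cv u l -> CLim_seq u = l.
Proof.
  intros Hu. apply cv_Re_Im in Hu. destruct Hu as [H1 H2].
  unfold CLim_seq. rewrite (is_lim_seq_unique _ _ H1), (is_lim_seq_unique _ _ H2).
  destruct l; auto.
Qed.

Lemma CSeries_cv f l : cv (fun n => lsum f (seq 0 n)) l -> CSeries f = l.
Proof.
  (* [sum_n] includes its last index, whence the passage to the subsequence along [S]. *)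
  intros H. apply (cv_sub _ _ S) in H; [|auto]. apply cv_Re_Im in H. destruct H as [H1 H2].
  unfold CSeries.
  assert (E : forall h : C -> R, h 0 = 0%R -> (forall x y, h (x + y) = (h x + h y)%R) ->
     forall n, h (lsum f (seq 0 (S n))) = sum_n (fun k => h (f k)) n).
  { intros h h0 hp n. induction n.
    - rewrite sum_O. simpl. rewrite hp, h0. ring.
    - rewrite lsum_seq_S, hp, IHn, sum_Sn. reflexivity. }
  rewrite (is_series_unique _ (Re l)), (is_series_unique _ (Im l)).
  - destruct l; auto.
  - apply (is_lim_seq_ext _ _ _ (E Im eq_refl (fun _ _ => eq_refl)) H2).
  - apply (is_lim_seq_ext _ _ _ (E Re eq_refl (fun _ _ => eq_refl)) H1).
Qed.

Lemma CSeries_csum f : summable f -> CSeries f = csum f.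
Proof. intros H. apply CSeries_cv, csum_cv, H. Qed.

Lemma is_series_cv (f : nat -> C) l :
  @is_series C_AbsRing C_NormedModule f l -> cv (fun n => lsum f (seq 0 n)) l.
Proof.
  intros H eps He.
  assert (Hf : filterlim (sum_n f) eventually (locally (T := C_NormedModule) l)) by exact H.
  pose proof (proj1 (filterlim_locally_ball_norm (K := C_AbsRing) (sum_n f) l) Hf (mkposreal eps He))
    as [N HN].
  exists (S N). intros [|n] Hn; [lia|]. specialize (HN n ltac:(lia)).
  replace (lsum f (seq 0 (S n))) with (sum_n f n); [exact HN|].
  clear. induction n.
  - rewrite sum_O. simpl. ring.
  - rewrite lsum_seq_S, sum_Sn, IHn. reflexivity.
Qed.

Lemma csum_Z_nat (f : Z -> C) : summable f ->
  csum f = csum (fun n => f (Z.of_nat n)) + csum (fun n => f (- Z.of_nat (S n))%Z).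
Proof.
  intros Hf. rewrite (csum_split (fun n => (0 <=? n)%Z) f Hf). f_equal.
  - apply csum_restrict_inj; auto; intros.
    + lia.
    + apply Z.leb_le; lia.
    + apply Z.leb_le in H. exists (Z.to_nat i). lia.
  - apply (csum_restrict_inj (fun n => negb (0 <=? n)%Z) f (fun n => - Z.of_nat (S n))%Z); auto.
    + intros; lia.
    + intros i Hi _. exists (Z.to_nat (- i - 1)). destruct (Z.leb_spec 0 i); try discriminate. lia.
Qed.

Lemma CZSeries_csum f : summable f -> CZSeries f = csum f.
Proof.
  intros H. unfold CZSeries. rewrite csum_Z_nat by auto.
  rewrite !CSeries_csum; auto.
  - apply (summable_inj f (fun n => - Z.of_nat (S n))%Z); auto. intros; lia.
  - apply (summable_inj f Z.of_nat); auto. intros; lia.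
Qed.

Lemma csum_S (f : nat -> C) : summable f -> csum f = f O + csum (fun n => f (S n)).
Proof.
  intros Hf. rewrite (csum_split (fun n => Nat.eqb n 0) f Hf). f_equal.
  - rewrite (csum_single _ O); auto. intros i Hi. unfold restrict.
    destruct (Nat.eqb_spec i 0); auto; contradiction.
  - apply (csum_restrict_inj (fun n => negb (Nat.eqb n 0)) f S); auto.
    intros [|i] H _; [discriminate | exists i; auto].
Qed.

Lemma csum_shift (k : Z) (f : Z -> C) : summable f -> csum (fun n => f (n + k)%Z) = csum f.
Proof.
  intros Hf. apply (csum_bij f (fun n => n + k)%Z (fun n => n - k)%Z); auto; intros; lia.
Qed.

Lemma csum_reflect (k : Z) (f : Z -> C) : summable f -> csum (fun n => f (k - n)%Z) = csum f.
Proof.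
  intros Hf. apply (csum_bij f (fun n => k - n)%Z (fun n => k - n)%Z); auto; intros; lia.
Qed.

Lemma summable_shift (k : Z) (f : Z -> C) : summable f -> summable (fun n => f (n + k)%Z).
Proof. intros Hf. apply (summable_inj f (fun n => n + k)%Z); auto; intros; lia. Qed.

Lemma summable_reflect (k : Z) (f : Z -> C) : summable f -> summable (fun n => f (k - n)%Z).
Proof. intros Hf. apply (summable_inj f (fun n => k - n)%Z); auto; intros; lia. Qed.

(** * Integer powers *)

Lemma Cpowz_nat (x : C) n : x ^^ (Z.of_nat n) = x ^ n.
Proof. destruct n; simpl; auto. rewrite SuccNat2Pos.id_succ. reflexivity. Qed.

Lemma Cpowz_opp_nat (x : C) n : x <> 0 -> x ^^ (- Z.of_nat n) = / x ^ n.
Proof.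
  intros Hx. destruct n; simpl; [field | rewrite SuccNat2Pos.id_succ; reflexivity].
Qed.

Lemma Cpowz_neq0 (x : C) n : x <> 0 -> x ^^ n <> 0.
Proof.
  intros Hx. destruct n; simpl.
  - apply C1_nz.
  - apply Cpow_nz; auto.
  - intros H. apply C1_nz. rewrite <- (Cinv_r (x ^ Pos.to_nat p)) by (apply Cpow_nz; auto).
    rewrite H. ring.
Qed.

Lemma Cpowz_S (x : C) n : x <> 0 -> x ^^ (n + 1) = x ^^ n * x.
Proof.
  intros Hx. destruct (Z_le_gt_dec 0 n) as [H|H].
  - rewrite <- (Z2Nat.id n) by auto.
    replace (Z.of_nat (Z.to_nat n) + 1)%Z with (Z.of_nat (S (Z.to_nat n))) by lia.
    rewrite !Cpowz_nat. simpl. ring.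
  - replace n with (- Z.of_nat (S (Z.to_nat (- n - 1))))%Z by lia.
    replace (- Z.of_nat (S (Z.to_nat (- n - 1))) + 1)%Z with (- Z.of_nat (Z.to_nat (- n - 1)))%Z by lia.
    rewrite !Cpowz_opp_nat by auto. simpl. field. split; auto. apply Cpow_nz; auto.
Qed.

Lemma Cpowz_add (x : C) m n : x <> 0 -> x ^^ (m + n) = x ^^ m * x ^^ n.
Proof.
  intros Hx. revert m. 
  assert (H : forall k m, x ^^ (m + Z.of_nat k) = x ^^ m * x ^^ (Z.of_nat k)).
  { intros k m. induction k.
    - simpl. rewrite Z.add_0_r. ring.
    - replace (m + Z.of_nat (S k))%Z with (m + Z.of_nat k + 1)%Z by lia.
      replace (Z.of_nat (S k)) with (Z.of_nat k + 1)%Z by lia.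
      rewrite !Cpowz_S, IHk by auto. ring. }
  intros m. destruct (Z_le_gt_dec 0 n) as [Hn|Hn].
  - rewrite <- (Z2Nat.id n) by auto. apply H.
  - pose proof (H (Z.to_nat (- n)) (m + n)%Z) as H1.
    pose proof (H (Z.to_nat (- n)) n) as H2.
    rewrite Z2Nat.id in H1, H2 by lia.
    replace (m + n + - n)%Z with m in H1 by lia. replace (n + - n)%Z with 0%Z in H2 by lia.
    simpl in H2. rewrite H1, <- Cmult_assoc, (Cmult_comm (x ^^ (- n))), <- H2. ring.
Qed.

Lemma Cpowz_opp (x : C) n : x <> 0 -> x ^^ (- n) = / x ^^ n.
Proof.
  intros Hx. assert (H : x ^^ (- n) * x ^^ n = 1).
  { rewrite <- Cpowz_add by auto. replace (- n + n)%Z with 0%Z by lia. reflexivity. }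
  pose proof (Cpowz_neq0 x n Hx). rewrite <- (Cmult_1_r (x ^^ (- n))).
  rewrite <- (Cinv_r (x ^^ n)) by auto. rewrite Cmult_assoc, H. ring.
Qed.

Lemma Cpowz_1 n : 1 ^^ n = 1.
Proof. destruct n; simpl; rewrite ?Cpow_1_l; auto. field. Qed.

Lemma Cpowz_mul (x : C) m n : x <> 0 -> x ^^ (m * n) = (x ^^ m) ^^ n.
Proof.
  intros Hx. pose proof (Cpowz_neq0 x m Hx) as Hm.
  assert (H : forall k, x ^^ (m * Z.of_nat k) = (x ^^ m) ^^ (Z.of_nat k)).
  { induction k.
    - rewrite Z.mul_0_r. reflexivity.
    - replace (m * Z.of_nat (S k))%Z with (m * Z.of_nat k + m)%Z by lia.
      replace (Z.of_nat (S k)) with (Z.of_nat k + 1)%Z by lia.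
      rewrite Cpowz_add, Cpowz_S, IHk by auto. reflexivity. }
  destruct (Z_le_gt_dec 0 n) as [Hn|Hn].
  - rewrite <- (Z2Nat.id n) by auto. apply H.
  - replace n with (- Z.of_nat (Z.to_nat (- n)))%Z by lia.
    rewrite <- Zopp_mult_distr_r, !Cpowz_opp, H by auto. reflexivity.
Qed.

Lemma Cpowz_mult_base (x y : C) n : x <> 0 -> y <> 0 -> (x * y) ^^ n = x ^^ n * y ^^ n.
Proof.
  intros Hx Hy. destruct n; simpl; [ring | apply Cpow_mult_l|].
  rewrite Cpow_mult_l. field. split; apply Cpow_nz; auto.
Qed.

Lemma Cpowz_m1 (x : C) : x ^^ (-1) = / x.
Proof. simpl. rewrite Cmult_1_r. reflexivity. Qed.

Lemma Cinv_nz (x : C) : x <> 0 -> / x <> 0.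
Proof. intros Hx. rewrite <- Cpowz_m1. apply Cpowz_neq0; auto. Qed.

Definition tri (n : Z) : Z := (n * (n - 1) / 2)%Z.

Lemma tri_spec n : (2 * tri n = n * n - n)%Z.
Proof.
  unfold tri. destruct (Z.Even_or_Odd n) as [[k ->]|[k ->]].
  - replace (2 * k * (2 * k - 1))%Z with (k * (2 * k - 1) * 2)%Z by ring.
    rewrite Z.div_mul by lia. ring.
  - replace ((2 * k + 1) * (2 * k + 1 - 1))%Z with (k * (2 * k + 1) * 2)%Z by ring.
    rewrite Z.div_mul by lia. ring.
Qed.

Ltac tri :=
  repeat match goal with
  | |- context [tri ?a] => pose proof (tri_spec a); generalize dependent (tri a); intros
  end; lia.

Lemma Cpowz_split (x : C) e a b : x <> 0 -> e = (a + b)%Z -> x ^^ e = x ^^ a * x ^^ b.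
Proof. intros Hx ->. apply Cpowz_add; auto. Qed.

Lemma m1_neq0 : (-1 : C) <> 0.
Proof. intros H. apply (f_equal Re) in H. simpl in H. lra. Qed.

Lemma C2_neq0 : (2 : C) <> 0.
Proof. intros H. apply (f_equal Re) in H. simpl in H. lra. Qed.

Lemma sgn_sq n : (-1) ^^ n * (-1) ^^ n = 1.
Proof.
  rewrite <- Cpowz_mult_base by apply m1_neq0.
  replace (-1 * -1) with (1 : C) by ring. apply Cpowz_1.
Qed.

(** The half difference [k] is an explicit argument, which turns a congruence modulo 2 into a linear
    goal for [lia]; likewise in [sgn_neg]. *)
Lemma sgn_eq k n m : (n = m + 2 * k)%Z -> (-1) ^^ n = (-1) ^^ m.
Proof.
  intros ->. rewrite Cpowz_add by apply m1_neq0.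
  replace (2 * k)%Z with (k + k)%Z by ring.
  rewrite (Cpowz_add _ k k), sgn_sq by apply m1_neq0. ring.
Qed.

Lemma sgn_neg k n m : (n = m + 2 * k + 1)%Z -> (-1) ^^ n = - (-1) ^^ m.
Proof.
  intros ->. rewrite (sgn_eq k _ (m + 1)) by lia. rewrite Cpowz_S by apply m1_neq0. ring.
Qed.

Lemma Cmod_m1 : Cmod (-1) = 1%R.
Proof. rewrite Cmod_R. rewrite Rabs_left1; lra. Qed.

Lemma Cmod_sgn n : Cmod ((-1) ^^ n) = 1%R.
Proof.
  assert (H : (Cmod ((-1) ^^ n) * Cmod ((-1) ^^ n) = 1)%R)
    by (rewrite <- Cmod_mult, sgn_sq; apply Cmod_1).
  pose proof (Cmod_ge_0 ((-1) ^^ n)). nra.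
Qed.

Lemma Cpowz_le (q : C) m n : q <> 0 -> (Cmod q < 1)%R -> (m <= n)%Z ->
  (Cmod (q ^^ n) <= Cmod (q ^^ m))%R.
Proof.
  intros Hq H1 Hmn. rewrite (Cpowz_split q n m (Z.of_nat (Z.to_nat (n - m)))) by (auto; lia).
  rewrite Cmod_mult, Cpowz_nat, Cmod_pow.
  assert (Cmod q ^ Z.to_nat (n - m) <= 1)%R.
  { rewrite <- (pow1 (Z.to_nat (n - m))). apply pow_incr. split; [apply Cmod_ge_0 | lra]. }
  pose proof (Cmod_ge_0 (q ^^ m)). nra.
Qed.

Section Powers.

Variable q : C.
Hypothesis Hq : q <> 0.
Hypothesis Hq1 : (Cmod q < 1)%R.

(** Reference exponents: through [summable_q], summability is reduced to bounding an integer
    exponent from below by such a [w], up to a constant. *)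
Definition weight {I} (w : I -> Z) : Prop := rsummable (fun i => Cmod (q ^^ (w i))).

Lemma weight_nat : weight Z.of_nat.
Proof.
  eapply rsummable_le; [|apply (rsummable_geom (Cmod q))].
  - intros n; simpl. rewrite Cpowz_nat, Cmod_pow. lra.
  - split; [apply Cmod_ge_0 | auto].
Qed.

Lemma weight_Z : weight Z.abs.
Proof.
  eapply rsummable_le; [|apply (rsummable_geomZ (Cmod q))].
  - intros n; simpl. replace (Z.abs n) with (Z.of_nat (Z.abs_nat n)) by lia.
    rewrite Cpowz_nat, Cmod_pow. lra.
  - split; [apply Cmod_ge_0 | auto].
Qed.

Lemma weight_prod {I J} (v : I -> Z) (w : J -> Z) :
  weight v -> weight w -> weight (fun p => v (fst p) + w (snd p))%Z.
Proof.
  intros Hv Hw. eapply rsummable_le; [|apply (rsummable_prod _ _ (fun i => Cmod_ge_0 (q ^^ v i))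
    (fun i => Cmod_ge_0 (q ^^ w i)) Hv Hw)].
  intros p; simpl. rewrite Cpowz_add, Cmod_mult by auto. lra.
Qed.

Lemma rsummable_q {I} (w e : I -> Z) M K : weight w -> (0 <= M)%R ->
  (forall i, (w i - K <= e i)%Z) -> rsummable (fun i => M * Cmod (q ^^ (e i)))%R.
Proof.
  intros Hw HM He. apply rsummable_scal; auto.
  eapply rsummable_le; [|apply (rsummable_scal (Cmod (q ^^ (- K))) _ (Cmod_ge_0 _) Hw)].
  intros i; simpl. rewrite <- Cmod_mult, <- Cpowz_add by auto.
  apply Cpowz_le; auto. specialize (He i). lia.
Qed.

Lemma summable_q {I} (w e : I -> Z) M K (F : I -> C) : weight w ->
  (forall i, (Cmod (F i) <= M * Cmod (q ^^ (e i)))%R) ->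
  (forall i, (w i - K <= e i)%Z) -> summable F.
Proof.
  intros Hw HF He. apply summable_le with (fun i => Rmax M 0 * Cmod (q ^^ (e i)))%R.
  - intros i. eapply Rle_trans; [apply HF|]. apply Rmult_le_compat_r; [apply Cmod_ge_0|].
    apply Rmax_l.
  - apply rsummable_q with w K; auto. apply Rmax_r.
Qed.

(** The powers of any nonzero [z] are measured in powers of [q], so that growth can be compared
    through integer exponents alone. The constant [b] serves both [z] and its inverse. *)
Lemma powz_bound (z : C) : z <> 0 ->
  exists b, (0 <= b)%Z /\ forall n, (Cmod (z ^^ n) <= Cmod (q ^^ (- b * Z.abs n)))%R.
Proof.
  intros Hz.
  assert (Hb : forall y : R, exists b : nat, (y <= Cmod (q ^^ (- Z.of_nat b)))%R).
  { intros y. assert (Hp : (0 < Cmod q)%R) by (apply Cmod_gt_0; auto).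
    destruct (Pow_x_infinity (/ Cmod q)) with (b := y) as [N HN].
    - rewrite Rabs_right; [|left; apply Rinv_0_lt_compat; auto].
      rewrite <- Rinv_1. apply Rinv_lt_contravar; lra.
    - exists N. specialize (HN N (le_n N)). rewrite Cpowz_opp_nat, Cmod_inv, Cmod_pow by (auto; apply Cpow_nz; auto).
      rewrite pow_inv, Rabs_right in HN; [lra|].
      left. apply Rinv_0_lt_compat, pow_lt; auto. }
  destruct (Hb (Cmod z)) as [b1 H1]. destruct (Hb (Cmod (/ z))) as [b2 H2].
  exists (Z.of_nat (max b1 b2)). split; [lia|].
  assert (H : forall (y : C) b, y <> 0 -> (b <= max b1 b2)%nat ->
            (Cmod y <= Cmod (q ^^ (- Z.of_nat b)))%R ->
            forall k : nat, (Cmod (y ^^ Z.of_nat k)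
                      <= Cmod (q ^^ (- Z.of_nat (max b1 b2) * Z.of_nat k)))%R).
  { intros y b Hy Hbm Hyb k.
    apply Rle_trans with (Cmod (q ^^ (- Z.of_nat b * Z.of_nat k))).
    - rewrite Cpowz_mul, !Cpowz_nat, !Cmod_pow by auto. apply pow_incr.
      split; [apply Cmod_ge_0 | auto].
    - apply Cpowz_le; auto. nia. }
  intros n. destruct (Z_le_gt_dec 0 n) as [Hn|Hn].
  - replace n with (Z.of_nat (Z.to_nat n)) at 1 by lia.
    replace (Z.abs n) with (Z.of_nat (Z.to_nat n)) by lia. apply (H z b1); auto; lia.
  - replace (Z.abs n) with (Z.of_nat (Z.to_nat (- n))) by lia.
    replace (z ^^ n) with ((/ z) ^^ (Z.of_nat (Z.to_nat (- n)))).
    + apply (H (/ z) b2); auto; [|lia]. intros H0. apply C1_nz.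
      rewrite <- (Cinv_r z), H0 by auto. ring.
    + replace n with (- Z.of_nat (Z.to_nat (- n)))%Z at 2 by lia.
      rewrite Cpowz_nat, Cpowz_opp_nat, Cpow_inv by auto. reflexivity.
Qed.

Definition theta_term (z : C) (n : Z) : C := (-1) ^^ n * q ^^ (tri n) * z ^^ n.

(** Completing the square in |n|: quadratic growth beats every linear one. *)
Lemma tri_lower c n : (2 * c * Z.abs n - (2 * c + 1) * (2 * c + 1) <= 2 * tri n)%Z.
Proof.
  rewrite tri_spec. replace (n * n)%Z with (Z.abs n * Z.abs n)%Z by (rewrite Z.abs_square; auto).
  assert (Ha : (n <= Z.abs n)%Z) by lia. generalize dependent (Z.abs n). intros m Ha.
  pose proof (Z.square_nonneg (2 * m - (2 * c + 1))). pose proof (Z.square_nonneg (2 * c + 1)). nia.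
Qed.

Lemma summable_theta (z : C) : z <> 0 -> summable (theta_term z).
Proof.
  intros Hz. destruct (powz_bound z Hz) as [b [Hb0 Hb]].
  apply (summable_q Z.abs (fun n => tri n - b * Z.abs n)%Z 1 ((2 * (b + 1) + 1) * (2 * (b + 1) + 1))).
  - apply weight_Z.
  - intros n. unfold theta_term. rewrite !Cmod_mult, Cmod_sgn, !Rmult_1_l.
    rewrite (Cpowz_split q (tri n - b * Z.abs n) (tri n) (- b * Z.abs n)) by (auto; lia).
    rewrite Cmod_mult. apply Rmult_le_compat_l; [apply Cmod_ge_0 | auto].
  - intros n. pose proof (tri_lower (b + 1) n). nia.
Qed.

Lemma jtheta_csum (z : C) : z <> 0 -> jtheta z q = csum (theta_term z).
Proof.
  intros Hz. unfold jtheta. rewrite CZSeries_csum; [reflexivity|].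
  apply (summable_theta z Hz).
Qed.

End Powers.

(** * Infinite products and the triple product *)

Lemma Cprod_ext f g n : (forall i, f i = g i) -> Cprod f n = Cprod g n.
Proof. intros H. induction n; simpl; congruence. Qed.

(** The partial products P_n are bounded by the exponential of the sum of the moduli, and
    consecutive ones differ by P_n a_n, so they converge like an absolutely convergent series. The
    limit is nonzero: beyond an index N after which the moduli sum to at most 1/2, the products stay
    above half of |P_N|. *)
Lemma Cprod_cv (a : nat -> C) : summable a -> (forall n, 1 - a n <> 0) ->
  exists l, cv (Cprod (fun i => 1 - a i)) l /\ l <> 0.
Proof.
  intros [B HB] Hn. set (P := Cprod (fun i => 1 - a i)).
  assert (HS : forall n, (rsum (fun i => Cmod (a i)) (seq 0 (S n))
              = rsum (fun i => Cmod (a i)) (seq 0 n) + Cmod (a n))%R).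
  { intros n. rewrite seq_S, rsum_app. simpl. ring. }
  assert (HP : forall n, (Cmod (P n) <= exp (rsum (fun i => Cmod (a i)) (seq 0 n)))%R).
  { induction n.
    - change (Cmod 1 <= exp 0)%R. rewrite Cmod_1, exp_0. lra.
    - rewrite HS, exp_plus. change (P (S n)) with (P n * (1 - a n)). rewrite Cmod_mult.
      apply Rmult_le_compat; auto using Cmod_ge_0.
      eapply Rle_trans; [apply Cmod_triangle|]. rewrite Cmod_1, Cmod_opp.
      pose proof (Cmod_ge_0 (a n)). destruct (Req_dec (Cmod (a n)) 0) as [->|Hne].
      + rewrite exp_0; lra.
      + apply Rlt_le, exp_ineq1. lra. }
  assert (HPb : forall n, (Cmod (P n) <= exp B)%R).
  { intros n. eapply Rle_trans; [apply HP|]. specialize (HB (seq 0 n) (seq_NoDup _ _)).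
    destruct (Rle_lt_or_eq_dec _ _ HB) as [H|H]; [left; apply exp_increasing; auto | rewrite H; lra]. }
  assert (Hs : summable (fun n => P n * a n)).
  { apply summable_bounded with (exp B); auto. exists B; auto. }
  assert (Hcv : cv P (1 - csum (fun n => P n * a n))).
  { apply cv_ext with (fun n => 1 + (-1) * lsum (fun n => P n * a n) (seq 0 n)).
    - induction n; [change (1 + (-1) * 0 = 1); ring|].
      rewrite lsum_seq_S. change (P (S n)) with (P n * (1 - a n)). 
      transitivity (1 + (-1) * lsum (fun n => P n * a n) (seq 0 n) - P n * a n); [ring|].
      rewrite IHn. ring.
    - apply cv_lim with (1 + (-1) * csum (fun n => P n * a n)); [|ring].
      apply cv_plus; [apply cv_const|]. apply cv_scal, csum_cv, Hs. }
  exists (1 - csum (fun n => P n * a n)). split; auto.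
  destruct (csum_spec a (ex_intro _ B HB)) with (eps := 1%R) as [l0 _]; [lra|].
  assert (Htail : exists N, forall k, (rsum (fun i => Cmod (a i)) (seq N k) <= / 2)%R).
  { destruct (has_sum_nonneg (fun i => Cmod (a i))) as [S HSm];
      [intros; apply Cmod_ge_0 | exists B; auto |].
    destruct (HSm (/ 4)%R) as [m Hm]; [lra|].
    destruct (list_nat_bound m) as [N HN]. exists N. intros k.
    assert (Hi : forall j, incl m (seq 0 (N + j))).
    { intros j x Hx. apply in_seq. specialize (HN x Hx). lia. }
    pose proof (Hm (seq 0 (N + 0)) (seq_NoDup _ _) (Hi 0%nat)) as E1.
    pose proof (Hm (seq 0 (N + k)) (seq_NoDup _ _) (Hi k)) as E2.
    rewrite lsum_RtoC, <- RtoC_minus, Cmod_R in E1, E2.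
    rewrite Nat.add_0_r in E1. rewrite seq_app, rsum_app in E2.
    apply Rabs_def2 in E1. apply Rabs_def2 in E2. simpl in E2. lra. }
  destruct Htail as [N HN].
  (* Weierstrass's inequality: a product of factors 1 - t_i is at least 1 minus the sum of the
     t_i. *)
  assert (Hlow : forall k, (Cmod (P N) * (1 - rsum (fun i => Cmod (a i)) (seq N k))
                    <= Cmod (P (N + k)%nat))%R).
  { induction k.
    - simpl. rewrite Nat.add_0_r. lra.
    - rewrite seq_S, rsum_app, <- plus_n_Sm.
      change (P (S (N + k))) with (P (N + k)%nat * (1 - a (N + k)%nat)). simpl rsum.
      rewrite Cmod_mult.
      assert (1 - Cmod (a (N + k)%nat) <= Cmod (1 - a (N + k)%nat))%R.
      { pose proof (Cmod_triangle (1 - a (N + k)%nat) (a (N + k)%nat)) as Ht.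
        replace (1 - a (N + k)%nat + a (N + k)%nat) with (RtoC 1) in Ht by ring.
        rewrite Cmod_1 in Ht. lra. }
      pose proof (HN (S k)) as H2. rewrite seq_S, rsum_app in H2. simpl in H2.
      pose proof (rsum_nonneg (fun i => Cmod (a i)) (seq N k) (fun i => Cmod_ge_0 (a i))).
      pose proof (Cmod_ge_0 (a (N + k)%nat)). pose proof (Cmod_ge_0 (P N)).
      set (s := rsum (fun i => Cmod (a i)) (seq N k)) in *.
      set (t := Cmod (a (N + k)%nat)) in *.
      apply Rle_trans with (Cmod (P (N + k)%nat) * (1 - t))%R.
      + clearbody s t. apply Rle_trans with (Cmod (P N) * (1 - s) * (1 - t))%R; [|].
        { assert (0 <= Cmod (P N) * s * t)%R by (repeat apply Rmult_le_pos; auto). lra. }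
        apply Rmult_le_compat_r; [|exact IHk]. lra.
      + apply Rmult_le_compat_l; auto. apply Cmod_ge_0. }
  assert (HPN : (0 < Cmod (P N))%R).
  { apply Cmod_gt_0. clear - Hn. unfold P. induction N; simpl; [apply C1_nz|].
    apply Cmult_neq_0; auto. }
  intros H0. rewrite H0 in Hcv.
  destruct (Hcv (Cmod (P N) / 2)%R) as [M HM]; [lra|].
  specialize (HM (N + M)%nat ltac:(lia)). specialize (Hlow M). specialize (HN M).
  replace (P (N + M)%nat - 0) with (P (N + M)%nat) in HM by ring. nra.
Qed.

Definition pinf (x q : C) : C := CLim_seq (qpoch x q).

(** The inverse of (q)_n with the convention that it is 0 for n < 0. Finite sums thereby become sums
    over all integers, which can be shifted freely. *)
Definition iq (q : C) (n : Z) : C :=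
  if (n <? 0)%Z then 0 else / qpoch q q (Z.to_nat n).

Section QSeries.

Variable q : C.
Hypothesis Hq : q <> 0.
Hypothesis Hq1 : (Cmod q < 1)%R.

Lemma summable_geom (x : C) : summable (fun n => q ^ n * x).
Proof.
  apply (summable_q q Hq Hq1 Z.of_nat Z.of_nat (Cmod x) 0); [apply weight_nat; auto| |intros; lia].
  intros n. rewrite Cmod_mult, Cpowz_nat. lra.
Qed.

(** A vanishing factor is allowed, the products being then eventually 0; this is what makes
    [qpoch_cv] hold for every [x]. *)
Lemma qpoch_lim (x : C) : exists l, cv (qpoch x q) l /\ ((forall n, q ^ n * x <> 1) -> l <> 0).
Proof.
  destruct (classic (forall n, q ^ n * x <> 1)) as [H|H].
  - destruct (Cprod_cv (fun i => q ^ i * x)) as [l [H1 H2]].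
    + apply summable_geom.
    + intros n Hn. apply (H n). replace (q ^ n * x) with (1 - (1 - q ^ n * x)) by ring.
      rewrite Hn; ring.
    + exists l; auto.
  - exists 0. split; [|tauto].
    apply not_all_ex_not in H. destruct H as [N HN]. apply NNPP in HN.
    apply cv_ext_from with (u := fun _ => 0) (N := S N); [|apply cv_const].
    intros n Hn. induction Hn as [|n Hn IH].
    + unfold qpoch. simpl. rewrite HN. ring.
    + change (qpoch x q (S n)) with (qpoch x q n * (1 - q ^ n * x)). rewrite <- IH. ring.
Qed.

Lemma qpoch_cv (x : C) : cv (qpoch x q) (pinf x q).
Proof.
  destruct (qpoch_lim x) as [l [H _]]. unfold pinf. rewrite (CLim_seq_cv _ l H). auto.
Qed.

Lemma pinf_neq0 (x : C) : (forall n, q ^ n * x <> 1) -> pinf x q <> 0.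
Proof.
  intros H. destruct (qpoch_lim x) as [l [H1 H2]]. unfold pinf.
  rewrite (CLim_seq_cv _ l H1). auto.
Qed.

Lemma qpow_neq1 n : q ^ n * q <> 1.
Proof.
  intros H. apply (f_equal Cmod) in H. rewrite Cmod_mult, Cmod_pow, Cmod_1 in H.
  pose proof (Cmod_ge_0 q).
  assert (Cmod q ^ n <= 1)%R.
  { rewrite <- (pow1 n). apply pow_incr; lra. }
  nra.
Qed.

Lemma qpoch_q_neq0 n : qpoch q q n <> 0.
Proof.
  induction n; [apply C1_nz|].
  change (qpoch q q (S n)) with (qpoch q q n * (1 - q ^ n * q)).
  apply Cmult_neq_0; auto. intros H. apply (qpow_neq1 n).
  replace (q ^ n * q) with (1 - (1 - q ^ n * q)) by ring. rewrite H; ring.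
Qed.

Lemma pinf_q_neq0 : pinf q q <> 0.
Proof. apply pinf_neq0, qpow_neq1. Qed.

Lemma qinf_pinf : qinf q = pinf q q.
Proof.
  unfold qinf, Cprod_inf, pinf. f_equal. apply functional_extensionality. intros n.
  apply Cprod_ext. intros i. simpl. ring.
Qed.

Lemma iq_rec n : (1 - q ^^ n) * iq q n = iq q (n - 1).
Proof.
  unfold iq. destruct (Z.ltb_spec n 0), (Z.ltb_spec (n - 1) 0); try lia; try ring.
  - replace n with 0%Z by lia. simpl. ring.
  - replace (Z.to_nat n) with (S (Z.to_nat (n - 1))) by lia.
    change (qpoch q q (S (Z.to_nat (n - 1))))
      with (qpoch q q (Z.to_nat (n - 1)) * (1 - q ^ (Z.to_nat (n - 1)) * q)).
    replace (q ^^ n) with (q ^ (Z.to_nat (n - 1)) * q).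
    + field. split; [apply qpoch_q_neq0|].
      intros H1. apply (qpow_neq1 (Z.to_nat (n - 1))).
      set (t := q ^ Z.to_nat (n - 1) * q) in *. replace t with (1 - (1 - t)) by ring. rewrite H1; ring.
    + rewrite <- Cpowz_nat, <- Cpowz_S by auto. f_equal. lia.
Qed.

Lemma iq_0 : iq q 0 = 1.
Proof. unfold iq; simpl. unfold qpoch; simpl. field. Qed.

Lemma iq_neg n : (n < 0)%Z -> iq q n = 0.
Proof. intros H. unfold iq. destruct (Z.ltb_spec n 0); auto; lia. Qed.

Lemma iq_bounded : exists M, (0 < M)%R /\ forall n, (Cmod (iq q n) <= M)%R.
Proof.
  destruct (cv_inv_bounded _ _ (qpoch_cv q) pinf_q_neq0 qpoch_q_neq0) as [M [H0 HM]].
  exists M. split; auto. intros n. unfold iq. destruct (n <? 0)%Z; auto.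
  rewrite Cmod_0. lra.
Qed.

Lemma iq_cv k : cv (fun n => iq q (Z.of_nat n + k)) (/ pinf q q).
Proof.
  pose proof (cv_inv _ _ (qpoch_cv q) pinf_q_neq0 qpoch_q_neq0) as H.
  intros eps He. destruct (H eps He) as [N HN].
  exists (N + Z.to_nat (Z.abs k))%nat. intros n Hn. unfold iq.
  destruct (Z.ltb_spec (Z.of_nat n + k) 0); [lia|]. apply HN. lia.
Qed.

(* Finite form of the Jacobi triple product *)
Definition fin_theta (A B : nat) (z : C) : C :=
  csum (fun r => iq q (Z.of_nat A - r) * iq q (Z.of_nat B + r) * theta_term q z r).

Lemma summable_iq2 {I} (a b : I -> Z) (f : I -> C) :
  summable f -> summable (fun i => iq q (a i) * iq q (b i) * f i).
Proof.
  intros Hf. destruct iq_bounded as [M [H0 HM]].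
  apply summable_bounded with (M * M)%R; auto. intros i. rewrite Cmod_mult.
  apply Rmult_le_compat; auto using Cmod_ge_0.
Qed.

Lemma theta_term_shift (z : C) r : z <> 0 ->
  theta_term q z (r + 1) = - z * q ^^ r * theta_term q z r.
Proof.
  intros Hz. unfold theta_term.
  rewrite (Cpowz_split q (tri (r + 1)) (tri r) r) by (auto; tri).
  rewrite !Cpowz_S by (auto using m1_neq0). ring.
Qed.

(** With u = q^(A+1-r) and v = q^(B+r), write 1 - u v = (1 - u) + u (1 - v). The first part lowers
    the index of one factor [iq], the second that of the other, and they give the terms r and r - 1
    of the old sum. *)
Lemma fin_theta_SA A B (z : C) : z <> 0 ->
  (1 - q ^^ (Z.of_nat (A + B + 1))) * fin_theta (S A) B z
  = (1 - z * q ^ A) * fin_theta A B z.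
Proof.
  intros Hz. unfold fin_theta.
  pose proof (summable_theta q Hq Hq1 z Hz) as Hth.
  set (f := fun r => iq q (Z.of_nat A - r) * iq q (Z.of_nat B + r) * theta_term q z r).
  assert (Hf : summable f) by (apply summable_iq2; auto).
  assert (Hs : summable (fun r => iq q (Z.of_nat (S A) - r) * iq q (Z.of_nat B + r) * theta_term q z r))
    by (apply summable_iq2; auto).
  rewrite <- csum_scal by auto.
  rewrite (csum_ext _ (fun r => f r + (- z * q ^ A) * f (r + - (1))%Z)).
  - rewrite csum_plus, csum_scal.
    + rewrite (csum_shift (- (1)) f Hf). ring.
    + apply (summable_shift (- (1)) f Hf).
    + auto.
    + apply summable_scal, (summable_shift (- (1)) f Hf).
  - intros r. unfold f.
    replace (iq q (Z.of_nat A - r)) with ((1 - q ^^ (Z.of_nat (S A) - r)) * iq q (Z.of_nat (S A) - r))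
      by (rewrite iq_rec; f_equal; lia).
    replace (iq q (Z.of_nat B + (r + - (1)))) with ((1 - q ^^ (Z.of_nat B + r)) * iq q (Z.of_nat B + r))
      by (rewrite iq_rec; f_equal; lia).
    replace (theta_term q z r) with (- z * q ^^ (r - 1) * theta_term q z (r - 1))
      by (rewrite <- theta_term_shift by auto; f_equal; lia).
    replace (r + - (1))%Z with (r - 1)%Z by lia.
    replace (Z.of_nat A - (r - 1))%Z with (Z.of_nat (S A) - r)%Z by lia.
    rewrite <- Cpowz_nat.
    rewrite (Cpowz_split q (Z.of_nat (A + B + 1)) (Z.of_nat (S A) - r) (Z.of_nat B + r)) by (auto; lia).
    rewrite (Cpowz_split q (Z.of_nat A) (Z.of_nat (S A) - r) (r - 1)) by (auto; lia).
    ring.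
Qed.

Lemma fin_theta_SB A B (z : C) : z <> 0 ->
  (1 - q ^^ (Z.of_nat (A + B + 1))) * fin_theta A (S B) z
  = (1 - q / z * q ^ B) * fin_theta A B z.
Proof.
  intros Hz. unfold fin_theta.
  pose proof (summable_theta q Hq Hq1 z Hz) as Hth.
  set (f := fun r => iq q (Z.of_nat A - r) * iq q (Z.of_nat B + r) * theta_term q z r).
  assert (Hf : summable f) by (apply summable_iq2; auto).
  assert (Hs : summable (fun r => iq q (Z.of_nat A - r) * iq q (Z.of_nat (S B) + r) * theta_term q z r))
    by (apply summable_iq2; auto).
  rewrite <- csum_scal by auto.
  rewrite (csum_ext _ (fun r => f r + (- (q / z) * q ^ B) * f (r + 1)%Z)).
  - rewrite csum_plus, csum_scal.
    + rewrite (csum_shift 1 f Hf). ring.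
    + apply (summable_shift 1 f Hf).
    + auto.
    + apply summable_scal, (summable_shift 1 f Hf).
  - intros r. unfold f.
    replace (iq q (Z.of_nat B + r)) with ((1 - q ^^ (Z.of_nat (S B) + r)) * iq q (Z.of_nat (S B) + r))
      by (rewrite iq_rec; f_equal; lia).
    replace (iq q (Z.of_nat A - (r + 1))) with ((1 - q ^^ (Z.of_nat A - r)) * iq q (Z.of_nat A - r))
      by (rewrite iq_rec; f_equal; lia).
    rewrite theta_term_shift by auto.
    replace (Z.of_nat B + (r + 1))%Z with (Z.of_nat (S B) + r)%Z by lia.
    rewrite <- Cpowz_nat.
    rewrite (Cpowz_split q (Z.of_nat (A + B + 1)) (Z.of_nat (S B) + r) (Z.of_nat A - r)) by (auto; lia).
    rewrite (Cpowz_split q (Z.of_nat (S B) + r) (Z.of_nat B + r) 1) by (auto; lia).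
    rewrite (Cpowz_split q (Z.of_nat B + r) (Z.of_nat B) r) by (auto; lia).
    change (q ^^ 1) with (q ^ 1). rewrite Cpow_1_r. field. auto.
Qed.

Lemma qpoch_S (x : C) n : qpoch x q (S n) = qpoch x q n * (1 - q ^ n * x).
Proof. reflexivity. Qed.

Lemma fin_triple_product A B (z : C) : z <> 0 ->
  qpoch q q (A + B) * fin_theta A B z = qpoch z q A * qpoch (q / z) q B.
Proof.
  intros Hz. revert A. induction B as [|B IHB]; intros A.
  - induction A as [|A IHA].
    + unfold fin_theta. rewrite (csum_single _ 0%Z).
      * change (Z.of_nat 0 - 0)%Z with 0%Z. change (Z.of_nat 0 + 0)%Z with 0%Z. rewrite !iq_0.
        unfold qpoch, theta_term, tri. simpl. ring.
      * intros r Hr. destruct (Z_lt_le_dec r 0).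
        -- rewrite (iq_neg (Z.of_nat 0 + r)) by lia. ring.
        -- rewrite (iq_neg (Z.of_nat 0 - r)) by lia. ring.
    + change (S A + 0)%nat with (S (A + 0)). rewrite !qpoch_S.
      transitivity (qpoch q q (A + 0) * ((1 - q ^^ (Z.of_nat (A + 0 + 1))) * fin_theta (S A) 0 z)).
      * rewrite Cpowz_nat. replace (A + 0 + 1)%nat with (S (A + 0)) by lia. simpl. ring.
      * rewrite fin_theta_SA by auto.
        transitivity ((1 - z * q ^ A) * (qpoch q q (A + 0) * fin_theta A 0 z)); [ring|].
        rewrite IHA. ring.
  - rewrite <- plus_n_Sm, !qpoch_S.
    transitivity (qpoch q q (A + B) * ((1 - q ^^ (Z.of_nat (A + B + 1))) * fin_theta A (S B) z)).
    + rewrite Cpowz_nat. replace (A + B + 1)%nat with (S (A + B)) by lia. simpl. ring.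
    + rewrite fin_theta_SB by auto.
      transitivity ((1 - q / z * q ^ B) * (qpoch q q (A + B) * fin_theta A B z)); [ring|].
      rewrite IHB. ring.
Qed.

(** Applied at z = 1 and z = q, this removes the correction terms in the recursions for
    [fin_appell]. *)
Lemma fin_theta_0 A B (z : C) : z <> 0 ->
  qpoch z q A * qpoch (q / z) q B = 0 -> fin_theta A B z = 0.
Proof.
  intros Hz H. rewrite <- fin_triple_product in H by auto.
  transitivity (/ qpoch q q (A + B) * (qpoch q q (A + B) * fin_theta A B z)).
  - field. apply qpoch_q_neq0.
  - rewrite H. ring.
Qed.

Lemma fin_theta_cv (z : C) : z <> 0 ->
  cv (fun n => fin_theta n n z) (/ pinf q q * / pinf q q * csum (theta_term q z)).
Proof.
  intros Hz. destruct iq_bounded as [M [H0 HM]].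
  pose proof (summable_theta q Hq Hq1 z Hz) as Hth.
  rewrite <- csum_scal by auto.
  apply tannery with (fun r => (M * M * Cmod (theta_term q z r))%R).
  - intros n r. rewrite !Cmod_mult. apply Rmult_le_compat_r; [apply Cmod_ge_0|].
    apply Rmult_le_compat; auto using Cmod_ge_0.
  - apply rsummable_scal; auto. nra.
  - intros r. apply cv_mult; [|apply cv_const]. apply cv_mult.
    + apply (iq_cv (- r)).
    + apply iq_cv.
Qed.

Lemma triple_product (z : C) : z <> 0 ->
  jtheta z q = pinf q q * pinf z q * pinf (q / z) q.
Proof.
  intros Hz. rewrite jtheta_csum by auto. set (t := csum (theta_term q z)).
  assert (H : / pinf q q * t = pinf z q * pinf (q / z) q).
  { apply cv_unique with (fun n => qpoch q q (n + n) * fin_theta n n z).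
    - apply cv_lim with (pinf q q * (/ pinf q q * / pinf q q * t)).
      + apply cv_mult; [|apply fin_theta_cv; auto].
        apply (cv_sub (qpoch q q) _ (fun n => n + n)%nat); [intros; lia | apply qpoch_cv].
      + field. apply pinf_q_neq0.
    - apply cv_ext with (fun n => qpoch z q n * qpoch (q / z) q n).
      + intros n. rewrite fin_triple_product; auto.
      + apply cv_mult; apply qpoch_cv. }
  transitivity (pinf q q * (/ pinf q q * t)); [field; apply pinf_q_neq0|].
  rewrite H. ring.
Qed.

End QSeries.

Lemma cv_pow_0 (y : C) : (Cmod y < 1)%R -> cv (fun n => y ^ n) 0.
Proof.
  intros Hy eps He.
  destruct (pow_lt_1_zero (Cmod y)) with (y := eps) as [N HN]; auto.
  { rewrite Rabs_right; auto. apply Rle_ge, Cmod_ge_0. }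
  exists N. intros n Hn. specialize (HN n Hn).
  replace (y ^ n - 0) with (y ^ n) by ring. rewrite Cmod_pow.
  rewrite Rabs_right in HN; auto. apply Rle_ge, pow_le, Cmod_ge_0.
Qed.

(** * Partial fractions and Bailey's lemma *)

Section PartialFractions.

Variable q : C.
Hypothesis Hq : q <> 0.
Hypothesis Hq1 : (Cmod q < 1)%R.

Lemma Cpowz_mod1 n : Cmod (q ^^ n) = 1%R -> n = 0%Z.
Proof.
  intros H. pose proof (proj1 (Cmod_gt_0 q) Hq) as H0.
  assert (Hp : forall k : nat, (Cmod (q ^^ Z.of_nat (S k)) < 1)%R).
  { intros k. rewrite Cpowz_nat, Cmod_pow. apply pow_lt_1_compat; [lra | lia]. }
  destruct (Z.lt_trichotomy n 0) as [Hn|[Hn|Hn]]; auto; exfalso.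
  - specialize (Hp (Z.to_nat (- n - 1))).
    replace (Z.of_nat (S (Z.to_nat (- n - 1)))) with (- n)%Z in Hp by lia.
    rewrite Cpowz_opp, Cmod_inv, H in Hp; auto; [lra | apply Cpowz_neq0; auto].
  - specialize (Hp (Z.to_nat (n - 1))).
    replace (Z.of_nat (S (Z.to_nat (n - 1)))) with n in Hp by lia. lra.
Qed.

(** The excluded nonzero points are the powers of [q], which are the zeros of j(x; q) and the poles
    of the partial fractions [lterm]. *)
Definition regular (x : C) : Prop := x <> 0 /\ forall n : Z, x * q ^^ n <> 1.

Lemma regular_sub (x : C) n : regular x -> 1 - x * q ^^ n <> 0.
Proof.
  intros [_ H] H0. apply (H n). replace (x * q ^^ n) with (1 - (1 - x * q ^^ n)) by ring.
  rewrite H0. ring.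
Qed.

(** The denominators tend to 1 as n -> +oo. As n -> -oo they grow; after multiplication by q^|n|
    they become [- x + q ^ |n|], which tends to -x, and this is nonzero. *)
Lemma regular_inv_bounded (x : C) : regular x ->
  exists M, (0 < M)%R /\ forall n, (Cmod (/ (1 - x * q ^^ n)) <= M)%R.
Proof.
  intros Hx.
  destruct (cv_inv_bounded (fun n => 1 + - x * q ^ n) 1) as [M1 [H1 HM1]].
  { apply cv_lim with (1 + - x * 0); [|ring]. apply cv_plus; [apply cv_const|].
    apply cv_scal, cv_pow_0, Hq1. }
  { apply C1_nz. }
  { intros n. replace (1 + - x * q ^ n) with (1 - x * q ^^ (Z.of_nat n)) by (rewrite Cpowz_nat; ring).
    apply regular_sub; auto. }
  destruct (cv_inv_bounded (fun n => - x + q ^ n) (- x)) as [M2 [H2 HM2]].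
  { apply cv_lim with (- x + 0); [|ring]. apply cv_plus; [apply cv_const | apply cv_pow_0, Hq1]. }
  { intros H. apply (proj1 Hx). replace x with (- - x) by ring. rewrite H; ring. }
  { intros n H. apply (regular_sub x (- Z.of_nat n) Hx).
    rewrite Cpowz_opp_nat by auto. replace x with (q ^ n - (- x + q ^ n)) by ring. rewrite H.
    field. apply Cpow_nz; auto. }
  exists (M1 + M2)%R. split; [lra|]. intros n.
  destruct (Z_le_gt_dec 0 n) as [Hn|Hn].
  - specialize (HM1 (Z.to_nat n)). rewrite <- Cpowz_nat, Z2Nat.id in HM1 by auto.
    replace (1 - x * q ^^ n) with (1 + - x * q ^^ n) by ring. lra.
  - specialize (HM2 (Z.to_nat (- n))).
    assert (Hne : - x + q ^ Z.to_nat (- n) <> 0).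
    { intros H. apply (regular_sub x n Hx). replace n with (- Z.of_nat (Z.to_nat (- n)))%Z by lia.
      rewrite Cpowz_opp_nat by auto.
      replace x with (q ^ Z.to_nat (- n) - (- x + q ^ Z.to_nat (- n))) at 1 by ring. rewrite H.
      field. apply Cpow_nz; auto. }
    replace (/ (1 - x * q ^^ n)) with (q ^ Z.to_nat (- n) * / (- x + q ^ Z.to_nat (- n))).
    + rewrite Cmod_mult, Cmod_pow.
      assert (Cmod q ^ Z.to_nat (- n) <= 1)%R.
      { rewrite <- (pow1 (Z.to_nat (- n))). apply pow_incr. split; [apply Cmod_ge_0 | lra]. }
      pose proof (Cmod_ge_0 (/ (- x + q ^ Z.to_nat (- n)))). nra.
    + replace n with (- Z.of_nat (Z.to_nat (- n)))%Z at 3 by lia. rewrite Cpowz_opp_nat by auto.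
      pose proof (Cpow_nz q (Z.to_nat (- n)) Hq).
      field. split; auto.
      intros H3. apply Hne. rewrite <- H3. ring.
Qed.

(** Summand of the partial fraction expansion of (q)^3 / j(x; q), with its pole at x = q^(-r). *)
Definition lterm (x : C) (r : Z) : C := (-1) ^^ r * q ^^ (tri r + r) * / (1 - x * q ^^ r).

Lemma summable_lterm (x : C) : regular x -> summable (lterm x).
Proof.
  intros Hx. destruct (regular_inv_bounded x Hx) as [M [H0 HM]].
  apply summable_ext with (fun r => / (1 - x * q ^^ r) * theta_term q q r).
  - intros r. unfold lterm, theta_term. rewrite Cpowz_add by auto. ring.
  - apply summable_bounded with M; auto. apply summable_theta; auto.
Qed.

Definition fin_appell (A B : nat) (x : C) : C :=
  csum (fun r => iq q (Z.of_nat A - r) * iq q (Z.of_nat B + r) * lterm x r).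

(** Write 1 - x q^(A+1) = (1 - q^(A+1-r)) + q^(A+1-r) (1 - x q^r). The first part lowers the index
    of [iq]. In the second the pole cancels, and what is left is a finite theta function at z = 1,
    which vanishes. The step in [B] is similar, with z = q. *)
Lemma fin_appell_SA A B (x : C) : regular x ->
  (1 - x * q ^ (S A)) * fin_appell (S A) B x = fin_appell A B x.
Proof.
  intros Hx. unfold fin_appell. pose proof (summable_lterm x Hx) as Hl.
  assert (Hs : summable (fun r => iq q (Z.of_nat (S A) - r) * iq q (Z.of_nat B + r) * lterm x r))
    by (apply summable_iq2; auto).
  assert (Ht : summable (fun r => iq q (Z.of_nat (S A) - r) * iq q (Z.of_nat B + r) * theta_term q 1 r))
    by (apply summable_iq2; auto; apply summable_theta; auto using C1_nz).
  rewrite <- csum_scal by auto.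
  transitivity (csum (fun r => iq q (Z.of_nat A - r) * iq q (Z.of_nat B + r) * lterm x r)
                + q ^ (S A) * fin_theta q (S A) B 1).
  - unfold fin_theta. rewrite <- csum_scal by auto. rewrite <- csum_plus.
    + apply csum_ext. intros r.
      replace (iq q (Z.of_nat A - r)) with ((1 - q ^^ (Z.of_nat (S A) - r)) * iq q (Z.of_nat (S A) - r))
        by (rewrite iq_rec by auto; f_equal; lia).
      unfold theta_term, lterm. rewrite Cpowz_1, <- Cpowz_nat.
      rewrite (Cpowz_split q (Z.of_nat (S A)) (Z.of_nat (S A) - r) r), Cpowz_add by (auto; lia).
      field. apply regular_sub; auto.
    + apply summable_iq2; auto.
    + apply summable_scal; auto.
  - rewrite fin_theta_0; auto using C1_nz; [ring|].
    replace (qpoch 1 q (S A)) with (0 : C); [ring|].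
    symmetry. clear. induction A; [unfold qpoch; simpl; ring|].
    rewrite qpoch_S, IHA. ring.
Qed.

Lemma fin_appell_SB A B (x : C) : regular x ->
  (1 - q / x * q ^ B) * fin_appell A (S B) x = fin_appell A B x.
Proof.
  intros Hx. unfold fin_appell. pose proof (summable_lterm x Hx) as Hl. pose proof (proj1 Hx) as Hx0.
  assert (Hs : summable (fun r => iq q (Z.of_nat A - r) * iq q (Z.of_nat (S B) + r) * lterm x r))
    by (apply summable_iq2; auto).
  assert (Ht : summable (fun r => iq q (Z.of_nat A - r) * iq q (Z.of_nat (S B) + r) * theta_term q q r))
    by (apply summable_iq2; auto; apply summable_theta; auto).
  rewrite <- csum_scal by auto.
  transitivity (csum (fun r => iq q (Z.of_nat A - r) * iq q (Z.of_nat B + r) * lterm x r)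
                + (- (q / x) * q ^ B) * fin_theta q A (S B) q).
  - unfold fin_theta. rewrite <- csum_scal by auto. rewrite <- csum_plus.
    + apply csum_ext. intros r.
      replace (iq q (Z.of_nat B + r)) with ((1 - q ^^ (Z.of_nat (S B) + r)) * iq q (Z.of_nat (S B) + r))
        by (rewrite iq_rec by auto; f_equal; lia).
      unfold theta_term, lterm. rewrite <- Cpowz_nat.
      rewrite (Cpowz_split q (Z.of_nat (S B) + r) (Z.of_nat B + 1) r) by (auto; lia).
      rewrite Cpowz_S, Cpowz_add by auto.
      field. split; auto. apply regular_sub; auto.
    + apply summable_iq2; auto.
    + apply summable_scal; auto.
  - rewrite fin_theta_0; auto; [ring|].
    replace (q / q) with (1 : C) by (field; auto).
    replace (qpoch 1 q (S B)) with (0 : C); [ring|].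
    symmetry. clear. induction B; [unfold qpoch; simpl; ring|].
    rewrite qpoch_S, IHB. ring.
Qed.

Lemma partial_fractions A B (x : C) : regular x ->
  qpoch x q (S A) * qpoch (q / x) q B * fin_appell A B x = 1.
Proof.
  intros Hx. revert A. induction B as [|B IHB]; intros A.
  - induction A as [|A IHA].
    + unfold fin_appell. rewrite (csum_single _ 0%Z).
      * change (Z.of_nat 0 - 0)%Z with 0%Z. change (Z.of_nat 0 + 0)%Z with 0%Z. rewrite !iq_0 by auto.
        pose proof (regular_sub x 0 Hx) as H. simpl in H. unfold qpoch, lterm, tri. simpl.
        field. intros E. apply H. rewrite <- E. ring.
      * intros r Hr. destruct (Z_lt_le_dec r 0).
        -- rewrite (iq_neg q (Z.of_nat 0 + r)) by lia. ring.
        -- rewrite (iq_neg q (Z.of_nat 0 - r)) by lia. ring.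
    + rewrite <- IHA, <- (fin_appell_SA A) by auto. rewrite (qpoch_S q x (S A)). ring.
  - rewrite <- (IHB A), <- (fin_appell_SB A B) by auto. rewrite (qpoch_S q (q / x) B). ring.
Qed.

(** The limit A = B -> oo of the finite partial fractions, by dominated convergence; the triple
    product identifies the denominator. *)
Lemma inv_jtheta (x : C) : regular x -> csum (lterm x) * jtheta x q = pinf q q ^ 3.
Proof.
  intros Hx. pose proof (proj1 Hx) as Hx0. pose proof (pinf_q_neq0 q Hq Hq1) as Hp.
  assert (H : pinf x q * pinf (q / x) q * (/ pinf q q * / pinf q q * csum (lterm x)) = 1).
  { apply cv_unique with (fun n => qpoch x q (S n) * qpoch (q / x) q n * fin_appell n n x).
    - apply cv_mult; [apply cv_mult|].
      + apply (cv_sub _ _ S); [auto | apply qpoch_cv; auto].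
      + apply qpoch_cv; auto.
      + destruct (iq_bounded q Hq Hq1) as [M [H0 HM]].
        pose proof (summable_lterm x Hx) as Hl. rewrite <- csum_scal by auto.
        apply tannery with (fun r => (M * M * Cmod (lterm x r))%R).
        * intros n r. rewrite !Cmod_mult. apply Rmult_le_compat_r; [apply Cmod_ge_0|].
          apply Rmult_le_compat; auto using Cmod_ge_0.
        * apply rsummable_scal; auto. nra.
        * intros r. apply cv_mult; [|apply cv_const]. apply cv_mult; [apply (iq_cv q Hq Hq1 (- r))|].
          apply iq_cv; auto.
    - apply cv_ext with (fun _ => 1); [|apply cv_const].
      intros n. rewrite partial_fractions; auto. }
  rewrite triple_product by auto.
  transitivity (pinf q q ^ 3 * (pinf x q * pinf (q / x) q * (/ pinf q q * / pinf q q * csum (lterm x))));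
    [field; auto | rewrite H; ring].
Qed.

(** Generates the partitions whose Durfee rectangle has sides m and m + k, which explains that the
    sum over m does not depend on k. *)
Definition durfee_term (k m : Z) : C := q ^^ (m * m + k * m) * iq q m * iq q (m + k).

Lemma durfee_bound : exists M, (0 < M)%R /\
  forall k m, (0 <= k)%Z -> (Cmod (durfee_term k m) <= M * Cmod (q ^^ (Z.abs m)))%R.
Proof.
  destruct (iq_bounded q Hq Hq1) as [M [H0 HM]]. exists (M * M)%R. split; [nra|].
  intros k m Hk. unfold durfee_term. destruct (Z_lt_le_dec m 0) as [Hm|Hm].
  - rewrite (iq_neg q m) by auto. replace (_ * 0 * _) with (0 : C) by ring. rewrite Cmod_0.
    pose proof (Cmod_ge_0 (q ^^ Z.abs m)). nra.
  - rewrite !Cmod_mult. rewrite Rmult_assoc, Rmult_comm.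
    apply Rmult_le_compat; auto using Cmod_ge_0.
    + apply Rmult_le_pos; apply Cmod_ge_0.
    + apply Rmult_le_compat; auto using Cmod_ge_0.
    + apply Cpowz_le; auto. nia.
Qed.

Lemma summable_durfee k : (0 <= k)%Z -> summable (durfee_term k).
Proof.
  intros Hk. destruct durfee_bound as [M [H0 HM]].
  apply (summable_q q Hq Hq1 Z.abs Z.abs M 0); auto using weight_Z; intros; lia.
Qed.

Lemma durfee_rec k : (0 <= k)%Z ->
  csum (durfee_term k) - csum (durfee_term (k + 1))
  = - q ^^ (k + 1) * (csum (durfee_term (k + 1)) - csum (durfee_term (k + 2))).
Proof.
  intros Hk.
  pose proof (summable_durfee k Hk) as S0.
  pose proof (summable_durfee (k + 1) ltac:(lia)) as S1.
  pose proof (summable_durfee (k + 2) ltac:(lia)) as S2.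
  assert (Sh : summable (fun m => durfee_term (k + 2) (m + - (1)))) by (apply summable_shift; auto).
  rewrite <- (csum_shift (- (1)) (durfee_term (k + 2))) by auto.
  rewrite <- csum_minus by auto.
  transitivity (csum (fun m => q ^^ (k + 1) * durfee_term (k + 2) (m + - (1))
                              - q ^^ (k + 1) * durfee_term (k + 1) m)).
  - apply csum_ext. intros m. unfold durfee_term.
    replace (m + - (1))%Z with (m - 1)%Z by lia.
    replace (iq q (m - 1)) with ((1 - q ^^ m) * iq q m) by (rewrite iq_rec; auto).
    replace (iq q (m + k)) with ((1 - q ^^ (m + (k + 1))) * iq q (m + (k + 1)))
      by (rewrite iq_rec by auto; f_equal; lia).
    replace (m - 1 + (k + 2))%Z with (m + (k + 1))%Z by lia.
    rewrite (Cpowz_split q (m * m + (k + 1) * m) (m * m + k * m) m) by (auto; lia).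
    rewrite (Cpowz_split q (m + (k + 1)) (k + 1) m) by (auto; lia).
    replace (q ^^ (m * m + k * m)) with (q ^^ (k + 1) * q ^^ ((m - 1) * (m - 1) + (k + 2) * (m - 1)))
      by (rewrite <- Cpowz_add by auto; f_equal; ring).
    ring.
  - rewrite csum_minus, !csum_scal by (auto; apply summable_scal; auto). ring.
Qed.

(** By [durfee_rec] the difference d_k of consecutive sums equals -q^(k+1) d_(k+1). The d_j are
    bounded, so iteration makes |d_k| smaller than any power of |q| times a constant. *)
Lemma durfee_const k : (0 <= k)%Z -> csum (durfee_term k) = csum (durfee_term (k + 1)).
Proof.
  intros Hk. destruct durfee_bound as [M [H0 HM]].
  assert (Hb : exists D, forall k, (0 <= k)%Z -> (Cmod (csum (durfee_term k)) <= D)%R).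
  { destruct (rsummable_q q Hq Hq1 Z.abs Z.abs M 0) as [D HD]; try (intros; lia);
      [apply weight_Z; auto | lra |].
    exists D. intros j Hj. apply csum_norm with (fun m => (M * Cmod (q ^^ Z.abs m))%R); auto. }
  destruct Hb as [D HD].
  set (d := fun j => csum (durfee_term j) - csum (durfee_term (j + 1))).
  assert (Hd : forall n : nat, forall j, (0 <= j)%Z -> (Cmod (d j) <= Cmod q ^ n * (2 * D))%R).
  { induction n; intros j Hj.
    - unfold d. unfold Cminus. rewrite pow_O. eapply Rle_trans; [apply Cmod_triangle|].
      rewrite Cmod_opp. pose proof (HD j Hj). pose proof (HD (j + 1)%Z ltac:(lia)). lra.
    - unfold d. rewrite durfee_rec by auto. rewrite Cmod_mult, Cmod_opp.
      specialize (IHn (j + 1)%Z ltac:(lia)). unfold d in IHn.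
      replace (j + 1 + 1)%Z with (j + 2)%Z in IHn by lia.
      simpl. rewrite Rmult_assoc. apply Rmult_le_compat; auto using Cmod_ge_0.
      replace (Cmod q) with (Cmod (q ^^ 1)) by (change (q ^^ 1) with (q ^ 1); rewrite Cpow_1_r; auto).
      apply Cpowz_le; auto. lia. }
  assert (Hz : d k = 0).
  { apply cv_unique with (fun _ => d k); [apply cv_const|].
    intros eps He.
    destruct (cv_pow_0 q Hq1 (eps / (2 * Rabs D + 1))%R) as [N HN].
    { apply Rdiv_lt_0_compat; auto. pose proof (Rabs_pos D). lra. }
    exists N. intros n Hn. specialize (HN n Hn). specialize (Hd n k Hk).
    replace (q ^ n - 0) with (q ^ n) in HN by ring. rewrite Cmod_pow in HN.
    replace (d k - 0) with (d k) by ring.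
    pose proof (Rabs_pos D). pose proof (Rle_abs D).
    assert (0 <= Cmod q ^ n)%R by (apply pow_le, Cmod_ge_0).
    assert (eps = (eps / (2 * Rabs D + 1) * (2 * Rabs D + 1))%R) by (field; lra).
    nra. }
  unfold d in Hz. replace (csum (durfee_term (k + 1))) with
    (csum (durfee_term k) - (csum (durfee_term k) - csum (durfee_term (k + 1)))) by ring.
  rewrite Hz. ring.
Qed.

(** Since the sum is independent of k, it equals its limit as k -> oo, to which only the term m = 0
    contributes. *)
Lemma durfee_nonneg (k : nat) : csum (durfee_term (Z.of_nat k)) = / pinf q q.
Proof.
  assert (H : forall n : nat, csum (durfee_term (Z.of_nat n)) = csum (durfee_term 0)).
  { induction n; auto. rewrite <- IHn. symmetry. rewrite durfee_const by lia. f_equal. f_equal. lia. }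
  rewrite H. apply cv_unique with (fun n => csum (durfee_term (Z.of_nat n))).
  { apply cv_ext with (fun _ => csum (durfee_term 0)); auto. apply cv_const. }
  set (f := fun m => if (m =? 0)%Z then / pinf q q else 0).
  assert (Hf : csum f = / pinf q q).
  { rewrite (csum_single f 0%Z); auto. intros m Hm. unfold f. destruct (Z.eqb_spec m 0); auto; lia. }
  rewrite <- Hf. destruct durfee_bound as [M [H0 HM]].
  apply tannery with (fun m => (M * Cmod (q ^^ Z.abs m))%R).
  - intros n m. apply HM. lia.
  - apply (rsummable_q q Hq Hq1 Z.abs Z.abs M 0); try (intros; lia); [apply weight_Z; auto | lra].
  - intros m. unfold f. destruct (Z.eqb_spec m 0) as [->|Hm].
    + apply cv_ext with (fun n => iq q (Z.of_nat n + 0)).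
      * intros n. unfold durfee_term. rewrite iq_0 by auto.
        replace (0 * 0 + Z.of_nat n * 0)%Z with 0%Z by lia.
        replace (0 + Z.of_nat n)%Z with (Z.of_nat n + 0)%Z by lia. simpl. ring.
      * apply iq_cv; auto.
    + destruct (Z_lt_le_dec m 0).
      * apply cv_ext with (fun _ => 0); [|apply cv_const]. intros n. unfold durfee_term.
        rewrite (iq_neg q m) by auto. ring.
      * destruct (iq_bounded q Hq Hq1) as [M' [H0' HM']].
        apply cv_ext with (fun n => (q ^^ (m * m) * iq q m * iq q (m + Z.of_nat n)) * (q ^^ m) ^ n).
        -- intros n. unfold durfee_term.
           rewrite (Cpowz_split q (m * m + Z.of_nat n * m) (m * m) (m * Z.of_nat n)) by (auto; ring).
           rewrite (Cpowz_mul q m (Z.of_nat n)), (Cpowz_nat (q ^^ m)) by auto. ring.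
        -- apply cv_0_mult with (Cmod (q ^^ (m * m) * iq q m) * M')%R.
           ++ intros n. rewrite Cmod_mult. apply Rmult_le_compat_l; auto using Cmod_ge_0.
           ++ apply cv_pow_0. replace m with (Z.of_nat (Z.to_nat m)) by lia.
              rewrite Cpowz_nat, Cmod_pow. apply pow_lt_1_compat; [|lia].
              split; auto using Cmod_ge_0.
Qed.

Lemma durfee (k : Z) : csum (durfee_term k) = / pinf q q.
Proof.
  destruct (Z_le_gt_dec 0 k) as [Hk|Hk].
  - rewrite <- (Z2Nat.id k) by auto. apply durfee_nonneg.
  - rewrite <- (durfee_nonneg (Z.to_nat (- k))).
    rewrite <- (csum_shift (k) (durfee_term (Z.of_nat (Z.to_nat (- k))))) by (apply summable_durfee; lia).
    apply csum_ext. intros m. unfold durfee_term.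
    replace (Z.of_nat (Z.to_nat (- k))) with (- k)%Z by lia.
    replace (m + k + - k)%Z with m by lia.
    replace ((m + k) * (m + k) + - k * (m + k))%Z with (m * m + k * m)%Z by ring. ring.
Qed.

(* Bailey's lemma for the pair given by [partial_fractions] *)
Lemma bailey_appell (d : nat) (x : C) : (d <= 1)%nat -> regular x ->
  summable (fun n => q ^ (n * (n + d)) * / (qpoch x q (S n) * qpoch (q / x) q (n + d))) /\
  csum (fun n => q ^ (n * (n + d)) * / (qpoch x q (S n) * qpoch (q / x) q (n + d)))
  = / pinf q q * csum (fun r => q ^^ (r * r + Z.of_nat d * r) * lterm x r).
Proof.
  intros Hd Hx. destruct (iq_bounded q Hq Hq1) as [M [H0 HM]].
  set (t := fun n r => q ^ (n * (n + d)) * (iq q (Z.of_nat n - r) * iq q (Z.of_nat (n + d) + r) * lterm x r)).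
  assert (Ht : summable (fun p => t (fst p) (snd p))).
  { apply summable_ext with (fun p => iq q (Z.of_nat (fst p) - snd p) * iq q (Z.of_nat (fst p + d) + snd p)
        * (q ^ (fst p * (fst p + d)) * lterm x (snd p))).
    { intros p. unfold t. ring. }
    apply summable_iq2; auto. apply (summable_prod (fun n => q ^ (n * (n + d))) (lterm x)).
    - apply (summable_q q Hq Hq1 Z.of_nat (fun n => Z.of_nat (n * (n + d))) 1 0); [apply weight_nat; auto| |].
      + intros n. rewrite Cpowz_nat. lra.
      + intros n. nia.
    - apply summable_lterm; auto. }
  assert (E : forall n, q ^ (n * (n + d)) * / (qpoch x q (S n) * qpoch (q / x) q (n + d))
                 = csum (fun r => t n r)).
  { intros n. unfold t.
    pose proof (partial_fractions n (n + d) x Hx) as P.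
    rewrite csum_scal by (apply summable_iq2; auto; apply summable_lterm; auto).
    f_equal. change (csum _) with (fin_appell n (n + d) x).
    assert (qpoch x q (S n) * qpoch (q / x) q (n + d) <> 0).
    { intros H. rewrite H in P. apply C1_nz. rewrite <- P. ring. }
    transitivity (/ (qpoch x q (S n) * qpoch (q / x) q (n + d))
       * (qpoch x q (S n) * qpoch (q / x) q (n + d) * fin_appell n (n + d) x)); [rewrite P; ring|].
    field. split; intros H1; apply H; rewrite H1; ring. }
  split.
  { apply summable_ext with (fun n => csum (fun r => t n r)); auto.
    apply (summable_rows (fun p => t (fst p) (snd p))); auto. }
  rewrite (csum_ext _ _ E), csum_exchange by auto.
  rewrite <- csum_scal.
  2:{ destruct (regular_inv_bounded x Hx) as [M' [H0' HM']].
      apply summable_ext with (fun r => / (1 - x * q ^^ r) * ((-1) ^^ r * q ^^ (tri r + r + (r * r + Z.of_nat d * r)))).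
      - intros r. unfold lterm. rewrite (Cpowz_add q (tri r + r)) by auto. ring.
      - apply summable_bounded with M'; auto.
        apply (summable_q q Hq Hq1 Z.abs (fun r => tri r + r + (r * r + Z.of_nat d * r))%Z 1 10).
        + apply weight_Z; auto.
        + intros r. rewrite Cmod_mult, Cmod_sgn. lra.
        + intros r. pose proof (tri_spec r). nia. }
  apply csum_ext. intros r.
  (* With m = n - r the inner sum is a Durfee sum for k = 2 r + d. The restriction n >= 0 loses
     nothing, because m < 0 or m + k < 0 in all other terms. *)
  transitivity (csum (fun n : nat => q ^^ (r * r + Z.of_nat d * r) * lterm x r * durfee_term (2 * r + Z.of_nat d) (Z.of_nat n - r))).
  - apply csum_ext. intros n. unfold t, durfee_term.
    rewrite <- Cpowz_nat.
    rewrite (Cpowz_split q (Z.of_nat (n * (n + d))) (r * r + Z.of_nat d * r)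
       ((Z.of_nat n - r) * (Z.of_nat n - r) + (2 * r + Z.of_nat d) * (Z.of_nat n - r))) by (auto; lia).
    replace (Z.of_nat n - r + (2 * r + Z.of_nat d))%Z with (Z.of_nat (n + d) + r)%Z by lia. ring.
  - set (c := q ^^ (r * r + Z.of_nat d * r) * lterm x r).
    assert (Sd : summable (durfee_term (2 * r + Z.of_nat d))).
    { destruct (Z_le_gt_dec 0 (2 * r + Z.of_nat d)); [apply summable_durfee; auto|].
      apply summable_ext with (fun m => durfee_term (- (2 * r + Z.of_nat d)) (m + (2 * r + Z.of_nat d))).
      - intros m. unfold durfee_term. set (k := (2 * r + Z.of_nat d)%Z).
        replace (m + k + - k)%Z with m by lia.
        replace ((m + k) * (m + k) + - k * (m + k))%Z with (m * m + k * m)%Z by ring. ring.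
      - apply (summable_shift _ (durfee_term (- (2 * r + Z.of_nat d)))), summable_durfee. lia. }
    rewrite csum_scal.
    + rewrite <- (durfee (2 * r + Z.of_nat d)).
      rewrite (csum_inj (durfee_term (2 * r + Z.of_nat d)) (fun n => Z.of_nat n - r)%Z); auto.
      * ring.
      * intros a b; lia.
      * intros m Hm. exists (Z.to_nat (m + r)).
        destruct (Z_lt_le_dec (m + r) 0); [|lia]. exfalso. apply Hm. unfold durfee_term.
        destruct (Z_lt_le_dec m 0); [rewrite (iq_neg q m) by auto; ring|].
        rewrite (iq_neg q (m + (2 * r + Z.of_nat d))) by lia. ring.
    + apply (summable_inj (durfee_term (2 * r + Z.of_nat d)) (fun n => Z.of_nat n - r)%Z); auto.
      intros a b; lia.
Qed.

End PartialFractions.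

(** From here on [lia] also decides goals with quotients and remainders by numerals. *)
Ltac Zify.zify_post_hook ::= Z.to_euclidean_division_equations.

(** * Watson's Appell-type expansions of the mock theta functions *)

Section MockTheta.

Variable q : C.
Hypothesis Hq : q <> 0.
Hypothesis Hq1 : (Cmod q < 1)%R.

Lemma m1_regular : regular q (-1).
Proof.
  split; [apply m1_neq0|]. intros n H.
  assert (n = 0%Z).
  { apply (Cpowz_mod1 q Hq Hq1). apply (f_equal Cmod) in H.
    rewrite Cmod_mult, Cmod_m1, Cmod_1 in H. lra. }
  subst. simpl in H. apply (f_equal Re) in H. simpl in H. lra.
Qed.

Lemma qpoch_cons (x : C) n : qpoch x q (S n) = (1 - x) * qpoch (q * x) q n.
Proof.
  induction n; [unfold qpoch; simpl; ring|].
  rewrite qpoch_S, IHn, (qpoch_S q (q * x)). simpl. ring.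
Qed.

(** Bailey's lemma at x = -1 with d = 0, where (-1)_(n+1) (-q)_n = 2 (-q)_n^2. *)
Lemma f3_appell :
  f3 q * pinf q q = 2 * csum (fun r => (-1) ^^ r * q ^^ (3 * tri r + 2 * r) * / (1 + q ^^ r)).
Proof.
  destruct (bailey_appell q Hq Hq1 0 (-1)) as [S0 E0]; [lia | apply m1_regular|].
  assert (E : forall n, q ^ (n * n) / qpoch (- q) q n ^ 2
     = 2 * (q ^ (n * (n + 0)) * / (qpoch (-1) q (S n) * qpoch (q / -1) q (n + 0)))).
  { intros n. rewrite !Nat.add_0_r, qpoch_cons.
    replace (q * -1) with (- q) by ring. replace (q / -1) with (- q) by (field; apply m1_neq0).
    assert (qpoch (- q) q n <> 0).
    { intros H. pose proof (partial_fractions q Hq Hq1 n n (-1) m1_regular) as P.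
      replace (q / -1) with (- q) in P by (field; apply m1_neq0). rewrite H in P.
      apply C1_nz. rewrite <- P. ring. }
    replace (1 - -1) with (2 : C) by ring. field. auto using C2_neq0. }
  unfold f3. rewrite CSeries_csum.
  - rewrite (csum_ext _ _ E), csum_scal, E0 by auto.
    transitivity (2 * csum (fun r => q ^^ (r * r + Z.of_nat 0 * r) * lterm q (-1) r)).
    + field. apply pinf_q_neq0; auto.
    + f_equal. apply csum_ext. intros r. unfold lterm.
      rewrite (Cpowz_split q (3 * tri r + 2 * r) (r * r + Z.of_nat 0 * r) (tri r + r)) by (auto; tri).
      replace (1 - -1 * q ^^ r) with (1 + q ^^ r) by ring. ring.
  - apply summable_ext with (2 := summable_scal 2 _ S0). intros n. rewrite E. reflexivity.
Qed.

End MockTheta.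

Lemma sqrt_regular (y : C) : y <> 0 -> (Cmod y < 1)%R -> regular (y ^ 2) y.
Proof.
  intros Hy Hy1. split; auto. intros n H.
  replace (y * (y ^ 2) ^^ n) with (y ^^ (2 * n + 1)) in H.
  - assert (2 * n + 1 = 0)%Z; [|lia].
    apply (Cpowz_mod1 y Hy Hy1). rewrite H. apply Cmod_1.
  - rewrite Cpowz_S, Cpowz_mul by auto. change (y ^^ 2) with (y ^ 2). ring.
Qed.

Lemma sq_lt_1 (y : C) : y <> 0 -> (Cmod y < 1)%R -> y ^ 2 <> 0 /\ (Cmod (y ^ 2) < 1)%R.
Proof.
  intros Hy Hy1. split; [apply Cpow_nz; auto|].
  rewrite Cmod_pow. pose proof (Cmod_ge_0 y). simpl. nra.
Qed.

(** Bailey's lemma in base y^2 at x = y with d = 1: there y^2 / x = x, so that the two products in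
    the denominator coincide. *)
Lemma omega3_appell (y : C) : y <> 0 -> (Cmod y < 1)%R ->
  omega3 y * pinf (y ^ 2) (y ^ 2)
  = csum (fun r => (-1) ^^ r * y ^^ (6 * tri r + 6 * r) * / (1 - y ^^ (2 * r + 1))).
Proof.
  intros Hy Hy1. destruct (sq_lt_1 y Hy Hy1) as [Hq Hq1].
  pose proof (sqrt_regular y Hy Hy1) as Hr.
  destruct (bailey_appell (y ^ 2) Hq Hq1 1 y) as [S0 E0]; [lia | auto|].
  assert (E : forall n, y ^ (2 * n * (n + 1)) / qpoch y (y ^ 2) (n + 1) ^ 2
     = (y ^ 2) ^ (n * (n + 1)) * / (qpoch y (y ^ 2) (S n) * qpoch (y ^ 2 / y) (y ^ 2) (n + 1))).
  { intros n. replace (y ^ 2 / y) with y by (simpl; field; auto).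
    rewrite <- Cpow_mult_r, Nat.mul_assoc, Nat.add_1_r. unfold Cdiv. f_equal. f_equal. simpl. ring. }
  unfold omega3. rewrite CSeries_csum.
  - rewrite (csum_ext _ _ E), E0.
    transitivity (csum (fun r => (y ^ 2) ^^ (r * r + Z.of_nat 1 * r) * lterm (y ^ 2) y r)).
    + field. apply pinf_q_neq0; auto.
    + apply csum_ext. intros r. unfold lterm. change (y ^ 2) with (y ^^ 2).
      rewrite <- !Cpowz_mul, Cpowz_S by auto.
      rewrite (Cpowz_split y (6 * tri r + 6 * r) (2 * (r * r + Z.of_nat 1 * r)) (2 * (tri r + r))) by (auto; tri).
      replace (y * y ^^ (2 * r)) with (y ^^ (2 * r) * y) by ring. ring.
  - apply summable_ext with (2 := S0). intros n. rewrite E. reflexivity.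
Qed.

Lemma csum_anti {I} (g : I -> C) (phi : I -> I) : (forall i, phi (phi i) = i) ->
  (forall i, g (phi i) = - g i) -> summable g -> csum g = 0.
Proof.
  intros Hp Hg Hs.
  assert (H : csum g = - csum g).
  { rewrite <- csum_opp, <- (csum_bij g phi phi) by auto. apply csum_ext; auto. }
  replace (csum g) with (/ 2 * (csum g + csum g)) by (field; apply C2_neq0).
  rewrite H at 1. ring.
Qed.

(** Two involutions act. Exchanging a and n makes the full sum vanish. On the pairs with n = 3 m,
    the map (a, 3 m) -> (m, 3 a) preserves [f] and exchanges the two sides of the line n = 3 a, so
    the terms with n divisible by 3 have the same sum on both sides. Adding these two relations to
    the right-hand side gives the left-hand side term by term. *)
Lemma antisymmetric_double_sum (f : Z * Z -> C) : summable f ->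
  (forall a n, f (n, a) = - f (a, n)) -> (forall a m, f (a, 3 * m)%Z = f (m, 3 * a)%Z) ->
  2 * csum (restrict (fun p => (3 * fst p <? snd p)%Z) f)
  + csum (restrict (fun p => (snd p =? 3 * fst p)%Z) f)
  = csum (restrict (fun p => ((3 * fst p <? snd p)%Z && negb (snd p mod 3 =? 0)%Z)%bool) f)
    - csum (restrict (fun p => ((snd p <? 3 * fst p)%Z && negb (snd p mod 3 =? 0)%Z)%bool) f).
Proof.
  intros Hf Ha H3.
  set (P1 := fun p : Z * Z => (3 * fst p <? snd p)%Z).
  set (P2 := fun p : Z * Z => (snd p =? 3 * fst p)%Z).
  set (P3 := fun p : Z * Z => ((3 * fst p <? snd p)%Z && negb (snd p mod 3 =? 0)%Z)%bool).
  set (P4 := fun p : Z * Z => ((snd p <? 3 * fst p)%Z && negb (snd p mod 3 =? 0)%Z)%bool).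
  pose proof (fun P => summable_restrict P f Hf) as HP.
  (* On multiples of 3, the side of the line n = 3 a; the second involution changes its sign. *)
  set (sg := fun p : Z * Z => if (snd p mod 3 =? 0)%Z then
         if (3 * fst p <? snd p)%Z then (1 : C) else if (snd p <? 3 * fst p)%Z then -1 else 0 else 0).
  assert (Hs : summable (fun p => sg p * f p)).
  { apply summable_bounded with 1%R; auto. intros p. unfold sg.
    destruct (_ =? 0)%Z, (3 * fst p <? snd p)%Z, (snd p <? 3 * fst p)%Z;
      rewrite ?Cmod_1, ?Cmod_0, ?Cmod_m1; lra. }
  assert (E1 : csum f = 0).
  { apply csum_anti with (fun p => (snd p, fst p)); auto; intros [a n]; cbn [fst snd]; auto. }
  assert (E2 : csum (fun p => sg p * f p) = 0).
  { apply csum_anti with (fun p => if (snd p mod 3 =? 0)%Z then (snd p / 3, 3 * fst p)%Z else p); auto.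
    - intros [a n]; cbn [fst snd]. destruct (Z.eqb_spec (n mod 3) 0) as [E|E]; cbn [fst snd].
      + destruct (Z.eqb_spec ((3 * a) mod 3) 0); [|lia]. f_equal; lia.
      + destruct (Z.eqb_spec (n mod 3) 0); auto. contradiction.
    - intros [a n]; unfold sg; cbn [fst snd]. destruct (Z.eqb_spec (n mod 3) 0) as [E|E]; cbn [fst snd].
      + destruct (Z.eqb_spec ((3 * a) mod 3) 0); [|lia].
        assert (Hn : exists m, n = (3 * m)%Z) by (exists (n / 3)%Z; lia). destruct Hn as [m ->].
        replace (3 * m / 3)%Z with m by lia. rewrite <- (H3 a m).
        destruct (Z.ltb_spec (3 * m) (3 * a)), (Z.ltb_spec (3 * a) (3 * m)); try lia; ring.
      + destruct (Z.eqb_spec (n mod 3) 0); [contradiction|]. ring. }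
  assert (E : 2 * csum (restrict P1 f) + csum (restrict P2 f)
            = csum (restrict P3 f) - csum (restrict P4 f) + (csum f + csum (fun p => sg p * f p))).
  { rewrite <- csum_scal, <- csum_plus, <- csum_minus, <- csum_plus, <- csum_plus
      by (auto; try apply summable_scal; auto; try apply summable_minus; auto; apply summable_plus; auto).
    apply csum_ext. intros [a n]. unfold restrict, P1, P2, P3, P4, sg; cbn [fst snd].
    destruct (Z.eqb_spec n (3 * a)), (Z.ltb_spec (3 * a) n), (Z.ltb_spec n (3 * a)),
       (Z.eqb_spec (n mod 3) 0); cbn [fst snd andb negb]; try lia; ring. }
  rewrite E, E1, E2. ring.
Qed.

Lemma geometric_series (y : C) : (Cmod y < 1)%R ->
  summable (fun n => y ^ n) /\ csum (fun n => y ^ n) = / (1 - y).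
Proof.
  intros Hy.
  assert (Hs : summable (fun n => y ^ n)).
  { apply summable_le with (fun n => (Cmod y ^ n)%R); [intros; rewrite Cmod_pow; lra|].
    apply rsummable_geom. split; auto using Cmod_ge_0. }
  split; auto.
  assert (H1 : 1 - y <> 0).
  { intros H. replace y with (1 - (1 - y)) in Hy by ring. rewrite H in Hy.
    replace (1 - 0) with (1 : C) in Hy by ring. rewrite Cmod_1 in Hy. lra. }
  assert (H : csum (fun n => y ^ n) = 1 + y * csum (fun n => y ^ n)).
  { rewrite csum_S at 1 by auto. rewrite <- csum_scal by auto. reflexivity. }
  assert (H2 : (1 - y) * csum (fun n => y ^ n) = 1).
  { transitivity (csum (fun n => y ^ n) - y * csum (fun n => y ^ n)); [ring|]. rewrite H at 1. ring. }
  transitivity (/ (1 - y) * ((1 - y) * csum (fun n => y ^ n))); [field; auto|]. rewrite H2. ring.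
Qed.

(** * Double sums for the mock theta functions *)

Section DoubleSums.

Variable q : C.
Hypothesis Hq : q <> 0.
Hypothesis Hq1 : (Cmod q < 1)%R.

(** Compared with a geometric series of ratio sqrt |q|, where the floor costs one factor of sqrt
    |q|. The exponents of [odd_term] grow only like half of a + n along the boundary of the
    quadrant. *)
Lemma weight_half : weight q (fun n => Z.abs n / 2)%Z.
Proof.
  pose proof (proj1 (Cmod_gt_0 q) Hq) as H0.
  set (s := sqrt (Cmod q)).
  assert (Hs0 : (0 < s)%R) by (apply sqrt_lt_R0; auto).
  assert (Hss : (s * s = Cmod q)%R) by (apply sqrt_sqrt; lra).
  assert (Hs1 : (s < 1)%R) by nra.
  eapply rsummable_le; [|apply (rsummable_scal (/ s)); [left; apply Rinv_0_lt_compat; auto|];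
    apply (rsummable_geomZ s); lra].
  intros n. simpl. set (k := Z.to_nat (Z.abs n / 2)).
  replace (Z.abs n / 2)%Z with (Z.of_nat k) by lia.
  rewrite Cpowz_nat, Cmod_pow, <- Hss, Rpow_mult_distr, <- pow_add.
  apply Rmult_le_reg_l with s; auto. rewrite <- Rmult_assoc, Rinv_r, Rmult_1_l by lra.
  change (s ^ S (k + k) <= s ^ Z.abs_nat n)%R.
  replace (S (k + k)) with (Z.abs_nat n + (S (k + k) - Z.abs_nat n))%nat by lia.
  rewrite pow_add. rewrite <- (Rmult_1_r (s ^ Z.abs_nat n)) at 2.
  apply Rmult_le_compat_l; [apply pow_le; lra|].
  rewrite <- (pow1 (S (k + k) - Z.abs_nat n)). apply pow_incr. lra.
Qed.

(* The parts with even and with odd indices of the antisymmetric array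
   [(-1)^((n-a-2)/4) q^(a n/2)] on [n = a + 2 mod 4], the even one rescaled by 2 and the
   odd one multiplied by [q^(3/2)].  Summed over [n > 3 a] they give the Appell-type sums
   of [f_3(q^4)] and of [omega_3(-q^2)]. *)
Definition even_term (p : Z * Z) : C :=
  if ((1 <=? fst p)%Z && (1 <=? snd p)%Z && ((snd p - fst p) mod 2 =? 1)%Z)%bool
  then (-1) ^^ ((snd p - fst p) / 2) * q ^^ (2 * fst p * snd p) else 0.

Definition odd_term (p : Z * Z) : C :=
  if ((1 <=? fst p)%Z && (1 <=? snd p)%Z && ((snd p - fst p) mod 4 =? 2)%Z && (snd p mod 2 =? 1)%Z)%bool
  then (-1) ^^ ((snd p - fst p) / 4) * q ^^ ((fst p * snd p + 3) / 2) else 0.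

Lemma even_term_eq a n : (1 <= a)%Z -> (1 <= n)%Z -> ((n - a) mod 2 = 1)%Z ->
  even_term (a, n) = (-1) ^^ ((n - a) / 2) * q ^^ (2 * a * n).
Proof.
  intros H1 H2 H3. unfold even_term; cbn [fst snd].
  rewrite (proj2 (Z.leb_le _ _) H1), (proj2 (Z.leb_le _ _) H2), (proj2 (Z.eqb_eq _ _) H3). reflexivity.
Qed.

Lemma odd_term_eq a n : (1 <= a)%Z -> (1 <= n)%Z -> ((n - a) mod 4 = 2)%Z -> (n mod 2 = 1)%Z ->
  odd_term (a, n) = (-1) ^^ ((n - a) / 4) * q ^^ ((a * n + 3) / 2).
Proof.
  intros H1 H2 H3 H4. unfold odd_term; cbn [fst snd].
  rewrite (proj2 (Z.leb_le _ _) H1), (proj2 (Z.leb_le _ _) H2), (proj2 (Z.eqb_eq _ _) H3),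
    (proj2 (Z.eqb_eq _ _) H4). reflexivity.
Qed.

Lemma even_term_supp a n : even_term (a, n) <> 0 ->
  (1 <= a)%Z /\ (1 <= n)%Z /\ ((n - a) mod 2 = 1)%Z.
Proof.
  unfold even_term; cbn [fst snd].
  destruct (Z.leb_spec 1 a), (Z.leb_spec 1 n), (Z.eqb_spec ((n - a) mod 2) 1); simpl; tauto.
Qed.

Lemma odd_term_supp a n : odd_term (a, n) <> 0 ->
  (1 <= a)%Z /\ (1 <= n)%Z /\ ((n - a) mod 4 = 2)%Z /\ (n mod 2 = 1)%Z.
Proof.
  unfold odd_term; cbn [fst snd].
  destruct (Z.leb_spec 1 a), (Z.leb_spec 1 n), (Z.eqb_spec ((n - a) mod 4) 2),
    (Z.eqb_spec (n mod 2) 1); simpl; tauto.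
Qed.

Lemma summable_even_term : summable even_term.
Proof.
  apply (summable_q q Hq Hq1 (fun p : Z * Z => Z.abs (fst p) + Z.abs (snd p))%Z
           (fun p => Z.abs (fst p) + Z.abs (snd p))%Z 1 0); [apply weight_prod; auto using weight_Z| |intros; lia].
  intros [a n]. destruct (classic (even_term (a, n) = 0)) as [H|H].
  - rewrite H, Cmod_0. pose proof (Cmod_ge_0 (q ^^ (Z.abs (fst (a, n)) + Z.abs (snd (a, n))))). lra.
  - apply even_term_supp in H. destruct H as [H1 [H2 H3]]. rewrite even_term_eq by auto.
    cbn [fst snd]. rewrite Cmod_mult, Cmod_sgn. apply Rmult_le_compat_l; [lra|].
    apply Cpowz_le; auto. nia.
Qed.

Lemma summable_odd_term : summable odd_term.
Proof.
  apply (summable_q q Hq Hq1 (fun p : Z * Z => Z.abs (fst p) / 2 + Z.abs (snd p) / 2)%Z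
           (fun p => Z.abs (fst p) / 2 + Z.abs (snd p) / 2)%Z 1 0); [apply (weight_prod q Hq _ _ weight_half weight_half)| |intros; lia].
  intros [a n]. destruct (classic (odd_term (a, n) = 0)) as [H|H].
  - rewrite H, Cmod_0. pose proof (Cmod_ge_0 (q ^^ (Z.abs (fst (a, n)) / 2 + Z.abs (snd (a, n)) / 2))). lra.
  - apply odd_term_supp in H. destruct H as [H1 [H2 [H3 H4]]]. rewrite odd_term_eq by auto.
    cbn [fst snd]. rewrite Cmod_mult, Cmod_sgn. apply Rmult_le_compat_l; [lra|].
    apply Cpowz_le; auto.
    assert (a + n - 1 <= a * n)%Z by nia. generalize dependent (a * n)%Z. intros; lia.
Qed.

(** As n - a is odd, the floors of (n - a)/2 and (a - n)/2 add up to -1, so the signs are opposite.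
    For [odd_term] the same holds with 4 in place of 2, because n - a = 2 mod 4. *)
Lemma even_term_anti a n : even_term (n, a) = - even_term (a, n).
Proof.
  destruct (classic (even_term (a, n) = 0)) as [H|H].
  - rewrite H. destruct (classic (even_term (n, a) = 0)) as [H'|H']; [rewrite H'; ring|].
    exfalso. apply even_term_supp in H'. destruct H' as [H1 [H2 H3]].
    rewrite even_term_eq in H by lia. revert H. apply Cmult_neq_0; apply Cpowz_neq0; auto using m1_neq0.
  - apply even_term_supp in H. destruct H as [H1 [H2 H3]]. rewrite !even_term_eq by lia.
    rewrite (sgn_neg (- ((n - a) / 2) - 1) ((a - n) / 2) ((n - a) / 2)) by lia.
    replace (2 * n * a)%Z with (2 * a * n)%Z by ring. ring.
Qed.

Lemma odd_term_anti a n : odd_term (n, a) = - odd_term (a, n).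
Proof.
  destruct (classic (odd_term (a, n) = 0)) as [H|H].
  - rewrite H. destruct (classic (odd_term (n, a) = 0)) as [H'|H']; [rewrite H'; ring|].
    exfalso. apply odd_term_supp in H'. destruct H' as [H1 [H2 H3]].
    rewrite odd_term_eq in H by lia. revert H. apply Cmult_neq_0; apply Cpowz_neq0; auto using m1_neq0.
  - apply odd_term_supp in H. destruct H as [H1 [H2 [H3 H4]]]. rewrite !odd_term_eq by lia.
    rewrite (sgn_neg (- ((n - a) / 4) - 1) ((a - n) / 4) ((n - a) / 4)) by lia.
    replace (n * a)%Z with (a * n)%Z by ring. ring.
Qed.

(** Both pairs have the product 3 a m, and 3 m - a differs from 3 a - m by 4 (m - a), so the signs
    agree. *)
Lemma even_term_3 a m : even_term (a, 3 * m)%Z = even_term (m, 3 * a)%Z.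
Proof.
  destruct (classic (even_term (a, 3 * m)%Z = 0)) as [H|H].
  - rewrite H. destruct (classic (even_term (m, 3 * a)%Z = 0)) as [H'|H']; [rewrite H'; ring|].
    exfalso. apply even_term_supp in H'. destruct H' as [H1 [H2 H3]].
    rewrite even_term_eq in H by lia. revert H. apply Cmult_neq_0; apply Cpowz_neq0; auto using m1_neq0.
  - apply even_term_supp in H. destruct H as [H1 [H2 H3]]. rewrite !even_term_eq by lia.
    rewrite (sgn_eq (m - a) ((3 * m - a) / 2) ((3 * a - m) / 2)) by lia.
    f_equal. f_equal. ring.
Qed.

Lemma odd_term_3 a m : odd_term (a, 3 * m)%Z = odd_term (m, 3 * a)%Z.
Proof.
  destruct (classic (odd_term (a, 3 * m)%Z = 0)) as [H|H].
  - rewrite H. destruct (classic (odd_term (m, 3 * a)%Z = 0)) as [H'|H']; [rewrite H'; ring|].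
    exfalso. apply odd_term_supp in H'. destruct H' as [H1 [H2 [H3 H4]]].
    rewrite odd_term_eq in H by lia. revert H. apply Cmult_neq_0; apply Cpowz_neq0; auto using m1_neq0.
  - apply odd_term_supp in H. destruct H as [H1 [H2 [H3 H4]]]. rewrite !odd_term_eq by lia.
    rewrite (sgn_eq ((m - a) / 2) ((3 * m - a) / 4) ((3 * a - m) / 4)) by lia.
    f_equal. f_equal. f_equal. ring.
Qed.

End DoubleSums.

(** The line n = 3 a and the residues of n modulo 3 cut the array into the pieces that the double
    sums [ds_term] of the recursion fill, up to sign and to one boundary diagonal. *)
Definition above (k : Z) (p : Z * Z) : bool :=
  ((3 * fst p <? snd p)%Z && (snd p mod 3 =? k)%Z)%bool.
Definition below (k : Z) (p : Z * Z) : bool :=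
  ((snd p <? 3 * fst p)%Z && (snd p mod 3 =? k)%Z)%bool.

Lemma restrict_residues (f : Z * Z -> C) : summable f ->
  csum (restrict (fun p => ((3 * fst p <? snd p)%Z && negb (snd p mod 3 =? 0)%Z)%bool) f)
  - csum (restrict (fun p => ((snd p <? 3 * fst p)%Z && negb (snd p mod 3 =? 0)%Z)%bool) f)
  = csum (restrict (above 1) f) + csum (restrict (above 2) f)
    - csum (restrict (below 1) f) - csum (restrict (below 2) f).
Proof.
  intros Hf. pose proof (fun P => summable_restrict P f Hf) as HP.
  rewrite <- csum_minus, <- csum_plus, <- csum_minus, <- csum_minus;
    repeat (first [apply HP | apply summable_minus | apply summable_plus]).
  apply csum_ext. intros [a n]. unfold restrict, above, below; cbn [fst snd].
  destruct (Z.ltb_spec (3 * a) n), (Z.ltb_spec n (3 * a)), (Z.eqb_spec (n mod 3) 0),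
    (Z.eqb_spec (n mod 3) 1), (Z.eqb_spec (n mod 3) 2); cbn [andb negb]; try lia; ring.
Qed.

Lemma pair_inv {A B} (a a' : A) (b b' : B) : (a, b) = (a', b') -> a = a' /\ b = b'.
Proof. intros H; injection H; auto. Qed.

Ltac injectivity :=
  let x := fresh in let y := fresh in let H := fresh in
  intros x y H; destruct x, y; cbn [fst snd] in H; apply pair_inv in H;
  f_equal; lia.

Ltac membership :=
  let p := fresh "p" in
  intros p; destruct p; unfold above, below; cbn [fst snd];
  rewrite ?Bool.andb_true_iff, ?Z.ltb_lt, ?Z.eqb_eq, ?Z.leb_le; lia.

Section AppellDoubleSums.

Variable q : C.
Hypothesis Hq : q <> 0.
Hypothesis Hq1 : (Cmod q < 1)%R.

Lemma q4_facts : q ^^ 4 <> 0 /\ (Cmod (q ^^ 4) < 1)%R.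
Proof.
  split; [apply Cpowz_neq0; auto|].
  change (q ^^ 4) with (q ^ 4). rewrite Cmod_pow. apply pow_lt_1_compat; [|lia].
  split; auto using Cmod_ge_0.
Qed.

Lemma alternating_geometric (c : C) (k : Z) : (0 < k)%Z ->
  csum (fun j : nat => c * ((-1) ^^ (Z.of_nat j) * q ^^ (k * Z.of_nat j))) = c * / (1 + q ^^ k).
Proof.
  intros Hk.
  destruct (geometric_series (- q ^^ k)) as [Hs E].
  { rewrite Cmod_opp. replace k with (Z.of_nat (Z.to_nat k)) by lia. rewrite Cpowz_nat, Cmod_pow.
    apply pow_lt_1_compat; [|lia]. split; auto using Cmod_ge_0. }
  replace (1 + q ^^ k) with (1 - - q ^^ k) by ring. rewrite <- E, <- csum_scal by auto.
  apply csum_ext. intros j. rewrite Cpowz_mul, !Cpowz_nat, <- Cpow_mult_l by auto.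
  f_equal. f_equal. ring.
Qed.

Lemma regular_q4 k : (k mod 4 = 2)%Z -> regular (q ^^ 4) (- q ^^ k).
Proof.
  intros Hk. split.
  - intros H. apply (Cpowz_neq0 q k Hq). replace (q ^^ k) with (- - q ^^ k) by ring. rewrite H; ring.
  - intros n H. rewrite <- Cpowz_mul in H by auto.
    assert (k + 4 * n = 0)%Z; [|lia]. apply (Cpowz_mod1 q Hq Hq1).
    rewrite Cpowz_add, <- Cmod_opp by auto.
    replace (- (q ^^ k * q ^^ (4 * n))) with (- q ^^ k * q ^^ (4 * n)) by ring.
    rewrite H. apply Cmod_1.
Qed.

Lemma summable_f3_appell :
  summable (fun r => (-1) ^^ r * q ^^ (12 * tri r + 8 * r) * / (1 + q ^^ (4 * r))).
Proof.
  destruct q4_facts as [H4 H41].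
  destruct (regular_inv_bounded _ H4 H41 _ (m1_regular _ H4 H41)) as [M [H0 HM]].
  apply summable_ext with (fun r => / (1 - -1 * (q ^^ 4) ^^ r) * ((-1) ^^ r * q ^^ (12 * tri r + 8 * r))).
  - intros r. rewrite <- Cpowz_mul by auto. replace (1 - -1 * q ^^ (4 * r)) with (1 + q ^^ (4 * r)) by ring.
    ring.
  - apply summable_bounded with M; auto.
    apply (summable_q q Hq Hq1 Z.abs (fun r => 12 * tri r + 8 * r)%Z 1 10); [apply weight_Z; auto| |].
    + intros r. rewrite Cmod_mult, Cmod_sgn. lra.
    + intros r. pose proof (tri_spec r). nia.
Qed.

Lemma summable_omega3_appell :
  summable (fun r => (-1) ^^ r * q ^^ (12 * tri r + 12 * r + 3) * / (1 + q ^^ (4 * r + 2))).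
Proof.
  destruct q4_facts as [H4 H41].
  destruct (regular_inv_bounded _ H4 H41 _ (regular_q4 2 eq_refl)) as [M [H0 HM]].
  apply summable_ext with (fun r => / (1 - - q ^^ 2 * (q ^^ 4) ^^ r) * ((-1) ^^ r * q ^^ (12 * tri r + 12 * r + 3))).
  - intros r. rewrite <- Cpowz_mul, (Cpowz_add q (4 * r)) by auto.
    replace (1 - - q ^^ 2 * q ^^ (4 * r)) with (1 + q ^^ (4 * r) * q ^^ 2) by ring. ring.
  - apply summable_bounded with M; auto.
    apply (summable_q q Hq Hq1 Z.abs (fun r => 12 * tri r + 12 * r + 3)%Z 1 10); [apply weight_Z; auto| |].
    + intros r. rewrite Cmod_mult, Cmod_sgn. lra.
    + intros r. pose proof (tri_spec r). nia.
Qed.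

(** The summand is invariant under r -> -r, and r = 0 gives 1/2. For r = a >= 1 the geometric
    expansion of 1 / (1 + q^(4 a)) runs through the row n = 3 a + 1 + 2 j, as 2 a n is then the
    resulting exponent. *)
Lemma f3_appell_double_sum :
  csum (fun r => (-1) ^^ r * q ^^ (12 * tri r + 8 * r) * / (1 + q ^^ (4 * r)))
  = / 2 + 2 * csum (restrict (fun p => (3 * fst p <? snd p)%Z) (even_term q)).
Proof.
  pose proof summable_f3_appell as Hs.
  pose proof (summable_even_term q Hq Hq1) as He.
  set (phi := fun p : nat * nat => (Z.of_nat (fst p) + 1, 3 * (Z.of_nat (fst p) + 1) + 1 + 2 * Z.of_nat (snd p))%Z).
  assert (Hi : forall x y, phi x = phi y -> x = y) by (unfold phi; injectivity).
  rewrite (csum_restrict_inj _ (even_term q) phi); auto.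
  2:{ unfold phi. membership. }
  2:{ intros [a n] H1 H2. apply Z.ltb_lt in H1. cbn [fst snd] in H1. apply even_term_supp in H2.
      exists (Z.to_nat (a - 1), Z.to_nat ((n - 3 * a - 1) / 2)). unfold phi; cbn [fst snd]. f_equal; lia. }
  rewrite csum_fubini by (apply (summable_inj (even_term q) phi); auto).
  rewrite csum_Z_nat by auto.
  rewrite csum_S by (apply (summable_inj _ Z.of_nat (fun x y => Nat2Z.inj x y) Hs)).
  assert (E : forall n : nat, csum (fun j => even_term q (phi (n, j)))
     = (-1) ^^ (Z.of_nat (S n)) * q ^^ (12 * tri (Z.of_nat (S n)) + 8 * Z.of_nat (S n))
        * / (1 + q ^^ (4 * Z.of_nat (S n)))).
  { intros n. rewrite <- alternating_geometric by lia. apply csum_ext. intros j.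
    unfold phi; cbn [fst snd]. rewrite even_term_eq by lia.
    set (m := Z.of_nat (S n)). replace (Z.of_nat n + 1)%Z with m by lia.
    rewrite (sgn_eq 0 _ (m + Z.of_nat j)) by lia. rewrite (Cpowz_add (-1)) by apply m1_neq0.
    rewrite (Cpowz_split q _ (12 * tri m + 8 * m) (4 * m * Z.of_nat j)); [ring | auto |].
    pose proof (tri_spec m). nia. }
  rewrite (csum_ext _ _ E).
  rewrite (csum_ext (fun n : nat => (-1) ^^ (- Z.of_nat (S n))
      * q ^^ (12 * tri (- Z.of_nat (S n)) + 8 * - Z.of_nat (S n)) * / (1 + q ^^ (4 * - Z.of_nat (S n))))
    (fun n => (-1) ^^ (Z.of_nat (S n)) * q ^^ (12 * tri (Z.of_nat (S n)) + 8 * Z.of_nat (S n))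
        * / (1 + q ^^ (4 * Z.of_nat (S n))))).
  - simpl (Z.of_nat 0). change (tri 0) with 0%Z. simpl (_ ^^ _).
    replace (/ (1 + 1)) with (/ 2) by (f_equal; ring). ring.
  - intros n. set (m := Z.of_nat (S n)).
    rewrite (sgn_eq (- m) (- m) m) by lia.
    rewrite (Cpowz_split q (12 * tri m + 8 * m) (12 * tri (- m) + 8 * - m) (4 * m)) by (auto; tri).
    replace (4 * - m)%Z with (- (4 * m))%Z by ring. rewrite Cpowz_opp by auto.
    destruct q4_facts as [H4 H41].
    assert (H1 : 1 + q ^^ (4 * m) <> 0).
    { replace (1 + q ^^ (4 * m)) with (1 - -1 * (q ^^ 4) ^^ m) by (rewrite <- Cpowz_mul by auto; ring).
      apply regular_sub; auto. apply m1_regular; auto. }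
    pose proof (Cpowz_neq0 q (4 * m) Hq).
    field. repeat split; auto.
Qed.

(** With a = 2 r + 1, the terms r >= 0 expand into n = 3 a + 4 j. The terms r < 0, reflected by r ->
    -r - 1, start one step later, at n = 3 a + 4. Hence the diagonal n = 3 a is counted only
    once. *)
Lemma omega3_appell_double_sum :
  csum (fun r => (-1) ^^ r * q ^^ (12 * tri r + 12 * r + 3) * / (1 + q ^^ (4 * r + 2)))
  = 2 * csum (restrict (fun p => (3 * fst p <? snd p)%Z) (odd_term q))
    + csum (restrict (fun p => (snd p =? 3 * fst p)%Z) (odd_term q)).
Proof.
  pose proof summable_omega3_appell as Hs.
  pose proof (summable_odd_term q Hq Hq1) as He.
  pose proof (fun P => summable_restrict P _ He) as HP.
  set (S1 := csum (restrict (fun p => (3 * fst p <=? snd p)%Z) (odd_term q))).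
  set (S2 := csum (restrict (fun p => (3 * fst p <? snd p)%Z) (odd_term q))).
  set (S3 := csum (restrict (fun p => (snd p =? 3 * fst p)%Z) (odd_term q))).
  assert (E0 : S1 = S2 + S3).
  { unfold S1, S2, S3. rewrite <- csum_plus by auto. apply csum_ext. intros [a n].
    unfold restrict; cbn [fst snd].
    destruct (Z.leb_spec (3 * a) n), (Z.ltb_spec (3 * a) n), (Z.eqb_spec n (3 * a)); try lia; ring. }
  replace (2 * S2 + S3) with (S1 + S2) by (rewrite E0; ring).
  rewrite csum_Z_nat by auto. f_equal.
  - set (phi := fun p : nat * nat => (2 * Z.of_nat (fst p) + 1, 3 * (2 * Z.of_nat (fst p) + 1) + 4 * Z.of_nat (snd p))%Z).
    assert (Hi : forall x y, phi x = phi y -> x = y) by (unfold phi; injectivity).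
    unfold S1. rewrite (csum_restrict_inj _ (odd_term q) phi); auto.
    2:{ unfold phi. membership. }
    2:{ intros [a n] H1 H2. apply Z.leb_le in H1. cbn [fst snd] in H1. apply odd_term_supp in H2.
        exists (Z.to_nat ((a - 1) / 2), Z.to_nat ((n - 3 * a) / 4)). unfold phi; cbn [fst snd]. f_equal; lia. }
    rewrite csum_fubini by (apply (summable_inj (odd_term q) phi); auto).
    apply csum_ext. intros n. rewrite <- alternating_geometric by lia. apply csum_ext. intros j.
    unfold phi; cbn [fst snd]. rewrite odd_term_eq by lia.
    set (m := Z.of_nat n).
    rewrite (sgn_eq 0 ((3 * (2 * m + 1) + 4 * Z.of_nat j - (2 * m + 1)) / 4) (m + Z.of_nat j)) by lia.
    rewrite (Cpowz_add (-1)) by apply m1_neq0.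
    rewrite (Cpowz_split q (((2 * m + 1) * (3 * (2 * m + 1) + 4 * Z.of_nat j) + 3) / 2) (12 * tri m + 12 * m + 3) ((4 * m + 2) * Z.of_nat j)); [ring | auto |].
    symmetry. apply Z.div_unique with 0%Z; [lia|]. pose proof (tri_spec m). nia.
  - set (phi := fun p : nat * nat => (2 * Z.of_nat (fst p) + 1, 3 * (2 * Z.of_nat (fst p) + 1) + 4 * Z.of_nat (snd p) + 4)%Z).
    assert (Hi : forall x y, phi x = phi y -> x = y) by (unfold phi; injectivity).
    unfold S2. rewrite (csum_restrict_inj _ (odd_term q) phi); auto.
    2:{ unfold phi. membership. }
    2:{ intros [a n] H1 H2. apply Z.ltb_lt in H1. cbn [fst snd] in H1. apply odd_term_supp in H2.
        exists (Z.to_nat ((a - 1) / 2), Z.to_nat ((n - 3 * a - 4) / 4)). unfold phi; cbn [fst snd]. f_equal; lia. }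
    rewrite csum_fubini by (apply (summable_inj (odd_term q) phi); auto).
    apply csum_ext. intros n. set (m := Z.of_nat n).
    replace (- Z.of_nat (S n))%Z with (- m - 1)%Z by lia.
    transitivity ((-1) ^^ (m + 1) * q ^^ (12 * tri m + 12 * m + 3 + (4 * m + 2)) * / (1 + q ^^ (4 * m + 2))).
    + rewrite (sgn_eq (- m - 1) (- m - 1) (m + 1)) by lia.
      rewrite (Cpowz_split q (12 * tri m + 12 * m + 3 + (4 * m + 2))
         (12 * tri (- m - 1) + 12 * (- m - 1) + 3) (4 * m + 2)) by (auto; tri).
      replace (4 * (- m - 1) + 2)%Z with (- (4 * m + 2))%Z by ring. rewrite Cpowz_opp by auto.
      destruct q4_facts as [H4 H41].
      assert (H1 : 1 + q ^^ (4 * m + 2) <> 0).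
      { replace (1 + q ^^ (4 * m + 2)) with (1 - - q ^^ 2 * (q ^^ 4) ^^ m)
          by (rewrite <- Cpowz_mul, Cpowz_add by auto; ring).
        apply regular_sub; auto. apply regular_q4; auto. }
      pose proof (Cpowz_neq0 q (4 * m + 2) Hq).
      field. repeat split; auto.
    + rewrite <- alternating_geometric by lia. apply csum_ext. intros j.
      unfold phi; cbn [fst snd]. rewrite odd_term_eq by lia. fold m.
      rewrite (sgn_eq 0 ((3 * (2 * m + 1) + 4 * Z.of_nat j + 4 - (2 * m + 1)) / 4) (m + 1 + Z.of_nat j)) by lia.
      rewrite (Cpowz_add (-1) (m + 1)) by apply m1_neq0.
      rewrite (Cpowz_split q (((2 * m + 1) * (3 * (2 * m + 1) + 4 * Z.of_nat j + 4) + 3) / 2) (12 * tri m + 12 * m + 3 + (4 * m + 2)) ((4 * m + 2) * Z.of_nat j)); [ring | auto |].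
      symmetry. apply Z.div_unique with 0%Z; [lia|]. pose proof (tri_spec m). nia.
Qed.

(** The solution of the recursion is evaluated at index l + J, and the inhomogeneous term entered at
    index J - 1. The parameters [a] and [c] come from that term together with the weight, [b] from
    the weight alone. *)
Definition ds_term (a b c : Z) (p : nat * nat) : C :=
  let l := Z.of_nat (fst p) in let J := (Z.of_nat (snd p) + 1)%Z in
  (-1) ^^ (l + J) * q ^^ (6 * l * l + 12 * l * J + a * J + b * l + c).

Lemma summable_ds_term a b c : (2 <= a)%Z -> (-2 <= b)%Z -> summable (ds_term a b c).
Proof.
  intros Ha Hb.
  apply (summable_q q Hq Hq1 (fun p : nat * nat => Z.of_nat (fst p) + Z.of_nat (snd p))%Z
    (fun p : nat * nat => let l := Z.of_nat (fst p) in let J := (Z.of_nat (snd p) + 1)%Z in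
       6 * l * l + 12 * l * J + a * J + b * l + c)%Z 1 (- c)); [apply weight_prod; auto using weight_nat| |].
  - intros p. unfold ds_term. rewrite Cmod_mult, Cmod_sgn. lra.
  - intros p. cbv zeta. generalize (Zle_0_nat (fst p)) (Zle_0_nat (snd p)).
    generalize (Z.of_nat (fst p)) (Z.of_nat (snd p)). intros l j Hl Hj. nia.
Qed.

Lemma ds_even (P : Z * Z -> bool) (phi : nat * nat -> Z * Z) (e : Z) a b c :
  (forall x y, phi x = phi y -> x = y) -> (forall p, P (phi p) = true) ->
  (forall i, P i = true -> even_term q i <> 0 -> exists p, phi p = i) ->
  (forall p, ds_term a b c p = (-1) ^^ e * even_term q (phi p)) ->
  csum (ds_term a b c) = (-1) ^^ e * csum (restrict P (even_term q)).
Proof.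
  intros H1 H2 H3 H4. pose proof (summable_even_term q Hq Hq1) as He.
  rewrite (csum_restrict_inj P (even_term q) phi) by auto.
  rewrite <- csum_scal by (apply (summable_inj (even_term q) phi); auto).
  apply csum_ext, H4.
Qed.

Lemma ds_odd (P : Z * Z -> bool) (phi : nat * nat -> Z * Z) (e : Z) a b c :
  (forall x y, phi x = phi y -> x = y) -> (forall p, P (phi p) = true) ->
  (forall i, P i = true -> odd_term q i <> 0 -> exists p, phi p = i) ->
  (forall p, ds_term a b c p = (-1) ^^ e * odd_term q (phi p)) ->
  csum (ds_term a b c) = (-1) ^^ e * csum (restrict P (odd_term q)).
Proof.
  intros H1 H2 H3 H4. pose proof (summable_odd_term q Hq Hq1) as He.
  rewrite (csum_restrict_inj P (odd_term q) phi) by auto.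
  rewrite <- csum_scal by (apply (summable_inj (odd_term q) phi); auto).
  apply csum_ext, H4.
Qed.

Ltac ds_hyps H1 H2 :=
  unfold above, below in H1; cbn [fst snd] in H1;
  rewrite ?Bool.andb_true_iff, ?Z.ltb_lt, ?Z.eqb_eq, ?Z.leb_le in H1;
  first [apply even_term_supp in H2 | apply odd_term_supp in H2].

Ltac ds_even_term k :=
  let l := fresh "l" in let j := fresh "j" in
  intros [l j]; unfold ds_term; cbv zeta; cbn [fst snd]; rewrite even_term_eq by lia;
  rewrite Cmult_assoc, <- (Cpowz_add (-1)) by apply m1_neq0;
  f_equal; [apply (sgn_eq (k (Z.of_nat l) (Z.of_nat j))%Z); lia | f_equal; ring].

Ltac ds_odd_term k :=
  let l := fresh "l" in let j := fresh "j" in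
  intros [l j]; unfold ds_term; cbv zeta; cbn [fst snd]; rewrite odd_term_eq by lia;
  rewrite Cmult_assoc, <- (Cpowz_add (-1)) by apply m1_neq0;
  f_equal; [apply (sgn_eq (k (Z.of_nat l) (Z.of_nat j))%Z); lia
           | f_equal; apply Z.div_unique with 0%Z; [lia | ring]].

(** The exponent factors as 2 a n with a = l + 2 J and n = 3 l + 1. The other lemmas of this kind
    rest on similar factorisations, into (a n + 3)/2 in the odd case; the residue of n modulo 3 and
    the side of n = 3 a are read off from the factors. *)
Lemma ds_even_1 : csum (ds_term 4 2 0) = csum (restrict (below 1) (even_term q)).
Proof.
  rewrite (ds_even (below 1) (fun p => let l := Z.of_nat (fst p) in let J := (Z.of_nat (snd p) + 1)%Z in
     (l + 2 * J, 3 * l + 1)%Z) 0); [change ((-1) ^^ 0) with (1 : C); ring| | | |].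
  - injectivity.
  - membership.
  - intros [a n] H1 H2. ds_hyps H1 H2.
    exists (Z.to_nat ((n - 1) / 3), Z.to_nat ((a - (n - 1) / 3) / 2 - 1)). cbn [fst snd]. f_equal; lia.
  - ds_even_term (fun l j : Z => j + 1)%Z.
Qed.

Lemma ds_even_2 : csum (ds_term 12 2 (-4)) = csum (restrict (above 1) (even_term q)).
Proof.
  rewrite (ds_even (above 1) (fun p => let l := Z.of_nat (fst p) in let J := (Z.of_nat (snd p) + 1)%Z in
     (l + 1, 3 * (l + 1) + 6 * J - 5)%Z) 0); [change ((-1) ^^ 0) with (1 : C); ring| | | |].
  - injectivity.
  - membership.
  - intros [a n] H1 H2. ds_hyps H1 H2.
    exists (Z.to_nat (a - 1), Z.to_nat ((n - 3 * a - 1) / 6)). cbn [fst snd]. f_equal; lia.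
  - ds_even_term (fun l j : Z => - j)%Z.
Qed.

Lemma ds_even_4 : csum (ds_term 8 (-2) (-4)) = - csum (restrict (below 2) (even_term q)).
Proof.
  rewrite (ds_even (below 2) (fun p => let l := Z.of_nat (fst p) in let J := (Z.of_nat (snd p) + 1)%Z in
     (l + 2 * J - 1, 3 * l + 2)%Z) 1); [change ((-1) ^^ 1) with ((-1) ^ 1); ring| | | |].
  - injectivity.
  - membership.
  - intros [a n] H1 H2. ds_hyps H1 H2.
    exists (Z.to_nat ((n - 2) / 3), Z.to_nat ((a - (n - 2) / 3 - 1) / 2)). cbn [fst snd]. f_equal; lia.
  - ds_even_term (fun l j : Z => j)%Z.
Qed.

(** Here J = 1 lands on n = 3 a - 1, just below the line, so the double sum covers one diagonal too
    many. This diagonal is a partial theta series, which cancels in [hecke_0] against the constant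
    subtracted there to obtain convergence. *)
Lemma ds_even_3 : csum (ds_term 12 (-2) (-8)) = - csum (restrict (above 2) (even_term q))
   + csum (fun n : nat => (-1) ^^ (Z.of_nat n + 1) * q ^^ (6 * (Z.of_nat n + 1) * (Z.of_nat n + 1) - 2 * (Z.of_nat n + 1))).
Proof.
  pose proof (summable_even_term q Hq Hq1) as He.
  rewrite (ds_even (fun p => ((3 * fst p - 1 <=? snd p)%Z && (snd p mod 3 =? 2)%Z)%bool)
     (fun p => let l := Z.of_nat (fst p) in let J := (Z.of_nat (snd p) + 1)%Z in
     (l + 1, 3 * (l + 1) + 6 * J - 7)%Z) 1).
  - transitivity (- (csum (restrict (above 2) (even_term q))
        + csum (restrict (fun p => (snd p =? 3 * fst p - 1)%Z) (even_term q)))).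
    + rewrite <- csum_plus by (apply summable_restrict; auto). simpl ((-1) ^^ 1).
      rewrite (csum_ext _ (fun i => restrict (above 2) (even_term q) i +
         restrict (fun p => (snd p =? 3 * fst p - 1)%Z) (even_term q) i)); [ring|].
      intros [a n]. unfold restrict, above; cbn [fst snd].
      destruct (Z.leb_spec (3 * a - 1) n), (Z.eqb_spec (n mod 3) 2), (Z.ltb_spec (3 * a) n),
        (Z.eqb_spec n (3 * a - 1)); cbn [andb]; try lia; ring.
    + rewrite (csum_restrict_inj (fun p => (snd p =? 3 * fst p - 1)%Z) (even_term q)
        (fun n : nat => (Z.of_nat n + 1, 3 * (Z.of_nat n + 1) - 1)%Z)); auto.
      * transitivity (- csum (restrict (above 2) (even_term q)) +
          - csum (fun n : nat => even_term q (Z.of_nat n + 1, 3 * (Z.of_nat n + 1) - 1)%Z)); [ring|].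
        f_equal. rewrite <- csum_opp.
        -- apply csum_ext. intros n. rewrite even_term_eq by lia.
           rewrite (sgn_neg (-1) ((3 * (Z.of_nat n + 1) - 1 - (Z.of_nat n + 1)) / 2) (Z.of_nat n + 1)) by lia.
           replace (2 * (Z.of_nat n + 1) * (3 * (Z.of_nat n + 1) - 1))%Z
             with (6 * (Z.of_nat n + 1) * (Z.of_nat n + 1) - 2 * (Z.of_nat n + 1))%Z by ring. ring.
        -- apply (summable_inj (even_term q)); auto. intros x y H. apply pair_inv in H. lia.
      * intros x y H. apply pair_inv in H. lia.
      * intros n. cbn [fst snd]. apply Z.eqb_refl.
      * intros [a n] H1 H2. apply Z.eqb_eq in H1. cbn [fst snd] in H1. apply even_term_supp in H2.
        exists (Z.to_nat (a - 1)). f_equal; lia.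
  - injectivity.
  - membership.
  - intros [a n] H1 H2. ds_hyps H1 H2.
    exists (Z.to_nat (a - 1), Z.to_nat ((n - 3 * a + 1) / 6)). cbn [fst snd]. f_equal; lia.
  - ds_even_term (fun l j : Z => - j)%Z.
Qed.

Lemma ds_odd_1 : csum (ds_term 6 2 1) = - csum (restrict (above 2) (odd_term q)).
Proof.
  rewrite (ds_odd (above 2) (fun p => let l := Z.of_nat (fst p) in let J := (Z.of_nat (snd p) + 1)%Z in
     (2 * l + 1, 6 * l + 12 * J - 1)%Z) 1); [change ((-1) ^^ 1) with ((-1) ^ 1); ring| | | |].
  - injectivity.
  - membership.
  - intros [a n] H1 H2. ds_hyps H1 H2.
    exists (Z.to_nat ((a - 1) / 2), Z.to_nat ((n - 3 * a - 8) / 12)). cbn [fst snd]. f_equal; lia.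
  - ds_odd_term (fun l j : Z => - j - 1)%Z.
Qed.

Lemma ds_odd_2 : csum (ds_term 10 2 (-1)) = - csum (restrict (below 2) (odd_term q)).
Proof.
  rewrite (ds_odd (below 2) (fun p => let l := Z.of_nat (fst p) in let J := (Z.of_nat (snd p) + 1)%Z in
     (2 * l + 4 * J - 1, 6 * l + 5)%Z) 1); [change ((-1) ^^ 1) with ((-1) ^ 1); ring| | | |].
  - injectivity.
  - membership.
  - intros [a n] H1 H2. ds_hyps H1 H2.
    exists (Z.to_nat ((n - 5) / 6), Z.to_nat ((a - 2 * ((n - 5) / 6) - 3) / 4)). cbn [fst snd]. f_equal; lia.
  - ds_odd_term (fun l j : Z => j)%Z.
Qed.

Lemma ds_odd_3 : csum (ds_term 2 (-2) 1) = csum (restrict (below 1) (odd_term q)).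
Proof.
  rewrite (ds_odd (below 1) (fun p => let l := Z.of_nat (fst p) in let J := (Z.of_nat (snd p) + 1)%Z in
     (2 * l + 4 * J - 1, 6 * l + 1)%Z) 0); [change ((-1) ^^ 0) with (1 : C); ring| | | |].
  - injectivity.
  - membership.
  - intros [a n] H1 H2. ds_hyps H1 H2.
    exists (Z.to_nat ((n - 1) / 6), Z.to_nat ((a - 2 * ((n - 1) / 6) - 3) / 4)). cbn [fst snd]. f_equal; lia.
  - ds_odd_term (fun l j : Z => j + 1)%Z.
Qed.

Lemma ds_odd_4 : csum (ds_term 6 (-2) (-1)) = csum (restrict (above 1) (odd_term q)).
Proof.
  rewrite (ds_odd (above 1) (fun p => let l := Z.of_nat (fst p) in let J := (Z.of_nat (snd p) + 1)%Z in
     (2 * l + 1, 6 * l + 12 * J - 5)%Z) 0); [change ((-1) ^^ 0) with (1 : C); ring| | | |].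
  - injectivity.
  - membership.
  - intros [a n] H1 H2. ds_hyps H1 H2.
    exists (Z.to_nat ((a - 1) / 2), Z.to_nat ((n - 3 * a - 4) / 12)). cbn [fst snd]. f_equal; lia.
  - ds_odd_term (fun l j : Z => - j)%Z.
Qed.

End AppellDoubleSums.

(** * Partial theta functions and the Laurent expansion of (q)^3 / j(z; q) *)

Section PartialTheta.

Variable q : C.
Hypothesis Hq : q <> 0.
Hypothesis Hq1 : (Cmod q < 1)%R.

Definition pt_term (k : Z) (m : nat) : C :=
  (-1) ^^ (Z.of_nat m) * q ^^ (tri (Z.of_nat m) + Z.of_nat m + k * Z.of_nat m).

(* For [|q| < |z| < 1] these are the Laurent coefficients of [(q)^3 / j(z;q)]. *)
Definition pt (k : Z) : C := csum (pt_term k).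

Lemma summable_pt k : summable (pt_term k).
Proof.
  apply (summable_q q Hq Hq1 Z.of_nat (fun m => tri (Z.of_nat m) + Z.of_nat m + k * Z.of_nat m)%Z
           1 (4 * (Z.abs k + 2) * (Z.abs k + 2))).
  - apply weight_nat; auto.
  - intros m. unfold pt_term. rewrite Cmod_mult, Cmod_sgn. lra.
  - intros m. pose proof (tri_spec (Z.of_nat m)) as H. assert (0 <= Z.of_nat m)%Z by lia.
    generalize dependent (tri (Z.of_nat m)). generalize dependent (Z.of_nat m). intros x Hx t Ht.
    assert (- Z.abs k * x <= k * x)%Z by nia.
    assert (0 <= (x - 2 * (Z.abs k + 2)) * (x - 2 * (Z.abs k + 2)))%Z by apply Z.square_nonneg.
    assert (0 <= Z.abs k)%Z by lia. nia.
Qed.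

Lemma pt_tail k : csum (fun m => pt_term k (S m)) = - q ^^ (k + 1) * pt (k + 1).
Proof.
  unfold pt. rewrite <- csum_scal by apply summable_pt. apply csum_ext. intros m. unfold pt_term.
  replace (Z.of_nat (S m)) with (Z.of_nat m + 1)%Z by lia.
  rewrite Cpowz_S by apply m1_neq0.
  rewrite (Cpowz_split q (tri (Z.of_nat m + 1) + (Z.of_nat m + 1) + k * (Z.of_nat m + 1)) (k + 1)
    (tri (Z.of_nat m) + Z.of_nat m + (k + 1) * Z.of_nat m)) by (auto; tri). ring.
Qed.

Lemma pt_rec k : pt k = 1 - q ^^ (k + 1) * pt (k + 1).
Proof.
  unfold pt at 1. rewrite csum_S by apply summable_pt. rewrite pt_tail.
  unfold pt_term. simpl (Z.of_nat 0). replace (tri 0 + 0 + k * 0)%Z with 0%Z by (rewrite Z.mul_0_r; reflexivity).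
  simpl (_ ^^ 0). ring.
Qed.

Lemma pt_sym k : pt (- k) = q ^^ k * pt k.
Proof.
  assert (H : forall n : nat, pt (- Z.of_nat n) = q ^^ (Z.of_nat n) * pt (Z.of_nat n)).
  { induction n; [simpl; ring|].
    assert (E : q ^^ (Z.of_nat n + 1) * pt (Z.of_nat n + 1) = 1 - pt (Z.of_nat n))
      by (rewrite (pt_rec (Z.of_nat n)); ring).
    replace (Z.of_nat (S n)) with (Z.of_nat n + 1)%Z by lia. rewrite E, pt_rec.
    replace (- (Z.of_nat n + 1) + 1)%Z with (- Z.of_nat n)%Z by lia. rewrite IHn, Cmult_assoc, <- Cpowz_add by auto.
    replace (- Z.of_nat n + Z.of_nat n)%Z with 0%Z by lia. simpl. ring. }
  destruct (Z_le_gt_dec 0 k) as [Hk|Hk].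
  - rewrite <- (Z2Nat.id k) by auto. apply H.
  - specialize (H (Z.to_nat (- k))). replace (Z.of_nat (Z.to_nat (- k))) with (- k)%Z in H by lia.
    rewrite Z.opp_involutive in H. rewrite H, Cmult_assoc, <- Cpowz_add by auto.
    replace (k + - k)%Z with 0%Z by lia. simpl. ring.
Qed.

Lemma pt_bound : exists M, (0 < M)%R /\ (forall k, (Cmod (pt k) <= M)%R) /\
  forall k, (k <= 0)%Z -> (Cmod (pt k) <= M * Cmod (q ^^ Z.abs k))%R.
Proof.
  assert (H : exists M, (0 < M)%R /\ forall k, (0 <= k)%Z -> (Cmod (pt k) <= M)%R).
  { destruct (summable_pt 0) as [B HB]. exists (Rmax B 1). split; [pose proof (Rmax_r B 1); lra|].
    intros k Hk. eapply Rle_trans; [|apply (Rmax_l B 1)].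
    apply csum_norm with (fun m => Cmod (pt_term 0 m)); auto.
    intros m. unfold pt_term. rewrite !Cmod_mult. apply Rmult_le_compat_l; [apply Cmod_ge_0|].
    apply Cpowz_le; auto. nia. }
  destruct H as [M [H0 HM]]. exists M. split; auto.
  assert (HN : forall k, (k <= 0)%Z -> (Cmod (pt k) <= M * Cmod (q ^^ Z.abs k))%R).
  { intros k Hk. replace k with (- (- k))%Z at 1 by lia. rewrite pt_sym, Cmod_mult, Rmult_comm.
    replace (Z.abs k) with (- k)%Z by lia. apply Rmult_le_compat_r; [apply Cmod_ge_0|].
    apply HM. lia. }
  split; auto. intros k. destruct (Z_le_gt_dec 0 k) as [Hk|Hk]; auto.
  eapply Rle_trans; [apply HN; lia|].
  pose proof (Cpowz_le q 0 (Z.abs k) Hq Hq1 ltac:(lia)) as H. simpl (q ^^ 0) in H. rewrite Cmod_1 in H.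
  nra.
Qed.

(** Taking off the indicator of k >= 0 removes the pole 1 / (1 - z) from the generating function.
    The remainder decays in both directions, so its series converges on the unit circle too. *)
Definition ptr (k : Z) : C := pt k - (if (0 <=? k)%Z then 1 else 0).

Lemma ptr_bound : exists M, (0 < M)%R /\ forall k, (Cmod (ptr k) <= M * Cmod (q ^^ Z.abs k))%R.
Proof.
  destruct pt_bound as [M [H0 [HM HN]]]. exists M. split; auto. intros k. unfold ptr.
  destruct (Z.leb_spec 0 k).
  - rewrite pt_rec. replace (1 - q ^^ (k + 1) * pt (k + 1) - 1) with (- (q ^^ (k + 1) * pt (k + 1))) by ring.
    rewrite Cmod_opp, Cmod_mult, Rmult_comm. apply Rmult_le_compat; auto using Cmod_ge_0.
    apply Cpowz_le; auto. lia.
  - replace (pt k - 0) with (pt k) by ring. apply HN. lia.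
Qed.

Lemma summable_annulus (z : C) : z <> 0 -> (Cmod q < Cmod z < / Cmod q)%R ->
  summable (fun k => q ^^ Z.abs k * z ^^ k).
Proof.
  intros Hz [H1 H2]. pose proof (proj1 (Cmod_gt_0 q) Hq). pose proof (proj1 (Cmod_gt_0 z) Hz).
  apply rsummable_Z.
  - intros; apply Cmod_ge_0.
  - eapply rsummable_le; [|apply (rsummable_geom (Cmod (q * z)))].
    + intros n. rewrite Z.abs_eq by lia. rewrite !Cpowz_nat, <- Cpow_mult_l, Cmod_pow. lra.
    + split; [apply Cmod_ge_0|]. rewrite Cmod_mult.
      apply Rmult_lt_reg_l with (/ Cmod q)%R; [apply Rinv_0_lt_compat; auto|].
      rewrite <- Rmult_assoc, Rinv_l by lra. lra.
  - eapply rsummable_le; [|apply (rsummable_geom (Cmod (q / z)))].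
    + intros n. replace (Z.abs (- Z.of_nat n)) with (Z.of_nat n) by lia.
      rewrite Cpowz_opp_nat, Cpowz_nat by auto. unfold Cdiv.
      rewrite <- Cmod_pow, Cpow_mult_l, Cpow_inv by auto. lra.
    + split; [apply Cmod_ge_0|]. rewrite Cmod_div by auto.
      apply Rmult_lt_reg_r with (Cmod z); auto. unfold Rdiv. rewrite Rmult_assoc, Rinv_l by lra. lra.
Qed.

Lemma summable_ptr (z : C) : z <> 0 -> (Cmod q < Cmod z < / Cmod q)%R ->
  summable (fun k => ptr k * z ^^ k).
Proof.
  intros Hz H. destruct ptr_bound as [M [H0 HM]].
  apply summable_le with (fun k => (M * Cmod (q ^^ Z.abs k * z ^^ k))%R).
  - intros k. rewrite !Cmod_mult, <- Rmult_assoc. apply Rmult_le_compat_r; [apply Cmod_ge_0 | auto].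
  - apply rsummable_scal; [lra|]. apply summable_annulus; auto.
Qed.

(** Apart from r = 0, which stays as 1 / (1 - z), every partial fraction is a geometric series valid
    on both sides of the unit circle. After exchanging the summations, r > 0 yields the coefficients
    with k >= 0 and r < 0 those with k < 0. *)
Lemma lterm_expansion (z : C) : regular q z -> (Cmod q < Cmod z < / Cmod q)%R ->
  csum (lterm q z) = / (1 - z) + csum (fun k => ptr k * z ^^ k).
Proof.
  intros Hr Hz. pose proof (proj1 Hr) as Hz0. pose proof (summable_lterm q Hq Hq1 z Hr) as Hl.
  pose proof (summable_ptr z Hz0 Hz) as Hp.
  pose proof (proj1 (Cmod_gt_0 q) Hq) as Hq0. pose proof (proj1 (Cmod_gt_0 z) Hz0) as Hzp.
  assert (B1 : (Cmod (q * z) < 1)%R).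
  { rewrite Cmod_mult. apply Rmult_lt_reg_l with (/ Cmod q)%R; [apply Rinv_0_lt_compat; auto|].
    rewrite <- Rmult_assoc, Rinv_l by lra. lra. }
  assert (B2 : (Cmod (q / z) < 1)%R).
  { rewrite Cmod_div by auto. apply Rmult_lt_reg_r with (Cmod z); auto.
    unfold Rdiv. rewrite Rmult_assoc, Rinv_l by lra. lra. }
  assert (Hb : forall m : nat, (Cmod (q ^ m) <= 1)%R).
  { intros m. rewrite Cmod_pow, <- (pow1 m). apply pow_incr. split; [apply Cmod_ge_0 | lra]. }
  assert (Hth : summable (fun m : nat => (-1) ^^ (Z.of_nat (S m)) * q ^^ (tri (Z.of_nat (S m))))).
  { apply (summable_q q Hq Hq1 Z.of_nat (fun m => tri (Z.of_nat (S m))) 1 1); [apply weight_nat; auto| |].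
    - intros m. rewrite Cmod_mult, Cmod_sgn. lra.
    - intros m. pose proof (tri_spec (Z.of_nat (S m))). nia. }
  rewrite (csum_Z_nat (lterm q z)) by auto.
  rewrite (csum_S (fun n => lterm q z (Z.of_nat n)))
    by (apply (summable_inj _ Z.of_nat (fun x y => Nat2Z.inj x y) Hl)).
  rewrite (csum_Z_nat (fun k => ptr k * z ^^ k)) by auto.
  replace (lterm q z (Z.of_nat 0)) with (/ (1 - z)).
  2:{ unfold lterm. simpl. change (tri 0 + 0)%Z with 0%Z. simpl. replace (1 - z * 1) with (1 - z) by ring. ring. }
  rewrite <- Cplus_assoc. f_equal. f_equal.
  (* The power taken out in front has modulus at most 1, and the rest is a function of m times a
     function of k; this gives the joint summability for the exchange. *)
  - transitivity (csum (fun m : nat => csum (fun k : nat => q ^ (k * m + 1 * m + 1) * ((-1) ^^ (Z.of_nat (S m)) * q ^^ (tri (Z.of_nat (S m)))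
          * (q * z) ^ k)))).
    + apply csum_ext. intros m.
      destruct (geometric_series (z * q ^^ (Z.of_nat (S m)))) as [Hg Eg].
      { rewrite Cpowz_nat. replace (z * q ^ S m) with (q * z * q ^ m) by (simpl; ring).
        rewrite Cmod_mult. pose proof (Hb m). pose proof (Cmod_ge_0 (q * z)). nra. }
      unfold lterm. rewrite <- Eg, <- csum_scal by auto. apply csum_ext. intros k.
      rewrite (Cpowz_add q (tri (Z.of_nat (S m)))) by auto. rewrite !Cpowz_nat, !Cpow_mult_l.
      rewrite <- (Cpow_mult_r q (S m) k).
      replace (q ^ (S m * k)) with (q ^ (k * m) * q ^ k) by (rewrite <- Cpow_add_r; f_equal; ring).
      rewrite !Cpow_add_r, Cpow_1_r, Nat.mul_1_l. simpl. ring.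
    + rewrite (csum_exchange (fun m k : nat => q ^ (k * m + 1 * m + 1) * ((-1) ^^ (Z.of_nat (S m)) * q ^^ (tri (Z.of_nat (S m)))
          * (q * z) ^ k))).
      2:{ apply (summable_bounded (fun p : nat * nat => (-1) ^^ (Z.of_nat (S (fst p))) * q ^^ (tri (Z.of_nat (S (fst p)))) * (q * z) ^ (snd p))
               (fun p => q ^ (snd p * fst p + 1 * fst p + 1)) 1); auto.
          apply (summable_prod (fun m : nat => (-1) ^^ (Z.of_nat (S m)) * q ^^ (tri (Z.of_nat (S m)))) (fun k => (q * z) ^ k)); auto.
          apply geometric_series; auto. }
      apply csum_ext. intros k.
      transitivity (csum (fun m => z ^ k * pt_term (Z.of_nat k) (S m))).
      * apply csum_ext. intros m. unfold pt_term.
        rewrite Cpow_mult_l.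
        rewrite (Cpowz_split q (tri (Z.of_nat (S m)) + Z.of_nat (S m) + Z.of_nat k * Z.of_nat (S m))
           (tri (Z.of_nat (S m))) (Z.of_nat (k * m + 1 * m + 1) + Z.of_nat k)) by (auto; lia).
        rewrite (Cpowz_add q (Z.of_nat (k * m + 1 * m + 1))), !(Cpowz_nat q) by auto. ring.
      * rewrite csum_scal by (apply (summable_inj (pt_term (Z.of_nat k)) S); auto; apply summable_pt).
        rewrite pt_tail. unfold ptr. rewrite (pt_rec (Z.of_nat k)).
        destruct (Z.leb_spec 0 (Z.of_nat k)); [|lia]. rewrite Cpowz_nat. ring.
  - transitivity (csum (fun m : nat => csum (fun k : nat => q ^ (k * m + m + 1) * ((-1) ^^ (Z.of_nat (S m)) * q ^^ (tri (Z.of_nat (S m)))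
          * (- / z * (q / z) ^ k))))).
    + apply csum_ext. intros m.
      destruct (geometric_series (q ^ S m / z)) as [Hg Eg].
      { replace (q ^ S m / z) with (q / z * q ^ m) by (simpl; field; auto).
        rewrite Cmod_mult. pose proof (Hb m). pose proof (Cmod_ge_0 (q / z)). nra. }
      pose proof (regular_sub q z (- Z.of_nat (S m)) Hr) as Hne. rewrite Cpowz_opp_nat in Hne by auto.
      assert (Hqs : q ^ S m <> 0) by (apply Cpow_nz; auto).
      transitivity ((-1) ^^ (Z.of_nat (S m)) * q ^^ (tri (Z.of_nat (S m))) * (- / z * q ^ S m) * / (1 - q ^ S m / z)).
      * unfold lterm. rewrite (sgn_eq (- Z.of_nat (S m)) (- Z.of_nat (S m)) (Z.of_nat (S m))) by lia.
        replace (tri (- Z.of_nat (S m)) + - Z.of_nat (S m))%Z with (tri (Z.of_nat (S m))) by tri.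
        rewrite Cpowz_opp_nat by auto. rewrite <- !Cmult_assoc. f_equal. f_equal.
        assert (1 - q ^ S m / z <> 0).
        { intros H. apply Hne. replace (1 - z * / q ^ S m) with (- z * / q ^ S m * (1 - q ^ S m / z)) by (field; auto).
          rewrite H. ring. }
        assert (q ^ S m - z <> 0).
        { intros H'. apply Hne. replace z with (q ^ S m - (q ^ S m - z)) by ring. rewrite H'. field; auto. }
        assert (z - q ^ S m <> 0).
        { intros H'. apply H0. replace (q ^ S m - z) with (- (z - q ^ S m)) by ring. rewrite H'. ring. }
        field. repeat split; auto.
      * rewrite <- Eg, <- csum_scal by auto. apply csum_ext. intros k.
        unfold Cdiv. rewrite !Cpow_mult_l, <- (Cpow_mult_r q (S m) k).
        replace (q ^ (S m * k)) with (q ^ (k * m) * q ^ k) by (rewrite <- Cpow_add_r; f_equal; ring).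
        rewrite !Cpow_add_r, Cpow_1_r. simpl. ring.
    + rewrite (csum_exchange (fun m k : nat => q ^ (k * m + m + 1) * ((-1) ^^ (Z.of_nat (S m)) * q ^^ (tri (Z.of_nat (S m)))
          * (- / z * (q / z) ^ k)))).
      2:{ apply (summable_bounded (fun p : nat * nat => (-1) ^^ (Z.of_nat (S (fst p))) * q ^^ (tri (Z.of_nat (S (fst p)))) * (- / z * (q / z) ^ (snd p)))
               (fun p => q ^ (snd p * fst p + fst p + 1)) 1); auto.
          apply (summable_prod (fun m : nat => (-1) ^^ (Z.of_nat (S m)) * q ^^ (tri (Z.of_nat (S m)))) (fun k => - / z * (q / z) ^ k)); auto.
          apply summable_scal, geometric_series; auto. }
      apply csum_ext. intros k.
      transitivity (csum (fun m => q ^^ (Z.of_nat (S k)) * / z ^ (S k) * pt_term (Z.of_nat (S k)) m)).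
      * apply csum_ext. intros m. unfold pt_term.
        replace (Z.of_nat (S m)) with (Z.of_nat m + 1)%Z by lia. rewrite Cpowz_S by apply m1_neq0.
        unfold Cdiv. rewrite Cpow_mult_l, Cpow_inv by auto.
        rewrite <- (Cpowz_nat q (k * m + m + 1)), <- (Cpowz_nat q k).
        replace (q ^^ (Z.of_nat (S k)) * / z ^ S k * ((-1) ^^ Z.of_nat m * q ^^ (tri (Z.of_nat m) + Z.of_nat m + Z.of_nat (S k) * Z.of_nat m)))
          with ((-1) ^^ Z.of_nat m * / z ^ S k * (q ^^ (Z.of_nat (S k)) * q ^^ (tri (Z.of_nat m) + Z.of_nat m + Z.of_nat (S k) * Z.of_nat m))) by ring.
        rewrite <- Cpowz_add by auto.
        rewrite (Cpowz_split q (Z.of_nat (S k) + (tri (Z.of_nat m) + Z.of_nat m + Z.of_nat (S k) * Z.of_nat m))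
          (Z.of_nat (k * m + m + 1)) (tri (Z.of_nat m + 1) + Z.of_nat k)) by (auto; pose proof (tri_spec (Z.of_nat m)); pose proof (tri_spec (Z.of_nat m + 1)); lia).
        rewrite (Cpowz_add q (tri (Z.of_nat m + 1))) by auto.
        simpl (z ^ S k). field. split; auto. apply Cpow_nz; auto.
      * rewrite csum_scal by apply summable_pt. change (csum (pt_term (Z.of_nat (S k)))) with (pt (Z.of_nat (S k))).
        unfold ptr. destruct (Z.leb_spec 0 (- Z.of_nat (S k))); [lia|].
        rewrite pt_sym, Cpowz_opp_nat by auto. ring.
Qed.

End PartialTheta.

(** * Values at the square roots of -1 *)

Section CentralValues.

Variable q : C.
Hypothesis Hq : q <> 0.
Hypothesis Hq1 : (Cmod q < 1)%R.

(** In terms of Ramanujan's theta function phi this is phi(-q) phi(-q^2). *)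
Definition phi_const : C := pinf q q ^ 2 * pinf (q ^ 2) (q ^ 2) / pinf (q ^ 4) (q ^ 4).

Lemma qpow_facts k : (0 < k)%nat -> q ^ k <> 0 /\ (Cmod (q ^ k) < 1)%R.
Proof.
  intros Hk. split; [apply Cpow_nz; auto|]. rewrite Cmod_pow. apply pow_lt_1_compat; auto.
  split; auto using Cmod_ge_0.
Qed.

Lemma Ci_sq : Ci * Ci = -1.
Proof. unfold Ci. apply injective_projections; simpl; ring. Qed.

Lemma unit_regular (z : C) : Cmod z = 1%R -> z <> 1 -> regular q z.
Proof.
  intros Hz H1. split.
  - intros H. rewrite H, Cmod_0 in Hz. lra.
  - intros n H. assert (n = 0%Z).
    { apply (Cpowz_mod1 q Hq Hq1). apply (f_equal Cmod) in H. rewrite Cmod_mult, Hz, Cmod_1 in H. lra. }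
    subst. apply H1. rewrite <- H. simpl. ring.
Qed.

Lemma sqrt_m1_facts (z : C) : z * z = -1 -> z <> 0 /\ Cmod z = 1%R /\ z <> 1.
Proof.
  intros Hz. split; [|split].
  - intros H. rewrite H in Hz. apply m1_neq0. rewrite <- Hz. ring.
  - assert (H : (Cmod z * Cmod z = 1)%R) by (rewrite <- Cmod_mult, Hz; apply Cmod_m1).
    pose proof (Cmod_ge_0 z). nra.
  - intros H. rewrite H in Hz. apply (f_equal Re) in Hz. simpl in Hz. lra.
Qed.

Lemma pinf_cons (x : C) : pinf x q = (1 - x) * pinf (q * x) q.
Proof.
  apply cv_unique with (fun n => qpoch x q (S n)).
  - apply (cv_sub (qpoch x q) _ S); auto. apply qpoch_cv; auto.
  - apply cv_ext with (fun n => (1 - x) * qpoch (q * x) q n).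
    + intros n. rewrite qpoch_cons; auto.
    + apply cv_scal, qpoch_cv; auto.
Qed.

(** From z^2 = -1 follow q/z = -q z and (q z)_n (-q z)_n = (-q^2; q^2)_n, so in the triple product
    only the factor 1 - z depends on the choice of the root. *)
Lemma inv_jtheta_sqrt_m1 (z : C) : z * z = -1 ->
  csum (lterm q z) = phi_const / (1 - z).
Proof.
  intros Hz. destruct (sqrt_m1_facts z Hz) as [Hz0 [Hz1 Hne]].
  pose proof (unit_regular z Hz1 Hne) as Hr.
  destruct (qpow_facts 2 ltac:(lia)) as [H2 H21]. destruct (qpow_facts 4 ltac:(lia)) as [H4 H41].
  pose proof (pinf_q_neq0 q Hq Hq1) as P1. pose proof (pinf_q_neq0 _ H2 H21) as P2.
  pose proof (pinf_q_neq0 _ H4 H41) as P4.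
  assert (Hinv : q / z = - (q * z)).
  { replace (q / z) with (- (q * (z * z)) / z) by (rewrite Hz; field; auto). field; auto. }
  assert (Hfin : forall n, qpoch (q * z) q n * qpoch (- (q * z)) q n * qpoch (q ^ 2) (q ^ 2) n = qpoch (q ^ 4) (q ^ 4) n).
  { induction n; [unfold qpoch; simpl; ring|].
    rewrite !qpoch_S, <- IHn.
    replace (1 - (q ^ 4) ^ n * q ^ 4) with ((1 - q ^ n * (q * z)) * (1 - q ^ n * - (q * z)) * (1 - (q ^ 2) ^ n * q ^ 2)); [ring|].
    rewrite <- !Cpow_mult_r. replace (4 * n)%nat with (n + n + (n + n))%nat by lia.
    replace (2 * n)%nat with (n + n)%nat by lia. rewrite !Cpow_add_r.
    transitivity ((1 - q ^ n * q ^ n * (q * q) * (z * z)) * (1 - q ^ n * q ^ n * q ^ 2)); [ring|].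
    rewrite Hz. ring. }
  assert (E : pinf (q * z) q * pinf (- (q * z)) q * pinf (q ^ 2) (q ^ 2) = pinf (q ^ 4) (q ^ 4)).
  { apply cv_unique with (qpoch (q ^ 4) (q ^ 4)); [|apply qpoch_cv; auto].
    eapply cv_ext; [exact Hfin|]. repeat apply cv_mult; apply qpoch_cv; auto. }
  pose proof (inv_jtheta q Hq Hq1 z Hr) as EV.
  rewrite triple_product, Hinv, (pinf_cons z) in EV by auto.
  assert (Hz1' : 1 - z <> 0).
  { intros H. apply Hne. replace z with (1 - (1 - z)) by ring. rewrite H; ring. }
  unfold phi_const. rewrite <- E in P4 |- *.
  assert (pinf (q * z) q <> 0) by (intros H; apply P4; rewrite H; ring).
  assert (pinf (- (q * z)) q <> 0) by (intros H'; apply P4; rewrite H'; ring).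
  set (V := csum (lterm q z)) in *.
  set (a := pinf (q * z) q) in *. set (b := pinf (- (q * z)) q) in *. set (c := pinf q q) in *.
  transitivity (V * (c * ((1 - z) * a) * b) / (c * ((1 - z) * a) * b)); [field; repeat split; auto|].
  rewrite EV. field. repeat split; auto.
Qed.

Lemma ptr_sum_sqrt_m1 (z : C) : z * z = -1 ->
  summable (fun k => ptr q k * z ^^ k) /\
  csum (fun k => ptr q k * z ^^ k) = (phi_const - 1) / (1 - z).
Proof.
  intros Hz. destruct (sqrt_m1_facts z Hz) as [Hz0 [Hz1 Hne]].
  pose proof (unit_regular z Hz1 Hne) as Hr. pose proof (proj1 (Cmod_gt_0 q) Hq).
  assert (Ha : (Cmod q < Cmod z < / Cmod q)%R).
  { rewrite Hz1. split; auto. rewrite <- Rinv_1. apply Rinv_lt_contravar; lra. }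
  split; [apply summable_ptr; auto|].
  pose proof (inv_jtheta_sqrt_m1 z Hz) as E. rewrite lterm_expansion in E by auto.
  assert (Hz1' : 1 - z <> 0).
  { intros H'. apply Hne. replace z with (1 - (1 - z)) by ring. rewrite H'; ring. }
  replace (csum (fun k => ptr q k * z ^^ k)) with (/ (1 - z) + csum (fun k => ptr q k * z ^^ k) - / (1 - z)) by ring.
  rewrite E. field. auto.
Qed.

Lemma Cpowz_even (z : C) k : z * z = -1 -> z ^^ (2 * k) = (-1) ^^ k.
Proof.
  intros Hz. destruct (sqrt_m1_facts z Hz) as [Hz0 _].
  rewrite Cpowz_mul by auto. f_equal. simpl. rewrite <- Hz. ring.
Qed.

(** Even and odd parts of the generating function at z = i, from its values at i and -i. In the odd
    part an additional factor [Ci] turns i^(2 k - 1) into (-1)^k. *)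
Lemma alternating_ptr :
  csum (fun k => (-1) ^^ k * ptr q (2 * k)) = (phi_const - 1) / 2 /\
  csum (fun k => (-1) ^^ k * ptr q (2 * k - 1)) = - ((phi_const - 1) / 2).
Proof.
  assert (Hm : - Ci * - Ci = -1) by (transitivity (Ci * Ci); [ring | apply Ci_sq]).
  destruct (ptr_sum_sqrt_m1 Ci Ci_sq) as [S1 E1].
  destruct (ptr_sum_sqrt_m1 (- Ci) Hm) as [S2 E2].
  destruct (sqrt_m1_facts Ci Ci_sq) as [Hi0 [_ Hi1]].
  destruct (sqrt_m1_facts (- Ci) Hm) as [Hi0' [_ Hi1']].
  assert (N1 : 1 - Ci <> 0) by (intros H; apply Hi1; replace Ci with (1 - (1 - Ci)) by ring; rewrite H; ring).
  assert (N2 : 1 + Ci <> 0) by (intros H; apply Hi1'; replace (- Ci) with (1 - (1 + Ci)) by ring; rewrite H; ring).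
  assert (Hodd : forall k, (k mod 2 = 1)%Z -> (- Ci) ^^ k = - Ci ^^ k).
  { intros k Hk. replace k with (2 * (k / 2) + 1)%Z by lia.
    rewrite !Cpowz_S, !Cpowz_even by auto using Ci_sq. ring. }
  assert (Heven : forall k, (k mod 2 = 0)%Z -> (- Ci) ^^ k = Ci ^^ k).
  { intros k Hk. replace k with (2 * (k / 2))%Z by lia.
    rewrite !Cpowz_even by auto using Ci_sq. ring. }
  assert (P2 : (1 - Ci) * (1 + Ci) = 2) by (transitivity (1 - Ci * Ci); [ring | rewrite Ci_sq; ring]).
  split.
  - transitivity (/ 2 * (csum (fun k => ptr q k * Ci ^^ k) + csum (fun k => ptr q k * (- Ci) ^^ k))).
    + rewrite <- csum_plus, <- csum_scal by (auto; apply summable_plus; auto).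
      rewrite <- (csum_inj (fun k => / 2 * (ptr q k * Ci ^^ k + ptr q k * (- Ci) ^^ k)) (fun k => 2 * k)%Z).
      * apply csum_ext. intros k. rewrite !Cpowz_even by auto using Ci_sq. field; apply C2_neq0.
      * intros; lia.
      * intros k Hk. exists (k / 2)%Z. destruct (Z.eq_dec (k mod 2) 0); [lia|]. exfalso. apply Hk.
        rewrite Hodd by lia. ring.
      * apply summable_scal, summable_plus; auto.
    + rewrite E1, E2. replace (1 - - Ci) with (1 + Ci) by ring.
      transitivity (/ 2 * ((phi_const - 1) * 2 / ((1 - Ci) * (1 + Ci)))); [field; repeat split; auto using C2_neq0|].
      rewrite P2. field; apply C2_neq0.
  - transitivity (Ci * / 2 * (csum (fun k => ptr q k * Ci ^^ k) - csum (fun k => ptr q k * (- Ci) ^^ k))).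
    + rewrite <- csum_minus, <- csum_scal by (auto; apply summable_minus; auto).
      rewrite <- (csum_inj (fun k => Ci * / 2 * (ptr q k * Ci ^^ k - ptr q k * (- Ci) ^^ k)) (fun k => 2 * k - 1)%Z).
      * apply csum_ext. intros k. rewrite Hodd by lia.
        rewrite <- (Cpowz_even Ci k Ci_sq). replace (2 * k)%Z with (2 * k - 1 + 1)%Z at 1 by lia.
        rewrite Cpowz_S by auto. field; apply C2_neq0.
      * intros; lia.
      * intros k Hk. exists ((k + 1) / 2)%Z. destruct (Z.eq_dec (k mod 2) 1); [lia|]. exfalso. apply Hk.
        rewrite Heven by lia. ring.
      * apply summable_scal, summable_minus; auto.
    + rewrite E1, E2. replace (1 - - Ci) with (1 + Ci) by ring.
      transitivity (/ 2 * ((phi_const - 1) * 2 * (Ci * Ci) / ((1 - Ci) * (1 + Ci)))); [field; repeat split; auto using C2_neq0|].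
      rewrite P2, Ci_sq. field; apply C2_neq0.
Qed.

Lemma summable_alternating_ptr j : summable (fun k => (-1) ^^ k * ptr q (2 * k - j)).
Proof.
  destruct (ptr_bound q Hq Hq1) as [M [H0 HM]].
  apply (summable_q q Hq Hq1 Z.abs (fun k => Z.abs (2 * k - j)) M (Z.abs j)); [apply weight_Z; auto| |intros; lia].
  intros k. rewrite Cmod_mult, Cmod_sgn, Rmult_1_l. auto.
Qed.

(** As [pt q k] tends to 1 for k -> +oo, its alternating sum diverges; the differences are
    summable. *)
Definition pt_diff (j k : Z) : C := (-1) ^^ k * (pt q (2 * k - j) - pt q (2 * k - j - 2)).

(** The two indicators differ exactly when 0 <= 2 k - j < 2, that is, at the single index k = ceil
    (j/2). *)
Lemma pt_diff_ptr j k : pt_diff j k = (-1) ^^ k * ptr q (2 * k - j)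
   + (-1) ^^ (k + -1) * ptr q (2 * (k + -1) - j)
   + (if (k =? (j + 1) / 2)%Z then (-1) ^^ k else 0).
Proof.
  unfold pt_diff, ptr. rewrite (sgn_neg 0 k (k + -1)) by lia.
  replace (2 * (k + -1) - j)%Z with (2 * k - j - 2)%Z by lia.
  destruct (Z.eqb_spec k ((j + 1) / 2)), (Z.leb_spec 0 (2 * k - j)), (Z.leb_spec 0 (2 * k - j - 2));
    try lia; ring.
Qed.

Lemma summable_pt_diff j : summable (pt_diff j).
Proof.
  pose proof (summable_alternating_ptr j) as Hs.
  apply summable_ext with (1 := fun k => eq_sym (pt_diff_ptr j k)).
  apply summable_plus; [apply summable_plus; auto|].
  - apply (summable_shift (-1) (fun k => (-1) ^^ k * ptr q (2 * k - j)) Hs).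
  - apply summable_single with ((j + 1) / 2)%Z. intros k Hk.
    destruct (Z.eqb_spec k ((j + 1) / 2)); auto; contradiction.
Qed.

Lemma csum_pt_diff_aux j : csum (pt_diff j)
  = 2 * csum (fun k => (-1) ^^ k * ptr q (2 * k - j)) + (-1) ^^ ((j + 1) / 2).
Proof.
  pose proof (summable_alternating_ptr j) as Hs.
  pose proof (summable_shift (-1) (fun k => (-1) ^^ k * ptr q (2 * k - j)) Hs) as Hs'.
  assert (H1 : forall k : Z, k <> ((j + 1) / 2)%Z -> (if (k =? (j + 1) / 2)%Z then (-1) ^^ k else 0) = 0).
  { intros k Hk. destruct (Z.eqb_spec k ((j + 1) / 2)); auto; contradiction. }
  rewrite (csum_ext _ _ (pt_diff_ptr j)).
  rewrite csum_plus, csum_plus; auto.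
  - rewrite (csum_shift (-1) (fun k => (-1) ^^ k * ptr q (2 * k - j)) Hs).
    rewrite (csum_single (fun k => if (k =? (j + 1) / 2)%Z then (-1) ^^ k else 0) ((j + 1) / 2)%Z) by auto. rewrite Z.eqb_refl. ring.
  - apply summable_plus; auto.
  - apply summable_single with ((j + 1) / 2)%Z; auto.
Qed.

(** Shifting k by one changes j by 2 at the cost of a sign, which leaves j = 0 and j = 1, the even
    and the odd part. In both cases the correction from the indicator turns [phi_const - 1] into
    [phi_const]. *)
Lemma csum_pt_diff j : csum (pt_diff j) = - (-1) ^^ ((j - 1) / 2) * phi_const.
Proof.
  destruct alternating_ptr as [E0 E1].
  assert (H0 : csum (pt_diff 0) = phi_const).
  { rewrite csum_pt_diff_aux. rewrite (csum_ext _ (fun k => (-1) ^^ k * ptr q (2 * k))).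
    - rewrite E0. change ((0 + 1) / 2)%Z with 0%Z. simpl. field; apply C2_neq0.
    - intros k. rewrite Z.sub_0_r. reflexivity. }
  assert (H1 : csum (pt_diff 1) = - phi_const).
  { rewrite csum_pt_diff_aux, E1. change ((1 + 1) / 2)%Z with 1%Z. simpl. field; apply C2_neq0. }
  assert (Hsh : forall t i, csum (pt_diff (2 * t + i)) = (-1) ^^ t * csum (pt_diff i)).
  { intros t i. rewrite <- csum_scal by apply summable_pt_diff.
    rewrite <- (csum_shift t (pt_diff (2 * t + i))) by apply summable_pt_diff.
    apply csum_ext. intros k. unfold pt_diff. rewrite (Cpowz_add (-1) k t) by apply m1_neq0.
    replace (2 * (k + t) - (2 * t + i))%Z with (2 * k - i)%Z by lia. ring. }
  destruct (Z.eq_dec (j mod 2) 0).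
  - replace j with (2 * (j / 2) + 0)%Z at 1 by lia. rewrite Hsh, H0.
    rewrite (sgn_neg 0 (j / 2) ((j - 1) / 2)) by lia. ring.
  - replace j with (2 * (j / 2) + 1)%Z at 1 by lia. rewrite Hsh, H1.
    replace ((j - 1) / 2)%Z with (j / 2)%Z by lia. ring.
Qed.

End CentralValues.

(** * The Hecke-type sum *)

(** Half of the proof is the square of m - (3 u + 8 b + 1): the Gaussian exponent of [lw] absorbs
    its own linear part, bounded by 3 m u, and the growth rate [b] of a test function along
    exponents of size up to 8 m + D. *)
Lemma quad_lower (m u b t D : Z) : (0 <= m -> 0 <= u -> 0 <= b -> - (3 * m * u) <= t ->
  m - ((3 * u + 8 * b + 1) * (3 * u + 8 * b + 1) + b * D) <= 24 * (m * m) + t - b * (8 * m + D))%Z.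
Proof.
  intros Hm Hu Hb Ht.
  assert (0 <= (m - (3 * u + 8 * b + 1)) * (m - (3 * u + 8 * b + 1)))%Z by apply Z.square_nonneg.
  assert (0 <= m * u)%Z by nia. assert (0 <= m * b)%Z by nia. nia.
Qed.

Section Functional.

Variable q : C.
Hypothesis Hq : q <> 0.
Hypothesis Hq1 : (Cmod q < 1)%R.

(** At most exponential growth, measured in powers of [q]. These are test functions for [lf], which
    converges on them because [lw] decays like a Gaussian. *)
Definition good (f : Z -> C) : Prop :=
  exists M b, (0 <= M)%R /\ (0 <= b)%Z /\ forall e, (Cmod (f e) <= M * Cmod (q ^^ (- b * Z.abs e)))%R.

Lemma good_const c : good (fun _ => c).
Proof.
  exists (Cmod c), 0%Z. split; [apply Cmod_ge_0|]. split; [lia|]. intros e. simpl. rewrite Cmod_1. lra.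
Qed.

Lemma good_pow a : good (fun e => q ^^ (a * e)).
Proof.
  exists 1%R, (Z.abs a). split; [lra|]. split; [lia|]. intros e. rewrite Rmult_1_l.
  apply Cpowz_le; auto. nia.
Qed.

Lemma good_pt n : good (fun e => pt q (n - e)).
Proof.
  destruct (pt_bound q Hq Hq1) as [M [H0 [HM _]]].
  exists M, 0%Z. split; [lra|]. split; [lia|]. intros e. simpl. rewrite Cmod_1. specialize (HM (n - e)%Z). lra.
Qed.

Lemma good_plus f g : good f -> good g -> good (fun e => f e + g e).
Proof.
  intros [M [b [HM [Hb Hf]]]] [N [c [HN [Hc Hg]]]].
  exists (M + N)%R, (b + c)%Z. split; [lra|]. split; [lia|]. intros e.
  eapply Rle_trans; [apply Cmod_triangle|]. specialize (Hf e). specialize (Hg e).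
  assert (Cmod (q ^^ (- b * Z.abs e)) <= Cmod (q ^^ (- (b + c) * Z.abs e)))%R by (apply Cpowz_le; auto; nia).
  assert (Cmod (q ^^ (- c * Z.abs e)) <= Cmod (q ^^ (- (b + c) * Z.abs e)))%R by (apply Cpowz_le; auto; nia).
  nra.
Qed.

Lemma good_mult f g : good f -> good g -> good (fun e => f e * g e).
Proof.
  intros [M [b [HM [Hb Hf]]]] [N [c [HN [Hc Hg]]]].
  exists (M * N)%R, (b + c)%Z. split; [nra|]. split; [lia|]. intros e. rewrite Cmod_mult.
  replace (- (b + c) * Z.abs e)%Z with (- b * Z.abs e + - c * Z.abs e)%Z by ring.
  rewrite Cpowz_add, Cmod_mult by auto.
  replace (M * N * (Cmod (q ^^ (- b * Z.abs e)) * Cmod (q ^^ (- c * Z.abs e))))%R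
    with (M * Cmod (q ^^ (- b * Z.abs e)) * (N * Cmod (q ^^ (- c * Z.abs e))))%R by ring.
  apply Rmult_le_compat; auto using Cmod_ge_0.
Qed.

Lemma good_scal c f : good f -> good (fun e => c * f e).
Proof. intros Hf. apply (good_mult (fun _ => c)); auto using good_const. Qed.

Lemma good_comp f (g : Z -> Z) D : good f -> (forall e, (Z.abs (g e) <= Z.abs e + D)%Z) ->
  good (fun e => f (g e)).
Proof.
  intros [M [b [HM [Hb Hf]]]] Hg.
  exists (M * Cmod (q ^^ (- b * D)))%R, b. split; [apply Rmult_le_pos; auto using Cmod_ge_0|].
  split; auto. intros e. eapply Rle_trans; [apply Hf|].
  rewrite Rmult_assoc, <- Cmod_mult, <- Cpowz_add by auto.
  apply Rmult_le_compat_l; auto. apply Cpowz_le; auto. specialize (Hg e). nia.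
Qed.

Definition lw (r i : Z) : C := q ^^ (24 * i * i + 3 * i * (2 * r + 1)).

(* [lf r f] is the sum of [p_e * f e], where the [p_e] are the Laurent coefficients of the
   numerator of the character of spin [2 r], up to a power of [q] and a power of [z]. *)
Definition lf (r : Z) (f : Z -> C) : C :=
  csum (fun i => lw r i * (f (- 8 * i - r)%Z - f (8 * i + r + 1)%Z)).

Lemma summable_lf_part r f (g : Z -> Z) D : good f -> (forall i, (Z.abs (g i) <= 8 * Z.abs i + D)%Z) ->
  summable (fun i => lw r i * f (g i)).
Proof.
  intros [M [b [HM [Hb Hf]]]] Hg.
  pose (c := (3 * Z.abs (2 * r + 1) + 8 * b + 1)%Z).
  apply (summable_q q Hq Hq1 Z.abs
     (fun i => 24 * i * i + 3 * i * (2 * r + 1) - b * (8 * Z.abs i + D))%Z M (c * c + b * D)); [apply weight_Z; auto| |].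
  - intros i. unfold lw. rewrite Cmod_mult.
    replace (24 * i * i + 3 * i * (2 * r + 1) - b * (8 * Z.abs i + D))%Z
      with (24 * i * i + 3 * i * (2 * r + 1) + - b * (8 * Z.abs i + D))%Z by ring.
    rewrite (Cpowz_add q (24 * i * i + 3 * i * (2 * r + 1))), Cmod_mult by auto.
    replace (M * (Cmod (q ^^ (24 * i * i + 3 * i * (2 * r + 1))) * Cmod (q ^^ (- b * (8 * Z.abs i + D)))))%R
      with (Cmod (q ^^ (24 * i * i + 3 * i * (2 * r + 1))) * (M * Cmod (q ^^ (- b * (8 * Z.abs i + D)))))%R by ring.
    apply Rmult_le_compat_l; [apply Cmod_ge_0|]. eapply Rle_trans; [apply Hf|].
    apply Rmult_le_compat_l; auto. apply Cpowz_le; auto. specialize (Hg i). nia.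
  - intros i. assert (- (3 * Z.abs i * Z.abs (2 * r + 1)) <= 3 * i * (2 * r + 1))%Z by nia.
    assert (E : (24 * i * i = 24 * (Z.abs i * Z.abs i))%Z) by (rewrite Z.abs_square; ring).
    rewrite E. unfold c. apply quad_lower; lia.
Qed.

Lemma summable_lf1 r f : good f -> summable (fun i => lw r i * f (- 8 * i - r)%Z).
Proof. intros Hf. apply (summable_lf_part r f (fun i => - 8 * i - r)%Z (Z.abs r)); auto. intros; lia. Qed.

Lemma summable_lf2 r f : good f -> summable (fun i => lw r i * f (8 * i + r + 1)%Z).
Proof. intros Hf. apply (summable_lf_part r f (fun i => 8 * i + r + 1)%Z (Z.abs r + 1)); auto. intros; lia. Qed.

Lemma lf_split r f : good f ->
  lf r f = csum (fun i => lw r i * f (- 8 * i - r)%Z) - csum (fun i => lw r i * f (8 * i + r + 1)%Z).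
Proof.
  intros Hf. unfold lf. pose proof (summable_lf1 r f Hf). pose proof (summable_lf2 r f Hf).
  rewrite <- csum_minus by auto.
  apply csum_ext. intros i. ring.
Qed.

Lemma lf_ext r f g : (forall e, f e = g e) -> lf r f = lf r g.
Proof. intros H. unfold lf. apply csum_ext. intros i. rewrite !H. reflexivity. Qed.

Lemma lf_plus r f g : good f -> good g -> lf r (fun e => f e + g e) = lf r f + lf r g.
Proof.
  intros Hf Hg. rewrite !lf_split by auto using good_plus.
  rewrite (csum_ext _ (fun i => lw r i * f (- 8 * i - r)%Z + lw r i * g (- 8 * i - r)%Z)) by (intros; ring).
  rewrite (csum_ext (fun i => lw r i * (f (8 * i + r + 1)%Z + _))
     (fun i => lw r i * f (8 * i + r + 1)%Z + lw r i * g (8 * i + r + 1)%Z)) by (intros; ring).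
  pose proof (summable_lf1 r f Hf). pose proof (summable_lf1 r g Hg).
  pose proof (summable_lf2 r f Hf). pose proof (summable_lf2 r g Hg).
  rewrite !csum_plus by auto. ring.
Qed.

Lemma lf_scal r c f : good f -> lf r (fun e => c * f e) = c * lf r f.
Proof.
  intros Hf. rewrite !lf_split by auto using good_scal.
  pose proof (summable_lf1 r f Hf). pose proof (summable_lf2 r f Hf).
  rewrite (csum_ext (fun i => lw r i * (c * f (- 8 * i - r)%Z))
    (fun i => c * (lw r i * f (- 8 * i - r)%Z))) by (intros; ring).
  rewrite (csum_ext (fun i => lw r i * (c * f (8 * i + r + 1)%Z))
    (fun i => c * (lw r i * f (8 * i + r + 1)%Z))) by (intros; ring).
  rewrite !csum_scal by auto. ring.
Qed.

(** Weyl antisymmetry of the numerator: e -> 1 - e exchanges the exponents -8 i - r and 8 i + r + 1,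
    which carry opposite signs. *)
Lemma lf_anti r f : good f -> lf r (fun e => f (1 - e)%Z) = - lf r f.
Proof.
  intros Hf. rewrite (lf_split r f) by auto. unfold lf.
  rewrite (csum_ext _ (fun i => lw r i * f (8 * i + r + 1)%Z - lw r i * f (- 8 * i - r)%Z)).
  - pose proof (summable_lf1 r f Hf). pose proof (summable_lf2 r f Hf).
    rewrite csum_minus by auto. ring.
  - intros i. replace (1 - (- 8 * i - r))%Z with (8 * i + r + 1)%Z by ring.
    replace (1 - (8 * i + r + 1))%Z with (- 8 * i - r)%Z by ring. ring.
Qed.

(** The symmetry ell -> p' - 2 - ell of the spins. Substituting i -> -1 - i in one theta series and
    i -> -i in the other turns each into the other one for [r], with exponents shifted by 4; hence
    the minus sign. *)
Lemma lf_flip r f : good f ->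
  lf (3 - r) f = - q ^^ (3 * r) * lf r (fun e => q ^^ (3 * e) * f (e + 4)%Z).
Proof.
  intros Hf.
  assert (Hg : good (fun e => q ^^ (3 * e) * f (e + 4)%Z)).
  { apply good_mult; [apply good_pow|]. apply (good_comp f (fun e => e + 4)%Z 4); auto. intros; lia. }
  rewrite !lf_split by auto.
  rewrite <- (csum_reflect (- (1)) (fun i => lw (3 - r) i * f (- 8 * i - (3 - r))%Z)) by auto using summable_lf1.
  rewrite <- (csum_reflect 0 (fun i => lw (3 - r) i * f (8 * i + (3 - r) + 1)%Z)) by auto using summable_lf2.
  rewrite (csum_ext (fun n => lw (3 - r) (- (1) - n) * _)
     (fun i => q ^^ (3 * r) * (lw r i * (q ^^ (3 * (8 * i + r + 1)) * f (8 * i + r + 1 + 4)%Z)))).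
  - rewrite (csum_ext (fun n => lw (3 - r) (0 - n) * _)
     (fun i => q ^^ (3 * r) * (lw r i * (q ^^ (3 * (- 8 * i - r)) * f (- 8 * i - r + 4)%Z)))).
    + rewrite !csum_scal; [cbv beta; ring | |].
      * apply (summable_lf1 r (fun e => q ^^ (3 * e) * f (e + 4)%Z)); auto.
      * apply (summable_lf2 r (fun e => q ^^ (3 * e) * f (e + 4)%Z)); auto.
    + intros i. unfold lw. rewrite !Cmult_assoc, <- !Cpowz_add by auto.
      f_equal; [f_equal; ring | f_equal; ring].
  - intros i. unfold lw. rewrite !Cmult_assoc, <- !Cpowz_add by auto.
    f_equal; [f_equal; ring | f_equal; ring].
Qed.

Definition lp (r a : Z) : C := lf r (fun e => q ^^ (a * e)).

Lemma lf_const r c : lf r (fun _ => c) = 0.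
Proof.
  pose proof (lf_anti r (fun _ => c) (good_const c)) as H.
  replace (lf r (fun _ => c)) with (/ 2 * (lf r (fun _ => c) + lf r (fun _ => c))) by (field; apply C2_neq0).
  rewrite H at 1. ring.
Qed.

Lemma lp_anti r a : lp r (- a) = - q ^^ (- a) * lp r a.
Proof.
  unfold lp. pose proof (good_pow a) as G.
  assert (G' : good (fun e => q ^^ (a * (1 - e)))).
  { apply (good_comp (fun e => q ^^ (a * e)) (fun e => 1 - e)%Z 1 G). intros; lia. }
  transitivity (q ^^ (- a) * lf r (fun e => q ^^ (a * (1 - e)))).
  - rewrite <- lf_scal by exact G'. apply lf_ext. intros e. rewrite <- Cpowz_add by auto. f_equal. ring.
  - rewrite (lf_anti r (fun e => q ^^ (a * e))) by exact G. ring.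
Qed.

Lemma lp_flip r a : lp (3 - r) a = - q ^^ (3 * r + 4 * a) * lp r (a + 3).
Proof.
  unfold lp. rewrite lf_flip by apply good_pow. rewrite (Cpowz_add q (3 * r)) by auto.
  transitivity (- q ^^ (3 * r) * (q ^^ (4 * a) * lf r (fun e => q ^^ ((a + 3) * e)))); [|ring].
  rewrite <- (lf_scal r (q ^^ (4 * a)) (fun e => q ^^ ((a + 3) * e))) by apply good_pow.
  f_equal. apply lf_ext. intros e.
  rewrite <- !Cpowz_add by auto. f_equal. ring.
Qed.

(** By [lp_flip] this is, up to sign and a power of [q], the numerator of the flipped spin at z = 1,
    where antisymmetry makes it vanish. *)
Lemma lp_3 r : lp r 3 = 0.
Proof.
  pose proof (lp_flip r 0) as H. unfold lp at 1 in H.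
  rewrite (lf_ext _ _ (fun _ => 1)) in H by (intros; rewrite Z.mul_0_l; reflexivity).
  rewrite lf_const in H. simpl (0 + 3)%Z in H.
  replace (lp r 3) with (- / q ^^ (3 * r + 4 * 0) * (- q ^^ (3 * r + 4 * 0) * lp r 3))
    by (field; apply Cpowz_neq0; auto).
  rewrite <- H. ring.
Qed.

Lemma lp_flip_1 r : lp (3 - r) 1 = q ^^ (3 * r - 3) * lp r 2.
Proof.
  pose proof (lp_flip r (- (1))) as H. rewrite lp_anti in H. simpl (- (1) + 3)%Z in H.
  transitivity (- q ^^ 1 * (- q ^^ (- (1)) * lp (3 - r) 1)).
  - rewrite Cpowz_opp by auto. field. apply Cpowz_neq0; auto.
  - rewrite H, (Cpowz_split q (3 * r - 3) 1 (3 * r + 4 * - (1))) by (auto; ring). ring.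
Qed.

Lemma lp_flip_2 r : lp (3 - r) 2 = q ^^ (3 * r - 6) * lp r 1.
Proof.
  pose proof (lp_flip r (- (2))) as H. rewrite lp_anti in H. simpl (- (2) + 3)%Z in H.
  transitivity (- q ^^ 2 * (- q ^^ (- (2)) * lp (3 - r) 2)).
  - rewrite Cpowz_opp by auto. field. apply Cpowz_neq0; auto.
  - rewrite H, (Cpowz_split q (3 * r - 6) 2 (3 * r + 4 * - (2))) by (auto; ring). ring.
Qed.

(* [(q)^3] times the coefficient of [z^n] in the character of spin [2 r]. *)
Definition hecke (r n : Z) : C := lf r (fun e => pt q (n - e)).

(** After [lf_flip] the partial theta function has index k - 3 with k = n - 1 - e. Three uses of
    [pt_rec] raise it to k, and the accumulated power q^(3 n - 6 - 3 e) cancels the weight q^(3 e).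
    The remainders are values of the numerator at q^3, q^2 and q, of which the first is 0. *)
Lemma hecke_flip r n : hecke (3 - r) n
  = q ^^ (3 * r + 3 * n - 6) * hecke r (n - 1) + q ^^ n * lp (3 - r) 1 - q ^^ (2 * n + 1) * lp (3 - r) 2.
Proof.
  unfold hecke. rewrite lf_flip by apply good_pt.
  rewrite (lf_ext _ _ (fun e => q ^^ (3 * e) + ((- q ^^ (n - 3) * q ^^ (2 * e)) + (q ^^ (2 * n - 5) * q ^^ (1 * e)
      + - q ^^ (3 * n - 6) * pt q (n - 1 - e))))).
  - pose proof (good_pow 1). pose proof (good_pow 2). pose proof (good_pow 3). pose proof (good_pt (n - 1)).
    rewrite !lf_plus, !lf_scal by (repeat (apply good_plus || apply good_scal); auto).
    change (lf r (fun e => q ^^ (3 * e))) with (lp r 3). change (lf r (fun e => q ^^ (2 * e))) with (lp r 2).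
    change (lf r (fun e => q ^^ (1 * e))) with (lp r 1).
    rewrite lp_3, lp_flip_1, lp_flip_2.
    rewrite (Cpowz_split q (3 * r + 3 * n - 6) (3 * r) (3 * n - 6)) by (auto; ring).
    transitivity (q ^^ (3 * r) * q ^^ (n - 3) * lp r 2 - q ^^ (3 * r) * q ^^ (2 * n - 5) * lp r 1
       + q ^^ (3 * r) * q ^^ (3 * n - 6) * lf r (fun e => pt q (n - 1 - e))); [ring|].
    rewrite !Cmult_assoc, <- !Cpowz_add by auto.
    replace (n + (3 * r - 3))%Z with (3 * r + (n - 3))%Z by ring.
    replace (2 * n + 1 + (3 * r - 6))%Z with (3 * r + (2 * n - 5))%Z by ring. ring.
  - intros e. set (k := (n - 1 - e)%Z).
    replace (n - (e + 4))%Z with (k - 3)%Z by (unfold k; ring).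
    rewrite (pt_rec q Hq Hq1 (k - 3)), (pt_rec q Hq Hq1 (k - 3 + 1)), (pt_rec q Hq Hq1 (k - 3 + 1 + 1)).
    replace (k - 3 + 1 + 1 + 1)%Z with k by ring.
    rewrite (Cpowz_split q (2 * e) (3 * e) (- e)) by (auto; ring).
    rewrite (Cpowz_split q (1 * e) (3 * e) (- 2 * e)) by (auto; ring).
    replace (q ^^ (k - 3 + 1)) with (q ^^ (n - 3) * q ^^ (- e)) by (rewrite <- Cpowz_add by auto; f_equal; unfold k; ring).
    rewrite (Cpowz_split q (k - 3 + 1 + 1) (n - 2) (- e)) by (auto; unfold k; ring).
    rewrite (Cpowz_split q k (n - 1) (- e)) by (auto; unfold k; ring).
    rewrite (Cpowz_split q (- 2 * e) (- e) (- e)) by (auto; ring).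
    rewrite (Cpowz_split q (2 * n - 5) (n - 3) (n - 2)) by (auto; ring).
    rewrite (Cpowz_split q (3 * n - 6) (n - 3) (n - 2 + (n - 1))), (Cpowz_add q (n - 2) (n - 1)) by (auto; ring).
    assert (E3 : q ^^ (3 * e) * (q ^^ (- e) * q ^^ (- e) * q ^^ (- e)) = 1).
    { rewrite <- !Cpowz_add by auto. replace (3 * e + (- e + - e + - e))%Z with 0%Z by ring. reflexivity. }
    transitivity (q ^^ (3 * e) - q ^^ (3 * e) * q ^^ (n - 3) * q ^^ (- e)
       + q ^^ (3 * e) * q ^^ (n - 3) * q ^^ (- e) * q ^^ (n - 2) * q ^^ (- e)
       - q ^^ (n - 3) * q ^^ (n - 2) * q ^^ (n - 1) * pt q k * (q ^^ (3 * e) * (q ^^ (- e) * q ^^ (- e) * q ^^ (- e)))); [ring|].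
    rewrite E3. ring.
Qed.

(** Two flips, through the spin [2 (3 - r)] at index n + 1. *)
Lemma hecke_rec r n : hecke r (n + 2) = q ^^ (6 * n + 6) * hecke r n
  + lp r 1 * (q ^^ (n + 2) - q ^^ (5 * n + 6)) - lp r 2 * (q ^^ (2 * n + 5) - q ^^ (4 * n + 7)).
Proof.
  pose proof (hecke_flip (3 - r) (n + 2)) as H1. replace (3 - (3 - r))%Z with r in H1 by ring.
  pose proof (hecke_flip r (n + 1)) as H2.
  replace (n + 2 - 1)%Z with (n + 1)%Z in H1 by ring. replace (n + 1 - 1)%Z with n in H2 by ring.
  rewrite H1, H2, lp_flip_1, lp_flip_2.
  rewrite (Cpowz_split q (6 * n + 6) (3 * (3 - r) + 3 * (n + 2) - 6) (3 * r + 3 * (n + 1) - 6)) by (auto; ring).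
  rewrite (Cpowz_split q (5 * n + 6) (3 * (3 - r) + 3 * (n + 2) - 6) (2 * (n + 1) + 1 + (3 * r - 6))) by (auto; ring).
  rewrite (Cpowz_split q (4 * n + 7) (3 * (3 - r) + 3 * (n + 2) - 6) (n + 1 + (3 * r - 3))) by (auto; ring).
  rewrite (Cpowz_add q (2 * (n + 1) + 1)), (Cpowz_add q (n + 1)) by auto.
  replace (2 * (n + 2) + 1)%Z with (2 * n + 5)%Z by ring. ring.
Qed.

Lemma hecke_1 r : hecke (3 - r) 1 = q ^^ (3 * r - 3) * (hecke r 0 - lp r 1 + q * lp r 2).
Proof.
  rewrite hecke_flip. simpl (1 - 1)%Z. rewrite lp_flip_1, lp_flip_2.
  replace (3 * r + 3 * 1 - 6)%Z with (3 * r - 3)%Z by ring.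
  rewrite (Cpowz_split q (3 * r - 3) 3 (3 * r - 6)) by (auto; ring).
  change (2 * 1 + 1)%Z with 3%Z. change (q ^^ 1) with (q ^ 1). rewrite Cpow_1_r. ring.
Qed.

(** By [pt_rec] and [pt_sym], u_(-1-k) = 1 - u_k. The constant is annihilated by [lf], and the
    remaining sign cancels the one from [lf_anti]. *)
Lemma hecke_sym r n : hecke r (- n) = hecke r n.
Proof.
  unfold hecke. transitivity (- (- lf r (fun e => pt q (- n - e)))); [ring|].
  rewrite <- lf_anti by apply good_pt.
  rewrite (lf_ext _ _ (fun e => 1 + (-1) * pt q (n - e))).
  - rewrite lf_plus, lf_const, lf_scal by auto using good_const, good_scal, good_pt. ring.
  - intros e. rewrite (pt_rec q Hq Hq1). replace (- n - (1 - e) + 1)%Z with (- (n - e))%Z by ring.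
    rewrite pt_sym, Cmult_assoc, <- Cpowz_add by auto.
    replace (- (n - e) + (n - e))%Z with 0%Z by ring. simpl. ring.
Qed.

Lemma lf_csum r (h : Z -> Z -> C) M b : (0 <= M)%R -> (0 <= b)%Z ->
  (forall k e, (Cmod (h k e) <= M * Cmod (q ^^ (Z.abs k - b * Z.abs e)))%R) ->
  summable (fun k => lf r (h k)) /\ csum (fun k => lf r (h k)) = lf r (fun e => csum (fun k => h k e)).
Proof.
  intros HM Hb Hh.
  set (F := fun p : Z * Z => lw r (snd p) * (h (fst p) (- 8 * snd p - r)%Z - h (fst p) (8 * snd p + r + 1)%Z)).
  assert (Hpart : forall (g : Z -> Z) D, (forall i, (Z.abs (g i) <= 8 * Z.abs i + D)%Z) ->
            summable (fun p : Z * Z => lw r (snd p) * h (fst p) (g (snd p)))).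
  { intros g D Hg.
    assert (Hgood : good (fun e => q ^^ (- b * Z.abs e))).
    { exists 1%R, b. split; [lra|]. split; auto. intros e. lra. }
    apply summable_le with (fun p : Z * Z => M * Cmod (q ^^ Z.abs (fst p) * (lw r (snd p) * q ^^ (- b * Z.abs (g (snd p))))))%R.
    - intros [k i]; cbn [fst snd]. rewrite !Cmod_mult. specialize (Hh k (g i)).
      rewrite (Cpowz_split q (Z.abs k - b * Z.abs (g i)) (Z.abs k) (- b * Z.abs (g i))), Cmod_mult in Hh by (auto; ring).
      pose proof (Cmod_ge_0 (lw r i)). nra.
    - apply rsummable_scal; auto.
      apply (summable_prod (fun k => q ^^ Z.abs k) (fun i => lw r i * q ^^ (- b * Z.abs (g i)))).
      + apply weight_Z; auto.
      + apply (summable_lf_part r (fun e => q ^^ (- b * Z.abs e)) g D); auto. }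
  assert (HF : summable F).
  { apply summable_ext with (fun p : Z * Z => lw r (snd p) * h (fst p) (- 8 * snd p - r)%Z - lw r (snd p) * h (fst p) (8 * snd p + r + 1)%Z).
    - intros p. unfold F. ring.
    - apply summable_minus.
      + apply (Hpart (fun i => - 8 * i - r)%Z (Z.abs r)). intros; lia.
      + apply (Hpart (fun i => 8 * i + r + 1)%Z (Z.abs r + 1)%Z). intros; lia. }
  assert (Hcol : forall e, summable (fun k => h k e)).
  { intros e. apply (summable_q q Hq Hq1 Z.abs (fun k => Z.abs k - b * Z.abs e)%Z M (b * Z.abs e)); auto using weight_Z.
    intros; lia. }
  split; [apply (summable_rows F HF)|].
  transitivity (csum (fun k => csum (fun i => F (k, i)))); [reflexivity|].
  unfold lf. rewrite (csum_exchange (fun k i => F (k, i))).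
  - apply csum_ext. intros i. unfold F; cbn [fst snd]. rewrite csum_scal, csum_minus; auto.
    apply summable_minus; auto.
  - apply summable_ext with (2 := HF). intros []; reflexivity.
Qed.

Lemma pt_diff_bound : exists M, (0 <= M)%R /\
  forall j k, (Cmod (pt_diff q j k) <= M * Cmod (q ^^ (Z.abs (2 * k - j) - 2)))%R.
Proof.
  destruct (ptr_bound q Hq Hq1) as [M [H0 HM]]. exists (2 * M + 1)%R. split; [lra|]. intros j k.
  rewrite pt_diff_ptr by auto.
  assert (H1 : (Cmod ((-1) ^^ k * ptr q (2 * k - j)) <= M * Cmod (q ^^ (Z.abs (2 * k - j) - 2)))%R).
  { rewrite Cmod_mult, Cmod_sgn, Rmult_1_l. eapply Rle_trans; [apply HM|].
    apply Rmult_le_compat_l; [lra|]. apply Cpowz_le; auto. lia. }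
  assert (H2 : (Cmod ((-1) ^^ (k + -1) * ptr q (2 * (k + -1) - j)) <= M * Cmod (q ^^ (Z.abs (2 * k - j) - 2)))%R).
  { rewrite Cmod_mult, Cmod_sgn, Rmult_1_l. eapply Rle_trans; [apply HM|].
    apply Rmult_le_compat_l; [lra|]. apply Cpowz_le; auto. lia. }
  assert (H3 : (Cmod (if (k =? (j + 1) / 2)%Z then (-1) ^^ k else 0) <= Cmod (q ^^ (Z.abs (2 * k - j) - 2)))%R).
  { destruct (Z.eqb_spec k ((j + 1) / 2)).
    - rewrite Cmod_sgn. rewrite <- Cmod_1. apply (Cpowz_le q _ 0); auto. lia.
    - rewrite Cmod_0. apply Cmod_ge_0. }
  eapply Rle_trans; [apply Cmod_triangle|]. pose proof (Cmod_triangle ((-1) ^^ k * ptr q (2 * k - j)) ((-1) ^^ (k + -1) * ptr q (2 * (k + -1) - j))).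
  lra.
Qed.

(* Up to regularisation at [k -> -oo] this is the value at [z = i q] of the even part of
   the character. *)
Lemma hecke_central r :
  summable (fun k => (-1) ^^ k * (q ^^ (2 * k) * hecke r (2 * k) - q ^^ (2 * (k - 1)) * hecke r (2 * (k - 1)))) /\
  csum (fun k => (-1) ^^ k * (q ^^ (2 * k) * hecke r (2 * k) - q ^^ (2 * (k - 1)) * hecke r (2 * (k - 1))))
  = (-1) ^^ ((r + 1) / 2) * phi_const q * lp r 1.
Proof.
  (* From q^(2 k) u_(2k-e) = q^e (1 - u_(2k-1-e)): as k -> -oo the right-hand sides tend to the
     nonzero constant term [lp r 1] in general, so that only differences can be summed. *)
  assert (Ha : forall k, q ^^ (2 * k) * hecke r (2 * k) = lp r 1 + (-1) * lf r (fun e => q ^^ (1 * e) * pt q (2 * k - 1 - e))).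
  { intros k. unfold hecke, lp.
    assert (G : good (fun e => q ^^ (1 * e) * pt q (2 * k - 1 - e))) by (apply good_mult; auto using good_pow, good_pt).
    rewrite <- lf_scal by apply good_pt. rewrite <- lf_scal, <- lf_plus by auto using good_pow, good_scal.
    apply lf_ext. intros e. rewrite (pt_rec q Hq Hq1 (2 * k - 1 - e)).
    replace (2 * k - 1 - e + 1)%Z with (2 * k - e)%Z by ring.
    rewrite (Cpowz_split q (2 * k) (1 * e) (2 * k - e)) by (auto; ring). ring. }
  set (h := fun k e => - q ^^ (1 * e) * pt_diff q (e + 1) k).
  assert (E : forall k, (-1) ^^ k * (q ^^ (2 * k) * hecke r (2 * k) - q ^^ (2 * (k - 1)) * hecke r (2 * (k - 1))) = lf r (h k)).
  { intros k. rewrite !Ha.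
    assert (G : forall n, good (fun e => q ^^ (1 * e) * pt q (n - e))) by (intros; apply good_mult; auto using good_pow, good_pt).
    transitivity ((-1) ^^ k * lf r (fun e => q ^^ (1 * e) * pt q (2 * (k - 1) - 1 - e))
      + - (-1) ^^ k * lf r (fun e => q ^^ (1 * e) * pt q (2 * k - 1 - e))); [ring|].
    rewrite <- !lf_scal, <- lf_plus by auto using good_scal.
    apply lf_ext. intros e. unfold h, pt_diff.
    replace (2 * k - (e + 1))%Z with (2 * k - 1 - e)%Z by ring.
    replace (2 * k - 1 - e - 2)%Z with (2 * (k - 1) - 1 - e)%Z by ring. ring. }
  destruct pt_diff_bound as [M [H0 HM]].
  (* The constants come from e + |2 k - (e + 1)| - 2 >= -3 + |k| - 2 |e|. *)
  destruct (lf_csum r h (M * Cmod (q ^^ (- (3)))) 2) as [S1 E1].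
  - apply Rmult_le_pos; auto using Cmod_ge_0.
  - lia.
  - intros k e. unfold h. rewrite Cmod_mult, Cmod_opp.
    replace (M * Cmod (q ^^ (- (3))) * Cmod (q ^^ (Z.abs k - 2 * Z.abs e)))%R
      with (M * Cmod (q ^^ (- (3) + (Z.abs k - 2 * Z.abs e))))%R by (rewrite Cpowz_add, Cmod_mult by auto; ring).
    specialize (HM (e + 1)%Z k).
    apply Rle_trans with (Cmod (q ^^ (1 * e)) * (M * Cmod (q ^^ (Z.abs (2 * k - (e + 1)) - 2))))%R.
    + apply Rmult_le_compat_l; auto using Cmod_ge_0.
    + rewrite <- Rmult_assoc, (Rmult_comm _ M), Rmult_assoc, <- Cmod_mult, <- Cpowz_add by auto.
      apply Rmult_le_compat_l; auto. apply Cpowz_le; auto. lia.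
  - split; [apply summable_ext with (2 := S1); intros; symmetry; auto|].
    rewrite (csum_ext _ _ E), E1.
    change (lp r 1) with (lf r (fun e => q ^^ (1 * e))).
    rewrite <- (lf_scal r ((-1) ^^ ((r + 1) / 2) * phi_const q) (fun e => q ^^ (1 * e))) by apply good_pow.
    unfold lf. apply csum_ext. intros i. unfold h.
    rewrite !csum_scal, !csum_pt_diff by (auto; apply summable_pt_diff; auto).
    (* The sign of [csum_pt_diff] at j = e + 1 is the same for all exponents e of the numerator, so
       it can be taken out and the remaining sum over i is [lp r 1]. *)
    rewrite (sgn_eq (- 2 * i - (r + 1) / 2) ((- 8 * i - r + 1 - 1) / 2) ((r + 1) / 2)) by lia.
    rewrite (sgn_eq (2 * i) ((8 * i + r + 1 + 1 - 1) / 2) ((r + 1) / 2)) by lia. ring.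
Qed.

End Functional.

Lemma summable_of_inj {I J} (f : I -> C) (phi : J -> I) :
  (forall x y, phi x = phi y -> x = y) -> (forall i, f i <> 0 -> exists j, phi j = i) ->
  summable (fun j => f (phi j)) -> summable f.
Proof.
  intros Hi Hs [B HB]. exists B. intros l Hl.
  assert (H : exists m, NoDup m /\ (forall j, In j m -> In (phi j) l) /\
            rsum (fun i => Cmod (f i)) l = rsum (fun j => Cmod (f (phi j))) m).
  { clear B HB. induction Hl as [|i l Hn Hl [m [H1 [H2 H3]]]].
    - exists nil. split; [constructor|]. split; [simpl; tauto | reflexivity].
    - destruct (classic (f i = 0)) as [H0|H0].
      + exists m. split; auto. split; [intros; right; auto|].
        simpl. rewrite H0, Cmod_0, H3. ring.
      + destruct (Hs i H0) as [j <-]. exists (j :: m). split; [constructor; auto|].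
        split; [intros k [->|Hk]; [left | right]; auto | simpl; rewrite H3; reflexivity]. }
  destruct H as [m [H1 [_ ->]]]. auto.
Qed.

Lemma csum_initial (g : nat -> C) k :
  csum (fun j => if (j <? k)%nat then g j else 0) = lsum g (seq 0 k).
Proof.
  assert (Hs : forall k, summable (fun j => if (j <? k)%nat then g j else 0)).
  { intros n. exists (rsum (fun j => Cmod (g j)) (seq 0 n)). intros l Hl.
    apply Rle_trans with (rsum (fun j => Cmod (g j)) (filter (fun j => (j <? n)%nat) l)).
    - apply Req_le. clear. induction l; simpl; auto. destruct (a <? n)%nat; simpl; rewrite IHl; auto.
      rewrite Cmod_0. ring.
    - apply rsum_incl; [intros; apply Cmod_ge_0 | apply NoDup_filter; auto|].
      intros j Hj. apply filter_In in Hj. destruct Hj as [_ Hj]. apply Nat.ltb_lt in Hj.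
      apply in_seq. lia. }
  induction k.
  - simpl. apply csum_zero.
  - rewrite lsum_seq_S, <- IHk.
    transitivity (csum (fun j => if (j <? k)%nat then g j else 0) + csum (fun j => if (j =? k)%nat then g j else 0)).
    + rewrite <- csum_plus; auto.
      * apply csum_ext. intros j. destruct (Nat.ltb_spec j (S k)), (Nat.ltb_spec j k), (Nat.eqb_spec j k); try lia; ring.
      * apply summable_single with k. intros j Hj. destruct (Nat.eqb_spec j k); auto; contradiction.
    + f_equal. rewrite (csum_single _ k).
      * rewrite Nat.eqb_refl. reflexivity.
      * intros j Hj. destruct (Nat.eqb_spec j k); auto; contradiction.
Qed.

(** * Solving the recursion and determining the central coefficient *)

Section CentralTerm.

Variable q : C.
Hypothesis Hq : q <> 0.
Hypothesis Hq1 : (Cmod q < 1)%R.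

(** Variation of constants: the exponents 12 j + 6 with j < k add up to 6 k^2, so q^(6 k^2) solves
    the homogeneous recursion. Substituting k = l + J with J = j + 1 turns 6 k^2 - 6 J^2 + b k into
    the exponent of [ds_term]. The condition on b + g makes the double sum converge in the direction
    of J. *)
Lemma recursion_sum (b g : Z) (M : R) (e d : nat -> C) :
  (forall k, e (S k) = q ^^ (12 * Z.of_nat k + 6) * e k + d k) ->
  (forall k, (Cmod (d k) <= M * Cmod (q ^^ (g * Z.of_nat k)))%R) -> (-2 <= b)%Z -> (1 <= b + g)%Z ->
  summable (fun k => (-1) ^^ (Z.of_nat k) * q ^^ (b * Z.of_nat k) * e k) /\
  summable (fun k => (-1) ^^ (Z.of_nat k) * q ^^ (6 * Z.of_nat k * Z.of_nat k + b * Z.of_nat k)) /\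
  csum (fun k => (-1) ^^ (Z.of_nat k) * q ^^ (b * Z.of_nat k) * e k)
  = e O * csum (fun k => (-1) ^^ (Z.of_nat k) * q ^^ (6 * Z.of_nat k * Z.of_nat k + b * Z.of_nat k))
    + csum (fun p => ds_term q b b 0 p * d (snd p)).
Proof.
  intros He Hd Hb Hg.
  assert (E : forall k, e k = q ^^ (6 * Z.of_nat k * Z.of_nat k) * e O
     + lsum (fun j => q ^^ (6 * Z.of_nat k * Z.of_nat k - 6 * (Z.of_nat j + 1) * (Z.of_nat j + 1)) * d j) (seq 0 k)).
  { induction k; [simpl; ring|].
    rewrite He, IHk, lsum_seq_S, Cmult_plus_distr_l, <- lsum_scal.
    replace (6 * Z.of_nat (S k) * Z.of_nat (S k) - 6 * (Z.of_nat k + 1) * (Z.of_nat k + 1))%Z with 0%Z by lia.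
    rewrite (Cpowz_split q (6 * Z.of_nat (S k) * Z.of_nat (S k)) (12 * Z.of_nat k + 6) (6 * Z.of_nat k * Z.of_nat k)) by (auto; lia).
    replace (fun j => q ^^ (6 * Z.of_nat (S k) * Z.of_nat (S k) - 6 * (Z.of_nat j + 1) * (Z.of_nat j + 1)) * d j)
      with (fun i => q ^^ (12 * Z.of_nat k + 6) * (q ^^ (6 * Z.of_nat k * Z.of_nat k - 6 * (Z.of_nat i + 1) * (Z.of_nat i + 1)) * d i)).
    - simpl (q ^^ 0). ring.
    - apply functional_extensionality. intros j. rewrite Cmult_assoc, <- Cpowz_add by auto. f_equal. f_equal. lia. }
  assert (Hth : summable (fun k => (-1) ^^ (Z.of_nat k) * q ^^ (6 * Z.of_nat k * Z.of_nat k + b * Z.of_nat k))).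
  { apply (summable_q q Hq Hq1 Z.of_nat (fun k => 6 * Z.of_nat k * Z.of_nat k + b * Z.of_nat k)%Z 1 0); [apply weight_nat; auto| |].
    - intros k. rewrite Cmod_mult, Cmod_sgn. lra.
    - intros k. assert (0 <= (b + 2) * Z.of_nat k)%Z by nia. nia. }
  set (F := fun p : nat * nat => if (snd p <? fst p)%nat
     then (-1) ^^ (Z.of_nat (fst p)) * q ^^ (b * Z.of_nat (fst p))
       * (q ^^ (6 * Z.of_nat (fst p) * Z.of_nat (fst p) - 6 * (Z.of_nat (snd p) + 1) * (Z.of_nat (snd p) + 1)) * d (snd p)) else 0).
  set (phi := fun p : nat * nat => (fst p + snd p + 1, snd p)%nat).
  assert (Hphi : forall p, F (phi p) = ds_term q b b 0 p * d (snd p)).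
  { intros [l j]. unfold F, phi, ds_term; cbn [fst snd]. cbv zeta.
    destruct (Nat.ltb_spec j (l + j + 1)); [|lia].
    replace (Z.of_nat (l + j + 1)) with (Z.of_nat l + (Z.of_nat j + 1))%Z by lia.
    set (L := Z.of_nat l). set (J := (Z.of_nat j + 1)%Z).
    rewrite (Cpowz_split q (6 * L * L + 12 * L * J + b * J + b * L + 0) (b * (L + J)) (6 * (L + J) * (L + J) - 6 * J * J)) by (auto; ring).
    ring. }
  assert (Hs : summable (fun p => F (phi p))).
  { apply (summable_q q Hq Hq1 (fun p : nat * nat => Z.of_nat (fst p) + Z.of_nat (snd p))%Z
      (fun p : nat * nat => let l := Z.of_nat (fst p) in let J := (Z.of_nat (snd p) + 1)%Z in
         6 * l * l + 12 * l * J + b * J + b * l + 0 + g * Z.of_nat (snd p))%Z M 2); [apply weight_prod; auto using weight_nat| |].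
    - intros p. rewrite Hphi. unfold ds_term. cbv zeta. rewrite Cmod_mult, Cmod_mult, Cmod_sgn, Rmult_1_l.
      rewrite (Cpowz_add q (6 * Z.of_nat (fst p) * Z.of_nat (fst p) + 12 * Z.of_nat (fst p) * (Z.of_nat (snd p) + 1) + b * (Z.of_nat (snd p) + 1) + b * Z.of_nat (fst p) + 0)), Cmod_mult by auto.
      rewrite (Rmult_comm M), Rmult_assoc. apply Rmult_le_compat_l; [apply Cmod_ge_0|].
      rewrite Rmult_comm. apply Hd.
    - intros [l j]; cbn [fst snd]. cbv zeta. assert (0 <= Z.of_nat l)%Z by lia. assert (0 <= Z.of_nat j)%Z by lia. nia. }
  assert (Hinj : forall x y, phi x = phi y -> x = y).
  { intros [l j] [l' j'] H. unfold phi in H; cbn [fst snd] in H. apply pair_inv in H. f_equal; lia. }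
  assert (Hsupp : forall i, F i <> 0 -> exists p, phi p = i).
  { intros [k j] H. unfold F in H; cbn [fst snd] in H. destruct (Nat.ltb_spec j k); [|tauto].
    exists (k - j - 1, j)%nat. unfold phi; cbn [fst snd]. f_equal; lia. }
  pose proof (summable_of_inj F phi Hinj Hsupp Hs) as HF.
  assert (Hrow : forall k, csum (fun j => F (k, j)) = (-1) ^^ (Z.of_nat k) * q ^^ (b * Z.of_nat k) * e k
     - e O * ((-1) ^^ (Z.of_nat k) * q ^^ (6 * Z.of_nat k * Z.of_nat k + b * Z.of_nat k))).
  { intros k. unfold F; cbn [fst snd]. rewrite csum_initial, lsum_scal. rewrite (E k) at 1.
    rewrite (Cpowz_add q (6 * Z.of_nat k * Z.of_nat k)) by auto. ring. }
  assert (Hse : summable (fun k => (-1) ^^ (Z.of_nat k) * q ^^ (b * Z.of_nat k) * e k)).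
  { apply summable_ext with (fun k => csum (fun j => F (k, j)) + e O * ((-1) ^^ (Z.of_nat k) * q ^^ (6 * Z.of_nat k * Z.of_nat k + b * Z.of_nat k))).
    - intros k. rewrite Hrow. ring.
    - apply summable_plus; [apply (summable_rows F HF) | apply summable_scal; auto]. }
  split; auto. split; auto.
  rewrite (csum_ext _ _ (fun p => eq_sym (Hphi p))), csum_inj by auto.
  rewrite csum_fubini, (csum_ext _ _ Hrow) by auto.
  rewrite csum_minus, csum_scal by (auto; apply summable_scal; auto). ring.
Qed.

(** The halves k >= 0 and k <= 0 share the term k = 0, whence the subtracted 1. *)
Lemma pentagonal_aux : csum (fun k : Z => (-1) ^^ k * q ^^ (6 * k * k + 2 * k)) =
  csum (fun k => (-1) ^^ (Z.of_nat k) * q ^^ (6 * Z.of_nat k * Z.of_nat k + 2 * Z.of_nat k))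
  + csum (fun k => (-1) ^^ (Z.of_nat k) * q ^^ (6 * Z.of_nat k * Z.of_nat k + -2 * Z.of_nat k)) - 1.
Proof.
  assert (Hs : summable (fun k : Z => (-1) ^^ k * q ^^ (6 * k * k + 2 * k))).
  { apply (summable_q q Hq Hq1 Z.abs (fun k => 6 * k * k + 2 * k)%Z 1 10); [apply weight_Z; auto| |].
    - intros k. rewrite Cmod_mult, Cmod_sgn. lra.
    - intros k. nia. }
  rewrite csum_Z_nat by auto.
  assert (Hs' : summable (fun k : nat => (-1) ^^ (Z.of_nat k) * q ^^ (6 * Z.of_nat k * Z.of_nat k + -2 * Z.of_nat k))).
  { apply (summable_q q Hq Hq1 Z.of_nat (fun k => 6 * Z.of_nat k * Z.of_nat k + -2 * Z.of_nat k)%Z 1 10); [apply weight_nat; auto| |].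
    - intros k. rewrite Cmod_mult, Cmod_sgn. lra.
    - intros k. nia. }
  rewrite (csum_S (fun k => (-1) ^^ (Z.of_nat k) * q ^^ (6 * Z.of_nat k * Z.of_nat k + -2 * Z.of_nat k))) by auto.
  rewrite (csum_ext (fun n => (-1) ^^ (- Z.of_nat (S n)) * _)
    (fun n => (-1) ^^ (Z.of_nat (S n)) * q ^^ (6 * Z.of_nat (S n) * Z.of_nat (S n) + -2 * Z.of_nat (S n)))).
  - simpl. ring.
  - intros n. rewrite (sgn_eq (- Z.of_nat (S n)) (- Z.of_nat (S n)) (Z.of_nat (S n))) by lia.
    f_equal; f_equal; ring.
Qed.

Lemma ds_term_scal a b c a' c' p : ds_term q a b c p * q ^^ (a' * (Z.of_nat (snd p) + 1) + c')
  = ds_term q (a + a') b (c + c') p.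
Proof.
  unfold ds_term. cbv zeta. rewrite <- Cmult_assoc, <- Cpowz_add by auto. f_equal. f_equal. ring.
Qed.

Definition f3_sum : C :=
  csum (fun r => (-1) ^^ r * q ^^ (12 * tri r + 8 * r) * / (1 + q ^^ (4 * r))).
Definition omega3_sum : C :=
  csum (fun r => (-1) ^^ r * q ^^ (12 * tri r + 12 * r + 3) * / (1 + q ^^ (4 * r + 2))).

(** The unknown value at 0 starts the recursion on both sides of the origin, so it is multiplied by
    the two halves of a theta series, which join into the pentagonal series. [hecke_central]
    evaluates the same alternating sum and thus gives a linear equation for it. *)
Lemma hecke_0 r :
  csum (fun k : Z => (-1) ^^ k * q ^^ (6 * k * k + 2 * k)) * hecke q r 0
  = (-1) ^^ ((r + 1) / 2) / 2 * phi_const q * lp q r 1 + lp q r 1 * f3_sum - lp q r 2 * omega3_sum.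
Proof.
  set (A := lp q r 1). set (B := lp q r 2). set (G := hecke q r 0).
  destruct (hecke_central q Hq Hq1 r) as [ST ET]. fold A in ET.
  set (e := fun k : nat => hecke q r (2 * Z.of_nat k)).
  set (d := fun k : nat => let J := (Z.of_nat k + 1)%Z in
     A * (q ^^ (2 * J) - q ^^ (10 * J - 4)) - B * (q ^^ (4 * J + 1) - q ^^ (8 * J - 1))).
  (* On the negative side q^(-2 k) times the coefficient is [A + q^(-2 k) e' k], and only [e'] can
     be summed with the weight exponent -2. Subtracting A q^(2 k) replaces the slowest term q^(2 J)
     of [d] by q^(14 J - 8). *)
  set (e' := fun k : nat => e k - A * q ^^ (2 * Z.of_nat k)).
  set (d' := fun k : nat => let J := (Z.of_nat k + 1)%Z in
     A * (q ^^ (14 * J - 8) - q ^^ (10 * J - 4)) - B * (q ^^ (4 * J + 1) - q ^^ (8 * J - 1))).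
  assert (He : forall k, e (S k) = q ^^ (12 * Z.of_nat k + 6) * e k + d k).
  { intros k. unfold e, d. cbv zeta. replace (2 * Z.of_nat (S k))%Z with (2 * Z.of_nat k + 2)%Z by lia.
    rewrite hecke_rec by auto. fold A B. set (m := Z.of_nat k).
    replace (6 * (2 * m) + 6)%Z with (12 * m + 6)%Z by ring.
    replace (2 * m + 2)%Z with (2 * (m + 1))%Z by ring.
    replace (5 * (2 * m) + 6)%Z with (10 * (m + 1) - 4)%Z by ring.
    replace (2 * (2 * m) + 5)%Z with (4 * (m + 1) + 1)%Z by ring.
    replace (4 * (2 * m) + 7)%Z with (8 * (m + 1) - 1)%Z by ring. ring. }
  assert (He' : forall k, e' (S k) = q ^^ (12 * Z.of_nat k + 6) * e' k + d' k).
  { intros k. unfold e'. rewrite He. unfold d, d'. cbv zeta. set (m := Z.of_nat k).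
    replace (Z.of_nat (S k)) with (m + 1)%Z by lia.
    rewrite (Cpowz_split q (14 * (m + 1) - 8) (12 * m + 6) (2 * m)) by (auto; ring). ring. }
  set (M := (2 * Cmod A + 2 * Cmod B)%R).
  assert (Hdb : forall (x y u v : C) t, (Cmod x <= t)%R -> (Cmod y <= t)%R -> (Cmod u <= t)%R -> (Cmod v <= t)%R ->
            (Cmod (A * (x - y) - B * (u - v)) <= M * t)%R).
  { intros x y u v t Hx Hy Hu Hv. unfold M, Cminus.
    eapply Rle_trans; [apply Cmod_triangle|]. rewrite Cmod_opp, !Cmod_mult.
    pose proof (Cmod_triangle x (- y)) as T1. pose proof (Cmod_triangle u (- v)) as T2.
    rewrite Cmod_opp in T1, T2. pose proof (Cmod_ge_0 A). pose proof (Cmod_ge_0 B). nra. }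
  destruct (recursion_sum 2 2 M e d He) as [Se [Sp Ep]].
  { intros k. unfold d. cbv zeta. apply Hdb; apply Cpowz_le; auto; lia. }
  { lia. } { lia. }
  destruct (recursion_sum (-2) 4 M e' d' He') as [Se' [Sm Em]].
  { intros k. unfold d'. cbv zeta. apply Hdb; apply Cpowz_le; auto; lia. }
  { lia. } { lia. }
  rewrite pentagonal_aux.
  set (Tp := csum (fun k => (-1) ^^ (Z.of_nat k) * q ^^ (6 * Z.of_nat k * Z.of_nat k + 2 * Z.of_nat k))) in *.
  set (Tm := csum (fun k => (-1) ^^ (Z.of_nat k) * q ^^ (6 * Z.of_nat k * Z.of_nat k + -2 * Z.of_nat k))) in *.
  assert (Dp : csum (fun p => ds_term q 2 2 0 p * d (snd p))
     = A * (csum (ds_term q 4 2 0) - csum (ds_term q 12 2 (-4)))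
       - B * (csum (ds_term q 6 2 1) - csum (ds_term q 10 2 (-1)))).
  { rewrite <- !csum_minus, <- !csum_scal, <- csum_minus
      by (repeat first [apply summable_minus | apply summable_scal | apply summable_ds_term; auto; lia]).
    apply csum_ext. intros p. unfold d. cbv zeta.
    rewrite <- (ds_term_scal 2 2 0 2 0 p : _ = ds_term q 4 2 0 p), <- (ds_term_scal 2 2 0 10 (-4) p : _ = ds_term q 12 2 (-4) p),
      <- (ds_term_scal 2 2 0 4 1 p : _ = ds_term q 6 2 1 p), <- (ds_term_scal 2 2 0 8 (-1) p : _ = ds_term q 10 2 (-1) p).
    rewrite Z.add_0_r. replace (10 * (Z.of_nat (snd p) + 1) + -4)%Z with (10 * (Z.of_nat (snd p) + 1) - 4)%Z by ring.
    replace (8 * (Z.of_nat (snd p) + 1) + -1)%Z with (8 * (Z.of_nat (snd p) + 1) - 1)%Z by ring. ring. }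
  assert (Dm : csum (fun p => ds_term q (-2) (-2) 0 p * d' (snd p))
     = A * (csum (ds_term q 12 (-2) (-8)) - csum (ds_term q 8 (-2) (-4)))
       - B * (csum (ds_term q 2 (-2) 1) - csum (ds_term q 6 (-2) (-1)))).
  { rewrite <- !csum_minus, <- !csum_scal, <- csum_minus
      by (repeat first [apply summable_minus | apply summable_scal | apply summable_ds_term; auto; lia]).
    apply csum_ext. intros p. unfold d'. cbv zeta.
    rewrite <- (ds_term_scal (-2) (-2) 0 14 (-8) p : _ = ds_term q 12 (-2) (-8) p), <- (ds_term_scal (-2) (-2) 0 10 (-4) p : _ = ds_term q 8 (-2) (-4) p),
      <- (ds_term_scal (-2) (-2) 0 4 1 p : _ = ds_term q 2 (-2) 1 p), <- (ds_term_scal (-2) (-2) 0 8 (-1) p : _ = ds_term q 6 (-2) (-1) p).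
    replace (14 * (Z.of_nat (snd p) + 1) + -8)%Z with (14 * (Z.of_nat (snd p) + 1) - 8)%Z by ring.
    replace (10 * (Z.of_nat (snd p) + 1) + -4)%Z with (10 * (Z.of_nat (snd p) + 1) - 4)%Z by ring.
    replace (8 * (Z.of_nat (snd p) + 1) + -1)%Z with (8 * (Z.of_nat (snd p) + 1) - 1)%Z by ring. ring. }
  rewrite Dp in Ep. rewrite Dm in Em. clear Dp Dm.
  rewrite ds_even_1, ds_even_2, ds_odd_1, ds_odd_2 in Ep by auto.
  rewrite ds_even_3, ds_even_4, ds_odd_3, ds_odd_4 in Em by auto.
  (* The diagonal left over by [ds_even_3] is [Tm] without its term k = 0. *)
  assert (HTm : csum (fun n : nat => (-1) ^^ (Z.of_nat n + 1) * q ^^ (6 * (Z.of_nat n + 1) * (Z.of_nat n + 1) - 2 * (Z.of_nat n + 1))) = Tm - 1).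
  { unfold Tm. rewrite (csum_S _ Sm). simpl (Z.of_nat 0). simpl (_ ^^ 0).
    replace (6 * 0 * 0 + -2 * 0)%Z with 0%Z by reflexivity. simpl (q ^^ 0).
    rewrite (csum_ext _ (fun n : nat => (-1) ^^ (Z.of_nat (S n)) * q ^^ (6 * Z.of_nat (S n) * Z.of_nat (S n) + -2 * Z.of_nat (S n)))); [ring|].
    intros n. replace (Z.of_nat (S n)) with (Z.of_nat n + 1)%Z by lia. f_equal. f_equal. ring. }
  rewrite HTm in Em.
  set (al := csum (fun k => (-1) ^^ (Z.of_nat k) * q ^^ (2 * Z.of_nat k) * e k)) in *.
  set (al' := csum (fun k => (-1) ^^ (Z.of_nat k) * q ^^ (-2 * Z.of_nat k) * e' k)) in *.
  (* The alternating sum of differences telescopes to twice the regularised alternating sum. *)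
  assert (ET' : 2 * al + 2 * al' - 2 * G + A = (-1) ^^ ((r + 1) / 2) * phi_const q * A).
  { rewrite <- ET. rewrite csum_Z_nat by auto.
    assert (Z1 : e O = G) by reflexivity.
    assert (Z2 : e' O = G - A) by (unfold e'; rewrite Z1; simpl; ring).
    assert (Ea : forall k : nat, q ^^ (2 * - Z.of_nat k) * hecke q r (2 * - Z.of_nat k) = A + q ^^ (-2 * Z.of_nat k) * e' k).
    { intros k. replace (2 * - Z.of_nat k)%Z with (- (2 * Z.of_nat k))%Z by ring.
      rewrite hecke_sym by auto. unfold e', e.
      replace (-2 * Z.of_nat k)%Z with (- (2 * Z.of_nat k))%Z by ring. rewrite Cpowz_opp by auto.
      field. apply Cpowz_neq0; auto. }
    pose proof (csum_S _ Se) as Ea0. fold al in Ea0.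
    pose proof (csum_S _ Se') as Ea1. fold al' in Ea1.
    assert (Se1 := summable_inj _ S (fun x y H => Nat.succ_inj x y H) Se).
    assert (Se1' := summable_inj _ S (fun x y H => Nat.succ_inj x y H) Se').
    assert (Se2' := summable_inj _ S (fun x y H => Nat.succ_inj x y H) Se1').
    cbv beta in Se1, Se1', Se2'.
    pose proof (csum_S _ Se1') as Ea2.
    rewrite csum_S.
    2:{ apply (summable_inj _ Z.of_nat (fun x y => Nat2Z.inj x y) ST). }
    rewrite (csum_ext (fun n : nat => (-1) ^^ (Z.of_nat (S n)) * (q ^^ (2 * Z.of_nat (S n)) * hecke q r (2 * Z.of_nat (S n)) - _))
      (fun n => (-1) ^^ (Z.of_nat (S n)) * q ^^ (2 * Z.of_nat (S n)) * e (S n) + (-1) ^^ (Z.of_nat n) * q ^^ (2 * Z.of_nat n) * e n)).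
    2:{ intros n. unfold e. rewrite (sgn_neg 0 (Z.of_nat (S n)) (Z.of_nat n)) by lia.
        replace (Z.of_nat (S n) - 1)%Z with (Z.of_nat n) by lia. ring. }
    rewrite (csum_ext (fun n : nat => (-1) ^^ (- Z.of_nat (S n)) * _)
      (fun n => (-1) ^^ (Z.of_nat (S n)) * q ^^ (-2 * Z.of_nat (S n)) * e' (S n)
         + (-1) ^^ (Z.of_nat (S (S n))) * q ^^ (-2 * Z.of_nat (S (S n))) * e' (S (S n)))).
    2:{ intros n. replace (- Z.of_nat (S n) - 1)%Z with (- Z.of_nat (S (S n)))%Z by lia.
        rewrite !Ea. rewrite (sgn_eq (- Z.of_nat (S n)) (- Z.of_nat (S n)) (Z.of_nat (S n))) by lia.
        rewrite (sgn_neg 0 (Z.of_nat (S (S n))) (Z.of_nat (S n))) by lia. ring. }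
    rewrite !csum_plus by auto.
    change (csum (fun i : nat => (-1) ^^ (Z.of_nat i) * q ^^ (2 * Z.of_nat i) * e i)) with al.
    replace (csum (fun i : nat => (-1) ^^ (Z.of_nat (S i)) * q ^^ (2 * Z.of_nat (S i)) * e (S i))) with
      (al - G) by (rewrite Ea0, Z1; simpl; ring).
    assert (Ea1' : csum (fun i : nat => (-1) ^^ (Z.of_nat (S i)) * q ^^ (-2 * Z.of_nat (S i)) * e' (S i)) = al' - (G - A))
      by (rewrite Ea1, Z2; simpl; ring).
    rewrite Ea1' in Ea2 |- *.
    replace (csum (fun i : nat => (-1) ^^ (Z.of_nat (S (S i))) * q ^^ (-2 * Z.of_nat (S (S i))) * e' (S (S i)))) with
      (al' - (G - A) - (-1) ^^ (Z.of_nat 1) * q ^^ (-2 * Z.of_nat 1) * e' 1%nat) by (rewrite Ea2; ring).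
    change (Z.of_nat 0 - 1)%Z with (- Z.of_nat 1)%Z. rewrite Ea.
    change (hecke q r (2 * Z.of_nat 0)) with G. simpl. ring. }
  assert (Hf3 : f3_sum = / 2 + csum (restrict (above 1) (even_term q)) + csum (restrict (above 2) (even_term q))
     - csum (restrict (below 1) (even_term q)) - csum (restrict (below 2) (even_term q))).
  { unfold f3_sum. rewrite f3_appell_double_sum by auto.
    pose proof (summable_even_term q Hq Hq1) as He0.
    pose proof (antisymmetric_double_sum (even_term q) He0 (even_term_anti q Hq) (even_term_3 q Hq)) as HA.
    rewrite restrict_residues in HA by auto.
    rewrite (csum_ext (restrict (fun p => (snd p =? 3 * fst p)%Z) (even_term q)) (fun _ => 0)) in HA.
    - rewrite csum_zero in HA.
      transitivity (/ 2 + (2 * csum (restrict (fun p => (3 * fst p <? snd p)%Z) (even_term q)) + 0)); [ring|].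
      rewrite HA. ring.
    - intros [a n]. unfold restrict; cbn [fst snd]. destruct (Z.eqb_spec n (3 * a)); auto.
      apply NNPP. intros H. apply even_term_supp in H. lia. }
  assert (Hw3 : omega3_sum = csum (restrict (above 1) (odd_term q)) + csum (restrict (above 2) (odd_term q))
     - csum (restrict (below 1) (odd_term q)) - csum (restrict (below 2) (odd_term q))).
  { unfold omega3_sum. rewrite omega3_appell_double_sum by auto.
    pose proof (summable_odd_term q Hq Hq1) as He0.
    rewrite (antisymmetric_double_sum (odd_term q) He0 (odd_term_anti q Hq) (odd_term_3 q Hq)).
    apply restrict_residues; auto. }
  rewrite Hf3, Hw3.
  assert (Z1 : e O = G) by reflexivity.
  assert (Z2 : e' O = G - A) by (unfold e'; rewrite Z1; simpl; ring).
  rewrite Z1 in Ep. rewrite Z2 in Em. rewrite Ep, Em in ET'.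
  (* [A * (Tm - 1)] from the diagonal cancels the part [- A * Tm] due to the initial value [G - A]
     of [e']. The constants left over combine with the [A] of [ET'] into the summand 1/2 of
     [f3_sum]. *)
  transitivity (/ 2 * ((-1) ^^ ((r + 1) / 2) * phi_const q * A) + A * (/ 2 + csum (restrict (above 1) (even_term q)) + csum (restrict (above 2) (even_term q))
     - csum (restrict (below 1) (even_term q)) - csum (restrict (below 2) (even_term q)))
     - B * (csum (restrict (above 1) (odd_term q)) + csum (restrict (above 2) (odd_term q))
     - csum (restrict (below 1) (odd_term q)) - csum (restrict (below 2) (odd_term q)))); [|field; apply C2_neq0].
  rewrite <- ET'. field; apply C2_neq0.
Qed.

End CentralTerm.

(** * The quintuple product *)

Lemma csum_mod3 (f : Z -> C) : summable f ->
  csum f = csum (fun n => f (3 * n)%Z) + csum (fun n => f (3 * n + 1)%Z) + csum (fun n => f (3 * n + 2)%Z).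
Proof.
  intros Hf. pose proof (fun P => summable_restrict P f Hf) as HP.
  rewrite <- (csum_restrict_inj (fun m => (m mod 3 =? 0)%Z) f (fun n => 3 * n)%Z); auto.
  2:{ intros; lia. } 2:{ intros n. apply Z.eqb_eq. lia. }
  2:{ intros m H _. apply Z.eqb_eq in H. exists (m / 3)%Z. lia. }
  rewrite <- (csum_restrict_inj (fun m => (m mod 3 =? 1)%Z) f (fun n => 3 * n + 1)%Z); auto.
  2:{ intros; lia. } 2:{ intros n. apply Z.eqb_eq. lia. }
  2:{ intros m H _. apply Z.eqb_eq in H. exists (m / 3)%Z. lia. }
  rewrite <- (csum_restrict_inj (fun m => (m mod 3 =? 2)%Z) f (fun n => 3 * n + 2)%Z); auto.
  2:{ intros; lia. } 2:{ intros n. apply Z.eqb_eq. lia. }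
  2:{ intros m H _. apply Z.eqb_eq in H. exists (m / 3)%Z. lia. }
  rewrite <- csum_plus, <- csum_plus; auto; [|apply summable_plus; auto].
  apply csum_ext. intros m. unfold restrict.
  destruct (Z.eqb_spec (m mod 3) 0), (Z.eqb_spec (m mod 3) 1), (Z.eqb_spec (m mod 3) 2); try lia; ring.
Qed.

Section ThetaIdentities.

Variable q : C.
Hypothesis Hq : q <> 0.
Hypothesis Hq1 : (Cmod q < 1)%R.

Lemma J_pinf a : J a q = pinf (q ^ a) (q ^ a).
Proof.
  unfold J, Cprod_inf, pinf. f_equal. apply functional_extensionality. intros n.
  apply Cprod_ext. intros i. rewrite <- Cpow_mult_r, <- Cpow_add_r. f_equal. f_equal. lia.
Qed.

(** The triple product in base q^6 at z = q^4, whose three progressions of exponents interleave to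
    all even ones. *)
Lemma pentagonal : csum (fun k : Z => (-1) ^^ k * q ^^ (3 * k * k + k)) = pinf (q ^ 2) (q ^ 2).
Proof.
  destruct (qpow_facts q Hq Hq1 2 ltac:(lia)) as [H2 H21]. destruct (qpow_facts q Hq Hq1 6 ltac:(lia)) as [H6 H61].
  destruct (qpow_facts q Hq Hq1 4 ltac:(lia)) as [H4 H41].
  transitivity (jtheta (q ^ 4) (q ^ 6)).
  - rewrite jtheta_csum by auto. apply csum_ext. intros k. unfold theta_term.
    change (q ^ 6) with (q ^^ 6). change (q ^ 4) with (q ^^ 4). rewrite <- !Cpowz_mul by auto.
    rewrite <- Cmult_assoc, <- Cpowz_add by auto. f_equal. f_equal. pose proof (tri_spec k). lia.
  - rewrite triple_product by auto.
    replace (q ^ 6 / q ^ 4) with (q ^ 2) by (simpl; field; auto).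
    apply cv_unique with (fun n => qpoch (q ^ 6) (q ^ 6) n * qpoch (q ^ 4) (q ^ 6) n * qpoch (q ^ 2) (q ^ 6) n).
    + repeat apply cv_mult; apply qpoch_cv; auto.
    + apply cv_ext with (fun n => qpoch (q ^ 2) (q ^ 2) (3 * n)).
      * induction n; [unfold qpoch; simpl; ring|].
        replace (3 * S n)%nat with (S (S (S (3 * n)))) by lia. rewrite !qpoch_S, IHn.
        rewrite <- !Cpow_mult_r, <- !Cpow_add_r.
        replace (2 * (3 * n) + 2)%nat with (6 * n + 2)%nat by lia.
        replace (2 * S (3 * n) + 2)%nat with (6 * n + 4)%nat by lia.
        replace (2 * S (S (3 * n)) + 2)%nat with (6 * n + 6)%nat by lia. ring.
      * apply (cv_sub (qpoch (q ^ 2) (q ^ 2)) _ (fun n => 3 * n)%nat); [intros; lia | apply qpoch_cv; auto].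
Qed.

Lemma summable_quadratic a b : (1 <= a)%Z -> summable (fun k : Z => (-1) ^^ k * q ^^ (a * k * k + b * k)).
Proof.
  intros Ha.
  apply (summable_q q Hq Hq1 Z.abs (fun k => a * k * k + b * k)%Z 1 ((Z.abs b + 1) * (Z.abs b + 1))); [apply weight_Z; auto| |].
  - intros k. rewrite Cmod_mult, Cmod_sgn. lra.
  - intros k. assert (- (Z.abs b * Z.abs k) <= b * k)%Z by nia.
    assert (E : (k * k = Z.abs k * Z.abs k)%Z) by (rewrite Z.abs_square; ring).
    assert (Z.abs k * Z.abs k <= a * k * k)%Z by nia.
    assert (0 <= (Z.abs k - (Z.abs b + 1)) * (Z.abs k - (Z.abs b + 1)))%Z by apply Z.square_nonneg. nia.
Qed.

(** Shifting b by n = m / 3 changes the linear coefficient into 1, -1 or -3, according to m modulo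
    3. The first two cases are the pentagonal series and its reflection; in the third, b -> 1 - b
    reverses the sign of each term. *)
Lemma quintuple_row m : csum (fun b : Z => (-1) ^^ b * q ^^ (3 * b * b + (1 - 2 * m) * b))
  = if (m mod 3 =? 2)%Z then 0 else (-1) ^^ (m / 3) * q ^^ ((m / 3) * (m / 3 + 1) - m * (2 * (m / 3)) + 2 * (m / 3) * (m / 3)) * pinf (q ^ 2) (q ^ 2).
Proof.
  pose proof pentagonal as HP. set (n := (m / 3)%Z).
  rewrite <- (csum_shift n) by (apply summable_quadratic; lia).
  destruct (Z.eqb_spec (m mod 3) 2) as [H2|H2].
  - assert (E : m = (3 * n + 2)%Z) by (unfold n; lia). rewrite E.
    apply csum_anti with (fun b => 1 - b)%Z.
    + intros; lia.
    + intros b. rewrite (sgn_neg (- b) (1 - b + n) (b + n)) by lia.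
      replace (3 * (1 - b + n) * (1 - b + n) + (1 - 2 * (3 * n + 2)) * (1 - b + n))%Z
        with (3 * (b + n) * (b + n) + (1 - 2 * (3 * n + 2)) * (b + n))%Z by ring. ring.
    + apply (summable_shift n (fun b => (-1) ^^ b * q ^^ (3 * b * b + (1 - 2 * (3 * n + 2)) * b))).
      apply summable_quadratic; lia.
  - destruct (Z.eq_dec (m mod 3) 0) as [H0|H0].
    + assert (E : m = (3 * n)%Z) by (unfold n; lia). rewrite E, <- HP.
      rewrite <- csum_scal.
      * apply csum_ext. intros b. rewrite (Cpowz_add (-1)) by apply m1_neq0.
        rewrite (Cpowz_split q (3 * (b + n) * (b + n) + (1 - 2 * (3 * n)) * (b + n)) (3 * b * b + b)
          (n * (n + 1) - 3 * n * (2 * n) + 2 * n * n)) by (auto; ring). ring.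
      * apply summable_ext with (2 := summable_quadratic 3 1 ltac:(lia)). intros b. rewrite Z.mul_1_l. reflexivity.
    + assert (E : m = (3 * n + 1)%Z) by (unfold n; lia). rewrite E, <- HP.
      assert (Hs : summable (fun k => (-1) ^^ k * q ^^ (3 * k * k + k))).
      { apply summable_ext with (2 := summable_quadratic 3 1 ltac:(lia)). intros b. rewrite Z.mul_1_l. reflexivity. }
      rewrite <- (csum_reflect 0 (fun k => (-1) ^^ k * q ^^ (3 * k * k + k))) by auto.
      rewrite <- csum_scal by (apply (summable_reflect 0 (fun k => (-1) ^^ k * q ^^ (3 * k * k + k))); auto).
      apply csum_ext. intros b. rewrite (Cpowz_add (-1)) by apply m1_neq0.
      rewrite (sgn_eq (- b) (0 - b) b) by lia.
      rewrite (Cpowz_split q (3 * (b + n) * (b + n) + (1 - 2 * (3 * n + 1)) * (b + n)) (3 * (0 - b) * (0 - b) + (0 - b))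
          (n * (n + 1) - (3 * n + 1) * (2 * n) + 2 * n * n)) by (auto; ring). ring.
Qed.

(** The product of the two theta series is collected by the total power m of [y]. The inner sums are
    [quintuple_row], so the classes m = 0 and m = 1 modulo 3 give the two series on the right and m
    = 2 gives nothing. *)
Lemma quintuple_product (y : C) : y <> 0 ->
  summable (fun n => q ^^ (3 * tri n + 2 * n) * (y ^^ (- 3 * n) - y ^^ (3 * n + 1))) /\
  jtheta y q * jtheta (q * y ^ 2) (q ^ 2)
  = pinf (q ^ 2) (q ^ 2) * csum (fun n => q ^^ (3 * tri n + 2 * n) * (y ^^ (- 3 * n) - y ^^ (3 * n + 1))).
Proof.
  intros Hy. destruct (qpow_facts q Hq Hq1 2 ltac:(lia)) as [H2 H21].
  assert (Hz : q * y ^ 2 <> 0) by (apply Cmult_neq_0; auto; apply Cpow_nz; auto).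
  pose proof (summable_theta q Hq Hq1 y Hy) as S1.
  pose proof (summable_theta (q ^ 2) H2 H21 _ Hz) as S2.
  assert (Hb : exists b, (0 <= b)%Z /\ forall n, (Cmod (y ^^ n) <= Cmod (q ^^ (- b * Z.abs n)))%R)
    by (apply powz_bound; auto).
  destruct Hb as [b [Hb0 Hb]].
  assert (S3 : forall c d : Z, summable (fun n => q ^^ (3 * tri n + 2 * n) * y ^^ (c * n + d))).
  { intros c d.
    apply (summable_q q Hq Hq1 Z.abs (fun n => 3 * tri n + 2 * n - b * (Z.abs c * Z.abs n + Z.abs d))%Z 1
       ((b * Z.abs c + 4) * (b * Z.abs c + 4) + b * Z.abs d)); [apply weight_Z; auto| |].
    - intros n. rewrite Cmod_mult, Rmult_1_l.
      rewrite (Cpowz_split q (3 * tri n + 2 * n - b * (Z.abs c * Z.abs n + Z.abs d)) (3 * tri n + 2 * n)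
        (- b * (Z.abs c * Z.abs n + Z.abs d))), Cmod_mult by (auto; ring).
      apply Rmult_le_compat_l; [apply Cmod_ge_0|]. eapply Rle_trans; [apply Hb|]. apply Cpowz_le; auto. nia.
    - intros n. pose proof (tri_spec n).
      assert (E : (n * n = Z.abs n * Z.abs n)%Z) by (rewrite Z.abs_square; ring).
      assert (0 <= b * Z.abs c)%Z by nia.
      set (u := (b * Z.abs c)%Z) in *.
      replace (b * (Z.abs c * Z.abs n + Z.abs d))%Z with (u * Z.abs n + b * Z.abs d)%Z by (unfold u; ring).
      assert (0 <= (Z.abs n - (u + 4)) * (Z.abs n - (u + 4)))%Z by apply Z.square_nonneg.
      assert (- Z.abs n <= n)%Z by lia. assert (0 <= u * Z.abs n)%Z by nia. nia. }
  assert (S4 : summable (fun n => q ^^ (3 * tri n + 2 * n) * y ^^ (- 3 * n))).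
  { apply summable_ext with (2 := S3 (-3)%Z 0%Z). intros n. rewrite Z.add_0_r. reflexivity. }
  assert (S5 := S3 3%Z 1%Z).
  assert (SR : summable (fun n => q ^^ (3 * tri n + 2 * n) * (y ^^ (- 3 * n) - y ^^ (3 * n + 1)))).
  { apply summable_ext with (fun n => q ^^ (3 * tri n + 2 * n) * y ^^ (- 3 * n) - q ^^ (3 * tri n + 2 * n) * y ^^ (3 * n + 1)).
    - intros; ring.
    - apply summable_minus; auto. }
  split; auto.
  rewrite !jtheta_csum by auto.
  rewrite <- csum_prod by auto.
  pose proof (summable_prod _ _ S1 S2) as SP.
  set (F := fun p : Z * Z => theta_term q y (fst p) * theta_term (q ^ 2) (q * y ^ 2) (snd p)) in *.
  (* A term n of the first series and c of the second contribute to y^(n + 2 c), so the row index is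
     m = n + 2 c. *)
  pose (phi := fun p : Z * Z => (fst p - 2 * snd p, snd p)%Z).
  pose (psi := fun p : Z * Z => (fst p + 2 * snd p, snd p)%Z).
  assert (Hpp : forall p, psi (phi p) = p) by (intros [a c]; unfold psi, phi; cbn [fst snd]; f_equal; lia).
  assert (Hpp' : forall p, phi (psi p) = p) by (intros [a c]; unfold psi, phi; cbn [fst snd]; f_equal; lia).
  rewrite <- (csum_bij F phi psi) by auto.
  assert (SF : summable (fun p => F (phi p))).
  { apply (summable_inj F phi); auto. intros x z H. rewrite <- (Hpp x), <- (Hpp z), H. reflexivity. }
  rewrite csum_fubini by auto.
  assert (Hrow : forall m, csum (fun c => F (phi (m, c))) = (-1) ^^ m * q ^^ (tri m) * y ^^ m
     * csum (fun b : Z => (-1) ^^ b * q ^^ (3 * b * b + (1 - 2 * m) * b))).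
  { intros m. rewrite <- csum_scal by (apply summable_quadratic; lia). apply csum_ext. intros c.
    unfold F, phi, theta_term; cbn [fst snd].
    rewrite (Cpowz_mult_base q (y ^ 2)) by (auto; apply Cpow_nz; auto).
    change (q ^ 2) with (q ^^ 2). change (y ^ 2) with (y ^^ 2). rewrite <- !Cpowz_mul by auto.
    rewrite (sgn_eq (- c) (m - 2 * c) m) by lia.
    rewrite (Cpowz_split y m (m - 2 * c) (2 * c)) by (auto; ring).
    transitivity ((-1) ^^ m * (-1) ^^ c * (q ^^ tri (m - 2 * c) * q ^^ (2 * tri c) * q ^^ c) * (y ^^ (m - 2 * c) * y ^^ (2 * c))); [ring|].
    transitivity ((-1) ^^ m * (-1) ^^ c * (q ^^ tri m * q ^^ (3 * c * c + (1 - 2 * m) * c)) * (y ^^ (m - 2 * c) * y ^^ (2 * c))); [|ring].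
    rewrite <- !Cpowz_add by auto using m1_neq0. f_equal. f_equal. f_equal.
    pose proof (tri_spec m). pose proof (tri_spec c). pose proof (tri_spec (m - 2 * c)). lia. }
  pose proof (summable_rows (fun p => F (phi p)) SF) as SRow. cbv beta in SRow.
  rewrite csum_mod3 by auto.
  rewrite (csum_ext (fun n => csum (fun j => F (phi ((3 * n)%Z, j)))) (fun n => pinf (q ^ 2) (q ^ 2) * (q ^^ (3 * tri (0 - n) + 2 * (0 - n)) * y ^^ (- 3 * (0 - n))))).
  2:{ intros n. rewrite Hrow, quintuple_row.
      destruct (Z.eqb_spec ((3 * n) mod 3) 2); [lia|]. replace (3 * n / 3)%Z with n by lia.
      rewrite (sgn_eq n (3 * n) n) by lia.
      replace (- 3 * (0 - n))%Z with (3 * n)%Z by ring.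
      transitivity ((-1) ^^ n * (-1) ^^ n * (q ^^ tri (3 * n) * q ^^ (n * (n + 1) - 3 * n * (2 * n) + 2 * n * n)) * y ^^ (3 * n) * pinf (q ^ 2) (q ^ 2)); [ring|].
      rewrite sgn_sq, <- Cpowz_add by auto.
      replace (tri (3 * n) + (n * (n + 1) - 3 * n * (2 * n) + 2 * n * n))%Z with (3 * tri (0 - n) + 2 * (0 - n))%Z by tri. ring. }
  rewrite (csum_ext (fun n => csum (fun j => F (phi ((3 * n + 1)%Z, j)))) (fun n => - pinf (q ^ 2) (q ^ 2) * (q ^^ (3 * tri n + 2 * n) * y ^^ (3 * n + 1)))).
  2:{ intros n. rewrite Hrow, quintuple_row.
      destruct (Z.eqb_spec ((3 * n + 1) mod 3) 2); [lia|]. replace ((3 * n + 1) / 3)%Z with n by lia.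
      rewrite (sgn_neg n (3 * n + 1) n) by lia.
      transitivity (- ((-1) ^^ n * (-1) ^^ n) * (q ^^ tri (3 * n + 1) * q ^^ (n * (n + 1) - (3 * n + 1) * (2 * n) + 2 * n * n)) * y ^^ (3 * n + 1) * pinf (q ^ 2) (q ^ 2)); [ring|].
      rewrite sgn_sq, <- Cpowz_add by auto.
      replace (tri (3 * n + 1) + (n * (n + 1) - (3 * n + 1) * (2 * n) + 2 * n * n))%Z with (3 * tri n + 2 * n)%Z by tri. ring. }
  rewrite (csum_ext (fun n => csum (fun j => F (phi ((3 * n + 2)%Z, j)))) (fun _ => 0)).
  2:{ intros n. rewrite Hrow, quintuple_row. destruct (Z.eqb_spec ((3 * n + 2) mod 3) 2); [ring|lia]. }
  rewrite csum_zero.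
  pose proof (summable_reflect 0 _ S4) as S4'. cbv beta in S4'.
  rewrite !csum_scal by auto.
  rewrite (csum_reflect 0 (fun n => q ^^ (3 * tri n + 2 * n) * y ^^ (- 3 * n))) by auto.
  rewrite (csum_ext (fun n => q ^^ (3 * tri n + 2 * n) * (y ^^ (- 3 * n) - y ^^ (3 * n + 1)))
     (fun n => q ^^ (3 * tri n + 2 * n) * y ^^ (- 3 * n) - q ^^ (3 * tri n + 2 * n) * y ^^ (3 * n + 1))) by (intros; ring).
  rewrite csum_minus by auto. ring.
Qed.

Lemma jtheta_inv (x : C) : x <> 0 -> jtheta (q / x) q = jtheta x q.
Proof.
  intros Hx. assert (Hx' : q / x <> 0) by (apply Cmult_neq_0; auto; apply Cinv_nz; auto).
  rewrite !jtheta_csum by auto. rewrite <- (csum_reflect 0 (theta_term q x)) by (apply summable_theta; auto).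
  apply csum_ext. intros n. unfold theta_term.
  rewrite (sgn_eq (- n) (0 - n) n) by lia. unfold Cdiv.
  rewrite Cpowz_mult_base by (auto; apply Cinv_nz; auto).
  replace ((/ x) ^^ n) with (x ^^ (0 - n)).
  - rewrite (Cpowz_split q (tri (0 - n)) (tri n) n) by (auto; tri). ring.
  - rewrite <- (Cpowz_m1 x), <- Cpowz_mul by auto. f_equal; ring.
Qed.

Lemma lp_split r a : lp q r a = csum (fun i => lw q r i * q ^^ (a * (- 8 * i - r)))
   - csum (fun i => lw q r i * q ^^ (a * (8 * i + r + 1))).
Proof. unfold lp. rewrite lf_split by auto using good_pow. reflexivity. Qed.

Lemma summable_lp1 r a : summable (fun i => lw q r i * q ^^ (a * (- 8 * i - r))).
Proof. apply (summable_lf1 q Hq Hq1 r (fun e => q ^^ (a * e))). apply good_pow; auto. Qed.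

Lemma summable_lp2 r a : summable (fun i => lw q r i * q ^^ (a * (8 * i + r + 1))).
Proof. apply (summable_lf2 q Hq Hq1 r (fun e => q ^^ (a * e))). apply good_pow; auto. Qed.

End ThetaIdentities.

(** * Products for the numerator at q and q^2, and the closed form of the coefficient *)

Section SpecialValues.

Variable q : C.
Hypothesis Hq : q <> 0.
Hypothesis Hq1 : (Cmod q < 1)%R.

(** Base q^16 and y = q^s; the choices s = 2 r + 1 and s = 7 - 2 r produce the numerator at q and at
    q^2. *)
Lemma quintuple_16 s :
  J 32 q * (csum (fun n => q ^^ (24 * n * n + 8 * n - 3 * n * s)) - csum (fun n => q ^^ (24 * n * n + 8 * n + (3 * n + 1) * s)))
  = jtheta (q ^^ s) (q ^ 16) * jtheta (q ^^ (2 * s + 16)) (q ^ 32).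
Proof.
  destruct (qpow_facts q Hq Hq1 16 ltac:(lia)) as [H16 H161].
  assert (Hy : q ^^ s <> 0) by (apply Cpowz_neq0; auto).
  destruct (quintuple_product (q ^ 16) H16 H161 _ Hy) as [_ E].
  replace (q ^ 16 * (q ^^ s) ^ 2) with (q ^^ (2 * s + 16)) in E.
  2:{ change ((q ^^ s) ^ 2) with ((q ^^ s) ^^ 2). change (q ^ 16) with (q ^^ 16).
      rewrite <- Cpowz_mul, <- Cpowz_add by auto. f_equal; ring. }
  rewrite <- !Cpow_mult_r in E. change (16 * 2)%nat with 32%nat in E.
  rewrite E, J_pinf. f_equal.
  assert (Hs : forall c, summable (fun n => q ^^ (24 * n * n + 8 * n + c * n))).
  { intros c. apply summable_ext with (fun n => (-1) ^^ n * ((-1) ^^ n * q ^^ (24 * n * n + (8 + c) * n))).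
    - intros n. rewrite Cmult_assoc, sgn_sq, Cmult_1_l. f_equal; ring.
    - apply summable_bounded with 1%R; [intros; rewrite Cmod_sgn; lra|].
      apply summable_quadratic; auto. lia. }
  rewrite <- csum_minus.
  - apply csum_ext. intros n. change (q ^ 16) with (q ^^ 16).
    rewrite <- !Cpowz_mul by auto.
    replace (16 * (3 * tri n + 2 * n))%Z with (24 * n * n + 8 * n)%Z by tri.
    rewrite (Cpowz_split q (24 * n * n + 8 * n - 3 * n * s) (24 * n * n + 8 * n) (s * (- 3 * n))) by (auto; ring).
    rewrite (Cpowz_split q (24 * n * n + 8 * n + (3 * n + 1) * s) (24 * n * n + 8 * n) (s * (3 * n + 1))) by (auto; ring).
    ring.
  - apply summable_ext with (2 := Hs (- 3 * s)%Z). intros n. f_equal; ring.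
  - apply summable_ext with (2 := summable_scal (q ^^ s) _ (Hs (3 * s)%Z)). intros n.
    rewrite <- Cpowz_add by auto. f_equal; ring.
Qed.

Lemma lp_1_product r : q ^^ r * lp q r 1 * J 32 q
  = jtheta (q ^^ (2 * r + 1)) (q ^ 16) * jtheta (q ^^ (4 * r + 18)) (q ^ 32).
Proof.
  replace (4 * r + 18)%Z with (2 * (2 * r + 1) + 16)%Z by ring. rewrite <- quintuple_16.
  rewrite lp_split by auto.
  rewrite <- (csum_reflect 0 (fun i => lw q r i * q ^^ (1 * (- 8 * i - r)))) by (apply summable_lp1; auto).
  transitivity (J 32 q * (q ^^ r * csum (fun n => lw q r (0 - n) * q ^^ (1 * (- 8 * (0 - n) - r)))
    - q ^^ r * csum (fun i => lw q r i * q ^^ (1 * (8 * i + r + 1))))); [ring|].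
  rewrite <- !csum_scal; [| apply summable_lp2; auto |
    apply (summable_reflect 0 (fun i => lw q r i * q ^^ (1 * (- 8 * i - r)))), summable_lp1; auto].
  f_equal. f_equal; apply csum_ext; intros n; unfold lw; rewrite <- !Cpowz_add by auto; f_equal; ring.
Qed.

Lemma lp_2_product r : q ^^ (2 * r) * lp q r 2 * J 32 q
  = jtheta (q ^^ (7 - 2 * r)) (q ^ 16) * jtheta (q ^^ (30 - 4 * r)) (q ^ 32).
Proof.
  replace (30 - 4 * r)%Z with (2 * (7 - 2 * r) + 16)%Z by ring. rewrite <- quintuple_16.
  rewrite lp_split by auto.
  rewrite <- (csum_reflect (-1) (fun i => lw q r i * q ^^ (2 * (8 * i + r + 1)))) by (apply summable_lp2; auto).
  transitivity (J 32 q * (q ^^ (2 * r) * csum (fun n => lw q r n * q ^^ (2 * (- 8 * n - r)))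
    - q ^^ (2 * r) * csum (fun n => lw q r (-1 - n) * q ^^ (2 * (8 * (-1 - n) + r + 1))))); [ring|].
  rewrite <- !csum_scal; [| apply (summable_reflect (-1) (fun i => lw q r i * q ^^ (2 * (8 * i + r + 1)))), summable_lp2; auto
    | apply summable_lp1; auto].
  f_equal. f_equal; apply csum_ext; intros n; unfold lw; rewrite <- !Cpowz_add by auto; f_equal; ring.
Qed.

Lemma f3_sum_eq : f3_sum q = f3 (q ^ 4) * pinf (q ^ 4) (q ^ 4) / 2.
Proof.
  destruct (qpow_facts q Hq Hq1 4 ltac:(lia)) as [H4 H41].
  rewrite f3_appell by auto. unfold f3_sum.
  rewrite (csum_ext _ (fun r => (-1) ^^ r * (q ^ 4) ^^ (3 * tri r + 2 * r) * / (1 + (q ^ 4) ^^ r))).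
  - field. 
  - intros r. change (q ^ 4) with (q ^^ 4). rewrite <- !Cpowz_mul by auto.
    replace (4 * (3 * tri r + 2 * r))%Z with (12 * tri r + 8 * r)%Z by ring. reflexivity.
Qed.

(** With y = -q^2 the exponent 6 tri r + 6 r is even and contributes no sign, while the odd exponent
    2 r + 1 turns 1 - y^(2 r + 1) into 1 + q^(4 r + 2). *)
Lemma omega3_sum_eq : omega3_sum q = q ^ 3 * omega3 (- q ^ 2) * pinf (q ^ 4) (q ^ 4).
Proof.
  destruct (qpow_facts q Hq Hq1 4 ltac:(lia)) as [H4 H41]. destruct (qpow_facts q Hq Hq1 2 ltac:(lia)) as [H2 H21].
  assert (Hy : - q ^ 2 <> 0) by (intros H; apply H2; replace (q ^ 2) with (- - q ^ 2) by ring; rewrite H; ring).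
  assert (Hy1 : (Cmod (- q ^ 2) < 1)%R) by (rewrite Cmod_opp; auto).
  replace (q ^ 4) with ((- q ^ 2) ^ 2) in * by (simpl; ring).
  rewrite <- Cmult_assoc, omega3_appell by auto.
  assert (E : forall k, (- q ^ 2) ^^ k = (-1) ^^ k * q ^^ (2 * k)).
  { intros k. replace (- q ^ 2) with (-1 * q ^ 2) by ring.
    rewrite Cpowz_mult_base by (auto using m1_neq0). change (q ^ 2) with (q ^^ 2). rewrite <- Cpowz_mul by auto. reflexivity. }
  assert (Ht : forall r, (-1) ^^ r * q ^^ (12 * tri r + 12 * r + 3) * / (1 + q ^^ (4 * r + 2))
     = q ^ 3 * ((-1) ^^ r * (- q ^ 2) ^^ (6 * tri r + 6 * r) * / (1 - (- q ^ 2) ^^ (2 * r + 1)))).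
  { intros r. rewrite !E.
    rewrite (sgn_eq (3 * tri r + 3 * r) (6 * tri r + 6 * r) 0), (sgn_neg r (2 * r + 1) 0) by lia.
    rewrite (Cpowz_split q (12 * tri r + 12 * r + 3) 3 (2 * (6 * tri r + 6 * r))) by (auto; ring).
    replace (2 * (2 * r + 1))%Z with (4 * r + 2)%Z by ring. simpl (_ ^^ 0).
    change (q ^^ 3) with (q ^ 3).
    replace (1 - - (1) * q ^^ (4 * r + 2)) with (1 + q ^^ (4 * r + 2)) by ring. ring. }
  unfold omega3_sum. rewrite (csum_ext _ _ Ht), csum_scal; [reflexivity|].
  apply summable_ext with (fun r => / q ^ 3 * ((-1) ^^ r * q ^^ (12 * tri r + 12 * r + 3) * / (1 + q ^^ (4 * r + 2)))).
  - intros r. rewrite Ht, Cmult_assoc, Cinv_l, Cmult_1_l by (apply Cpow_nz; auto). reflexivity.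
  - apply summable_scal, summable_omega3_appell; auto.
Qed.

(** The terms [- lp r 1 + q * lp r 2] of [hecke_1] supply the constants 1 in 1 - f_3 / 2 and in 1 -
    q^2 omega_3. *)
Lemma hecke_1_formula r : pinf (q ^ 4) (q ^ 4) * hecke q (3 - r) 1
  = q ^^ (3 * r - 3) * ((-1) ^^ ((r + 1) / 2) / 2 * phi_const q * lp q r 1
     - lp q r 1 * pinf (q ^ 4) (q ^ 4) * (1 - 1 / 2 * f3 (q ^ 4))
     + q * lp q r 2 * pinf (q ^ 4) (q ^ 4) * (1 - q ^ 2 * omega3 (- q ^ 2))).
Proof.
  destruct (qpow_facts q Hq Hq1 2 ltac:(lia)) as [H2 H21].
  pose proof (hecke_0 q Hq Hq1 r) as H0.
  replace (csum (fun k : Z => (-1) ^^ k * q ^^ (6 * k * k + 2 * k))) with (pinf (q ^ 4) (q ^ 4)) in H0.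
  2:{ replace (q ^ 4) with ((q ^ 2) ^ 2) by (simpl; ring). rewrite <- (pentagonal (q ^ 2)) by auto.
      apply csum_ext. intros k. change (q ^ 2) with (q ^^ 2). rewrite <- Cpowz_mul by auto. f_equal; f_equal; ring. }
  rewrite f3_sum_eq, omega3_sum_eq in H0.
  rewrite hecke_1 by auto.
  transitivity (q ^^ (3 * r - 3) * (pinf (q ^ 4) (q ^ 4) * hecke q r 0 - pinf (q ^ 4) (q ^ 4) * lp q r 1 + q * pinf (q ^ 4) (q ^ 4) * lp q r 2)); [ring|].
  rewrite H0. field; apply C2_neq0.
Qed.

End SpecialValues.

(** * Laurent coefficients of the character *)

Lemma Cexp_plus x y : Cexp (x + y) = Cexp x * Cexp y.
Proof.
  destruct x, y. unfold Cexp. apply injective_projections; simpl; rewrite exp_plus, ?cos_plus, ?sin_plus; ring.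
Qed.

Lemma Cexp_0 : Cexp 0 = 1.
Proof. unfold Cexp. apply injective_projections; simpl; rewrite exp_0, ?cos_0, ?sin_0; ring. Qed.

Lemma Cmod_Cexp x : Cmod (Cexp x) = exp (Re x).
Proof.
  unfold Cexp, Cmod; simpl.
  transitivity (sqrt (Rsqr (exp (Re x)))); [f_equal | apply sqrt_Rsqr; left; apply exp_pos].
  pose proof (sin2_cos2 (Im x)) as H. unfold Rsqr in *.
  transitivity (exp (Re x) * exp (Re x) * (sin (Im x) * sin (Im x) + cos (Im x) * cos (Im x)))%R; [ring|].
  rewrite H. ring.
Qed.

Lemma epow_add t a b : epow t (a + b) = epow t a * epow t b.
Proof. unfold epow. rewrite <- Cexp_plus. f_equal. rewrite RtoC_plus. ring. Qed.

Lemma epow_split t c a b : c = (a + b)%R -> epow t c = epow t a * epow t b.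
Proof. intros ->. apply epow_add. Qed.

Lemma epow_plus_base t s a : epow (t + s) a = epow t a * epow s a.
Proof. unfold epow. rewrite <- Cexp_plus. f_equal. ring. Qed.

Lemma epow_scale s t a : epow (RtoC s * t) a = epow t (s * a).
Proof. unfold epow. f_equal. rewrite RtoC_mult. ring. Qed.

Lemma epow_0 t : epow t 0 = 1.
Proof. unfold epow. replace (2 * PI * Ci * 0 * t) with (0 : C) by ring. apply Cexp_0. Qed.

Lemma Cmod_epow t a : Cmod (epow t a) = exp (- (2 * PI * a * Im t)).
Proof.
  unfold epow. rewrite Cmod_Cexp. f_equal. destruct t as [x y]. simpl. ring.
Qed.

Lemma epow_neq0 t a : epow t a <> 0.
Proof.
  intros H. apply (f_equal Cmod) in H. rewrite Cmod_epow, Cmod_0 in H.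
  pose proof (exp_pos (- (2 * PI * a * Im t))). lra.
Qed.

Lemma epow_IZR t n : epow t (IZR n) = epow t 1 ^^ n.
Proof.
  assert (H : forall k : nat, epow t (INR k) = epow t 1 ^ k).
  { induction k; [apply epow_0|]. rewrite S_INR, epow_add, IHk. simpl. ring. }
  destruct (Z_le_gt_dec 0 n) as [Hn|Hn].
  - rewrite <- (Z2Nat.id n) by auto. rewrite <- INR_IZR_INZ, H, Cpowz_nat. reflexivity.
  - replace n with (- Z.of_nat (Z.to_nat (- n)))%Z by lia.
    rewrite Cpowz_opp_nat by apply epow_neq0. rewrite <- H, opp_IZR, <- INR_IZR_INZ.
    set (x := INR (Z.to_nat (- n))).
    assert (E : epow t (- x) * epow t x = 1) by (rewrite <- epow_add, <- (epow_0 t); f_equal; ring).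
    transitivity (epow t (- x) * (epow t x * / epow t x)); [rewrite Cinv_r by apply epow_neq0; ring|].
    rewrite Cmult_assoc, E. ring.
Qed.

(** * Uniqueness of Fourier coefficients *)

Lemma csum_lsum {I K} (f : K -> I -> C) (l : list K) : (forall k, summable (f k)) ->
  summable (fun i => lsum (fun k => f k i) l) /\
  csum (fun i => lsum (fun k => f k i) l) = lsum (fun k => csum (f k)) l.
Proof.
  intros Hf. induction l as [|k l [IH1 IH2]]; simpl.
  - split; [apply summable_zero | apply csum_zero].
  - split; [apply summable_plus; auto | rewrite csum_plus, IH2; auto].
Qed.

Definition root_of_unity (M : nat) : C := epow (RtoC (/ INR M)) 1.

Lemma root_of_unity_pow M d : root_of_unity M ^^ d = epow (RtoC (/ INR M)) (IZR d).
Proof. symmetry. apply epow_IZR. Qed.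

Lemma epow_real_int n : epow 1 (IZR n) = 1.
Proof.
  rewrite epow_IZR. replace (epow 1 1) with (RtoC 1); [apply Cpowz_1|].
  unfold epow, Cexp. apply injective_projections; simpl.
  - match goal with |- _ = (exp ?a * cos ?b)%R => replace a with 0%R by ring; replace b with (2 * PI)%R by ring end.
    rewrite exp_0, cos_2PI. ring.
  - match goal with |- _ = (exp ?a * sin ?b)%R => replace b with (2 * PI)%R by ring end.
    rewrite sin_2PI. ring.
Qed.

Lemma root_of_unity_neq1 M d : (0 < M)%nat -> (d <> 0)%Z -> (Z.abs d < Z.of_nat M)%Z ->
  root_of_unity M ^^ d <> 1.
Proof.
  intros HM Hd Hlt H. rewrite root_of_unity_pow in H.
  assert (HM' : (0 < INR M)%R) by (apply lt_0_INR; auto).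
  set (x := (2 * PI * IZR d * / INR M)%R).
  assert (Hc : cos x = 1%R).
  { apply (f_equal Re) in H. unfold epow, Cexp in H. simpl in H.
    match type of H with (exp ?a * cos ?b)%R = _ => replace a with 0%R in H by ring; replace b with x in H by (unfold x; ring) end.
    rewrite exp_0 in H. lra. }
  (* [cos x = 1 - 2 sin^2 (x/2)], and [0 < |x/2| < PI] *)
  assert (Hs : sin (x / 2) = 0%R).
  { replace x with (2 * (x / 2))%R in Hc by field. rewrite cos_2a_sin in Hc. nra. }
  assert (Hb : (Rabs (IZR d) < INR M)%R).
  { rewrite <- abs_IZR, INR_IZR_INZ. apply IZR_lt; auto. }
  assert (Hx : (x / 2 = PI * (IZR d / INR M))%R) by (unfold x; field; lra).
  pose proof PI_RGT_0 as Hpi.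
  assert (Hr : (-1 < IZR d / INR M < 1)%R).
  { apply Rabs_def2 in Hb. split.
    - apply Rmult_lt_reg_r with (INR M); auto. unfold Rdiv. rewrite Rmult_assoc, Rinv_l; lra.
    - apply Rmult_lt_reg_r with (INR M); auto. unfold Rdiv. rewrite Rmult_assoc, Rinv_l; lra. }
  assert (Hd0 : (IZR d / INR M <> 0)%R).
  { intros H0. apply Hd. apply eq_IZR. replace (IZR d) with (IZR d / INR M * INR M)%R by (field; lra).
    rewrite H0. simpl. ring. }
  rewrite Hx in Hs. set (u := (IZR d / INR M)%R) in *.
  destruct (Rlt_dec 0 u) as [Hu|Hu].
  - assert (0 < sin (PI * u))%R by (apply sin_gt_0; nra). lra.
  - assert (sin (PI * u) < 0)%R by (apply sin_lt_0_var; nra). lra.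
Qed.

Definition unity_average (M : nat) (d : Z) : C :=
  / INR M * lsum (fun k => (root_of_unity M ^^ d) ^ k) (seq 0 M).

Lemma root_of_unity_neq0 M : root_of_unity M <> 0.
Proof. apply epow_neq0. Qed.

Lemma unity_average_cv d : cv (fun M => unity_average (S M) d) (if (d =? 0)%Z then 1 else 0).
Proof.
  destruct (Z.eqb_spec d 0) as [->|Hd].
  - apply cv_ext with (fun _ => 1); [|apply cv_const]. intros M. unfold unity_average.
    assert (E : forall n s, lsum (fun k => (root_of_unity (S M) ^^ 0) ^ k) (seq s n) = INR n).
    { induction n; intros s; [reflexivity|]. rewrite S_INR, RtoC_plus. simpl lsum.
      rewrite Cpow_1_l, IHn. ring. }
    rewrite E. field. intros H. apply (f_equal Re) in H. simpl Re in H.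
    apply (not_0_INR (S M)); auto.
  - apply cv_ext_from with (u := fun _ => 0) (N := Z.to_nat (Z.abs d)); [|apply cv_const].
    intros M HM. unfold unity_average. set (x := root_of_unity (S M) ^^ d).
    assert (Hx1 : x <> 1) by (apply root_of_unity_neq1; lia).
    assert (HxM : x ^ (S M) = 1).
    { unfold x. rewrite <- Cpowz_nat, <- Cpowz_mul by apply root_of_unity_neq0.
      rewrite root_of_unity_pow, mult_IZR, <- INR_IZR_INZ.
      rewrite <- (epow_real_int d). replace (RtoC (/ INR (S M))) with (RtoC (/ INR (S M)) * 1) by ring.
      rewrite epow_scale. f_equal. field. apply not_0_INR; auto. }
    assert (E : forall n, (1 - x) * lsum (fun k => x ^ k) (seq 0 n) = 1 - x ^ n).
    { induction n; [simpl; ring|]. rewrite lsum_seq_S, Cmult_plus_distr_l, IHn. simpl. ring. }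
    specialize (E (S M)). rewrite HxM in E.
    assert (H0 : lsum (fun k => x ^ k) (seq 0 (S M)) = 0).
    { assert (Hx : 1 - x <> 0) by (intros H; apply Hx1; replace x with (1 - (1 - x)) by ring; rewrite H; ring).
      transitivity (/ (1 - x) * ((1 - x) * lsum (fun k => x ^ k) (seq 0 (S M)))); [field; auto|].
      rewrite E. ring. }
    rewrite H0. ring.
Qed.

Lemma Cmod_root_of_unity M d : Cmod (root_of_unity M ^^ d) = 1%R.
Proof.
  rewrite root_of_unity_pow, Cmod_epow. simpl (Im _). rewrite Rmult_0_r, Ropp_0. apply exp_0.
Qed.

Lemma unity_average_bound M d : (Cmod (unity_average (S M) d) <= 1)%R.
Proof.
  unfold unity_average. rewrite Cmod_mult.
  assert (HM : (0 < INR (S M))%R) by (apply lt_0_INR; lia).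
  rewrite Cmod_inv.
  2:{ intros H. apply RtoC_inj in H. lra. }
  rewrite Cmod_R, Rabs_right by lra.
  apply Rmult_le_reg_l with (INR (S M)); auto. rewrite <- Rmult_assoc, Rinv_r, Rmult_1_l, Rmult_1_r by lra.
  eapply Rle_trans; [apply lsum_norm|].
  assert (E : forall n s, (rsum (fun k => Cmod ((root_of_unity (S M) ^^ d) ^ k)) (seq s n) = INR n)%R).
  { induction n; intros s; [reflexivity|]. rewrite S_INR. simpl rsum. rewrite Cmod_pow, Cmod_root_of_unity, pow1, IHn. ring. }
  rewrite E. lra.
Qed.

(* Averaging over the [M]-th roots of unity isolates the indices congruent to [m] modulo [M]. *)
Lemma fourier_uniqueness (a : Z -> C) : summable a ->
  (forall t : R, csum (fun n => a n * epow (RtoC t) 1 ^^ n) = 0) -> forall m, a m = 0.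
Proof.
  intros Ha H m.
  assert (Hmod : forall (t : R) n, Cmod (epow (RtoC t) 1 ^^ n) = 1%R).
  { intros t n. rewrite <- epow_IZR, Cmod_epow. simpl (Im _). rewrite Rmult_0_r, Ropp_0. apply exp_0. }
  assert (Hsum : forall M, csum (fun n => a n * unity_average (S M) (n - m)) = 0).
  { intros M.
    set (f := fun (k : nat) (n : Z) => / INR (S M) * (root_of_unity (S M) ^^ (- m)) ^ k * (a n * epow (RtoC (INR k * / INR (S M))) 1 ^^ n)).
    assert (Hf : forall k, summable (f k)).
    { intros k. unfold f. apply summable_scal.
      apply summable_ext with (fun n => epow (RtoC (INR k * / INR (S M))) 1 ^^ n * a n); [intros; ring|].
      apply summable_bounded with 1%R; auto. intros n. rewrite Hmod. lra. }
    destruct (csum_lsum f (seq 0 (S M)) Hf) as [_ E].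
    transitivity (csum (fun n => lsum (fun k => f k n) (seq 0 (S M)))).
    - apply csum_ext. intros n. unfold unity_average, f.
      rewrite Cmult_comm, <- Cmult_assoc, (Cmult_comm _ (a n)), <- !lsum_scal.
      f_equal. apply functional_extensionality. intros k.
      rewrite (Cpowz_split _ (n - m) (- m) n), Cpow_mult_l by (apply root_of_unity_neq0 || ring).
      replace (epow (RtoC (INR k * / INR (S M))) 1 ^^ n) with ((root_of_unity (S M) ^^ n) ^ k); [ring|].
      rewrite <- Cpowz_nat, <- Cpowz_mul by apply root_of_unity_neq0.
      rewrite root_of_unity_pow, <- epow_IZR, mult_IZR, <- INR_IZR_INZ.
      unfold epow. f_equal. rewrite !RtoC_mult. ring.
    - rewrite E. apply lsum_zero. intros k _. unfold f. rewrite csum_scal, H; [ring|].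
      apply summable_ext with (fun n => epow (RtoC (INR k * / INR (S M))) 1 ^^ n * a n); [intros; ring|].
      apply summable_bounded with 1%R; auto. intros n. rewrite Hmod. lra. }
  assert (Hlim : cv (fun M => csum (fun n => a n * unity_average (S M) (n - m)))
     (csum (fun n => a n * (if (n - m =? 0)%Z then 1 else 0)))).
  { apply tannery with (fun n => Cmod (a n)); auto.
    - intros M n. rewrite Cmod_mult. rewrite <- (Rmult_1_r (Cmod (a n))) at 2.
      apply Rmult_le_compat_l; [apply Cmod_ge_0 | apply unity_average_bound].
    - intros n. apply cv_scal, unity_average_cv. }
  rewrite (csum_single _ m) in Hlim.
  - rewrite Z.sub_diag in Hlim. simpl in Hlim. rewrite <- (Cmult_1_r (a m)).
    apply (cv_unique _ _ _ Hlim). apply cv_ext with (fun _ => 0); [auto | apply cv_const].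
  - intros n Hn. destruct (Z.eqb_spec (n - m) 0); [lia | ring].
Qed.

(** The first factor is indexed by an arbitrary type with an exponent map [g], which suits a theta
    series whose exponents are sparse. *)
Lemma csum_cauchy {I} (a : I -> C) (g : I -> Z) (b : Z -> C) (z : C) : z <> 0 ->
  summable (fun i => a i * z ^^ (g i)) -> summable (fun k => b k * z ^^ k) ->
  summable (fun n => csum (fun i => a i * b (n - g i)%Z) * z ^^ n) /\
  csum (fun i => a i * z ^^ (g i)) * csum (fun k => b k * z ^^ k)
  = csum (fun n => csum (fun i => a i * b (n - g i)%Z) * z ^^ n).
Proof.
  intros Hz Ha Hb. pose proof (summable_prod _ _ Ha Hb) as HP.
  set (F := fun p : I * Z => a (fst p) * z ^^ (g (fst p)) * (b (snd p) * z ^^ (snd p))) in *.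
  set (phi := fun p : Z * I => (snd p, fst p - g (snd p))%Z).
  set (psi := fun p : I * Z => (snd p + g (fst p), fst p)%Z).
  assert (H1 : forall p, psi (phi p) = p) by (intros [n i]; unfold psi, phi; cbn [fst snd]; f_equal; lia).
  assert (H2 : forall p, phi (psi p) = p) by (intros [i k]; unfold psi, phi; cbn [fst snd]; f_equal; lia).
  assert (HF : summable (fun p => F (phi p))).
  { apply (summable_inj F phi); auto. intros x y H. rewrite <- (H1 x), <- (H1 y), H. reflexivity. }
  assert (Hrow : forall n, csum (fun i => F (phi (n, i))) = csum (fun i => a i * b (n - g i)%Z) * z ^^ n).
  { intros n. pose proof (summable_row _ n HF) as Hr.
    assert (E : forall i, F (phi (n, i)) = a i * b (n - g i)%Z * z ^^ n).
    { intros i. unfold F, phi; cbn [fst snd]. rewrite (Cpowz_split z n (g i) (n - g i)) by (auto; ring). ring. }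
    assert (Hs : summable (fun i => a i * b (n - g i)%Z)).
    { apply summable_ext with (2 := summable_scal (z ^^ (- n)) _ Hr). intros i. rewrite E.
      rewrite Cpowz_opp by auto. field. apply Cpowz_neq0; auto. }
    rewrite (csum_ext _ _ E), (csum_ext _ (fun i => z ^^ n * (a i * b (n - g i)%Z))) by (intros; ring).
    rewrite csum_scal by auto. ring. }
  pose proof (summable_rows _ HF) as HR. split.
  - apply summable_ext with (2 := HR). intros n. apply Hrow.
  - rewrite <- csum_prod by auto. fold F. rewrite <- (csum_bij F phi psi) by auto.
    rewrite csum_fubini by auto. apply csum_ext, Hrow.
Qed.

Lemma exp_lt_1 x : (x < 0)%R -> (exp x < 1)%R.
Proof. intros H. rewrite <- exp_0. apply exp_increasing; auto. Qed.

(** * From the string functions to the Hecke-type sum *)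

Section Character.

Variable tau : C.
Hypothesis Htau : (0 < Im tau)%R.

Let q := epow tau 1.

Lemma nome_neq0 : q <> 0.
Proof. apply epow_neq0. Qed.

Lemma nome_lt1 : (Cmod q < 1)%R.
Proof.
  unfold q. rewrite Cmod_epow. apply exp_lt_1.
  pose proof (Rmult_lt_0_compat _ _ PI_RGT_0 Htau). lra.
Qed.

Let Hq := nome_neq0.
Let Hq1 := nome_lt1.

Lemma summable_CZSeries_scal (c : C) (f g : Z -> C) : summable f -> (forall i, g i = c * f i) ->
  CZSeries g = c * csum f.
Proof.
  intros Hf Hg. rewrite <- csum_scal by auto.
  rewrite CZSeries_csum by (apply summable_ext with (2 := summable_scal c f Hf); intros; auto).
  apply csum_ext; auto.
Qed.

(** Expanding 24 (i + (2 r + 1)/16)^2 gives the exponent of [lw] and the constant 3 (2 r + 1)^2 /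
    32. The second theta series is reindexed by i -> -i to share this weight; the factor z^(-1/2)
    recurs in the denominator. *)
Lemma theta_numerator r w :
  Theta (2 * r + 1) 8 w (RtoC 3 * tau) - Theta (- (2 * r + 1)) 8 w (RtoC 3 * tau)
  = epow tau (3 * (2 * IZR r + 1) ^ 2 / 32) * epow w (- / 2) * lf q r (fun e => epow w 1 ^^ e).
Proof.
  set (z := epow w 1). assert (Hz : z <> 0) by apply epow_neq0.
  assert (Hgood : good q (fun e => z ^^ e)).
  { destruct (powz_bound q Hq Hq1 z Hz) as [b [Hb0 Hb]]. exists 1%R, b. split; [lra|]. split; auto.
    intros e. rewrite Rmult_1_l. auto. }
  pose proof (summable_lf1 q Hq Hq1 r _ Hgood) as S1. pose proof (summable_lf2 q Hq Hq1 r _ Hgood) as S2.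
  cbv beta in S1, S2.
  rewrite lf_split by auto.
  set (c := epow tau (3 * (2 * IZR r + 1) ^ 2 / 32) * epow w (- / 2)).
  unfold Theta.
  rewrite (summable_CZSeries_scal c _ _ S1).
  - pose proof (summable_reflect 0 _ S2) as S2'. cbv beta in S2'.
    rewrite (summable_CZSeries_scal c _ _ S2').
    + rewrite (csum_reflect 0 (fun i => lw q r i * z ^^ (8 * i + r + 1))) by auto. ring.
    + intros i. unfold lw, c. set (k := (IZR i + IZR (- (2 * r + 1)) / (2 * IZR 8))%R).
      assert (Hk : k = (IZR i - (2 * IZR r + 1) / 16)%R) by (unfold k; rewrite opp_IZR, plus_IZR, mult_IZR; field).
      rewrite epow_scale.
      rewrite (epow_split tau (3 * (IZR 8 * k ^ 2)) (3 * (2 * IZR r + 1) ^ 2 / 32) (IZR (24 * (0 - i) * (0 - i) + 3 * (0 - i) * (2 * r + 1)))).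
      * rewrite (epow_split w (- (IZR 8 * k)) (- / 2) (IZR (8 * (0 - i) + r + 1))).
        -- rewrite (epow_IZR tau), (epow_IZR w). fold q z. ring.
        -- rewrite Hk, !plus_IZR, !mult_IZR, !minus_IZR. field.
      * rewrite Hk, plus_IZR, !mult_IZR, plus_IZR, !mult_IZR, !minus_IZR. field.
  - intros i. unfold lw, c. set (k := (IZR i + IZR (2 * r + 1) / (2 * IZR 8))%R).
    assert (Hk : k = (IZR i + (2 * IZR r + 1) / 16)%R) by (unfold k; rewrite plus_IZR, mult_IZR; field).
    rewrite epow_scale.
    rewrite (epow_split tau (3 * (IZR 8 * k ^ 2)) (3 * (2 * IZR r + 1) ^ 2 / 32) (IZR (24 * i * i + 3 * i * (2 * r + 1)))).
    * rewrite (epow_split w (- (IZR 8 * k)) (- / 2) (IZR (- 8 * i - r))).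
      -- rewrite (epow_IZR tau), (epow_IZR w). fold q z. ring.
      -- rewrite Hk, minus_IZR, mult_IZR. field.
    * rewrite Hk, plus_IZR, !mult_IZR, plus_IZR, !mult_IZR. field.
Qed.

(** The two theta series are the parts of j(z; q) with even index -2 i and with odd index 1 - 2
    i. *)
Lemma theta_denominator w :
  weyl_denominator w tau = epow tau (/ 8) * epow w (- / 2) * jtheta (epow w 1) q.
Proof.
  set (z := epow w 1). assert (Hz : z <> 0) by apply epow_neq0.
  pose proof (summable_theta q Hq Hq1 z Hz) as St.
  assert (S1 : summable (fun i => theta_term q z (- 2 * i))) by (apply (summable_inj _ (fun i => - 2 * i)%Z); auto; intros; lia).
  assert (S2 : summable (fun i => theta_term q z (1 - 2 * i))) by (apply (summable_inj _ (fun i => 1 - 2 * i)%Z); auto; intros; lia).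
  assert (E : csum (theta_term q z) = csum (fun i => theta_term q z (- 2 * i)) + csum (fun i => theta_term q z (1 - 2 * i))).
  { rewrite (csum_split Z.even (theta_term q z) St). f_equal.
    - apply csum_restrict_inj; auto.
      + intros; lia.
      + intros i. rewrite Z.even_mul. reflexivity.
      + intros n H _. apply Z.even_spec in H. destruct H as [k Hk]. exists (- k)%Z. lia.
    - apply (csum_restrict_inj (fun n => negb (Z.even n)) (theta_term q z) (fun i => 1 - 2 * i)%Z); auto.
      + intros; lia.
      + intros i. rewrite Z.even_sub, Z.even_mul. reflexivity.
      + intros n H _. rewrite Z.negb_even in H. apply Z.odd_spec in H. destruct H as [k Hk]. exists (- k)%Z. lia. }
  rewrite jtheta_csum, E by auto.
  set (c := epow tau (/ 8) * epow w (- / 2)).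
  unfold weyl_denominator, Theta.
  rewrite (summable_CZSeries_scal c _ _ S1).
  - rewrite (summable_CZSeries_scal (- c) _ _ S2); [ring|].
    intros i. unfold theta_term, c. rewrite (sgn_neg (- i) (1 - 2 * i) 0) by lia.
    set (k := (IZR i + IZR (-1) / (2 * IZR 2))%R).
    assert (Hk : k = (IZR i - / 4)%R) by (unfold k; field).
    rewrite (epow_split tau (IZR 2 * k ^ 2) (/ 8) (IZR (tri (1 - 2 * i)))).
    + rewrite (epow_split w (- (IZR 2 * k)) (- / 2) (IZR (1 - 2 * i))).
      * rewrite (epow_IZR tau), (epow_IZR w). fold q z. simpl (_ ^^ 0). ring.
      * rewrite Hk, minus_IZR, mult_IZR. field.
    + replace (tri (1 - 2 * i)) with (2 * i * i - i)%Z by tri.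
      rewrite Hk, minus_IZR, !mult_IZR. field.
  - intros i. unfold theta_term, c. rewrite (sgn_eq (- i) (- 2 * i) 0) by lia.
    set (k := (IZR i + IZR 1 / (2 * IZR 2))%R).
    assert (Hk : k = (IZR i + / 4)%R) by (unfold k; field).
    rewrite (epow_split tau (IZR 2 * k ^ 2) (/ 8) (IZR (tri (- 2 * i)))).
    + rewrite (epow_split w (- (IZR 2 * k)) (- / 2) (IZR (- 2 * i))).
      * rewrite (epow_IZR tau), (epow_IZR w). fold q z. simpl (_ ^^ 0). ring.
      * rewrite Hk, mult_IZR. field.
    + replace (tri (- 2 * i)) with (2 * i * i + i)%Z by tri.
      rewrite Hk, plus_IZR, !mult_IZR. field.
Qed.

Lemma annulus_regular (z : C) : (Cmod q < Cmod z < 1)%R -> regular q z.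
Proof.
  intros [H1 H2]. pose proof (proj1 (Cmod_gt_0 q) Hq) as H0. split.
  - intros H. rewrite H, Cmod_0 in H1. lra.
  - intros n H. apply (f_equal Cmod) in H. rewrite Cmod_mult, Cmod_1 in H.
    pose proof (Cmod_ge_0 (q ^^ n)).
    destruct (Z_le_gt_dec 0 n) as [Hn|Hn].
    + pose proof (Cpowz_le q 0 n Hq Hq1 Hn) as Hle. simpl (q ^^ 0) in Hle. rewrite Cmod_1 in Hle. nra.
    + pose proof (Cpowz_le q n (-1) Hq Hq1 ltac:(lia)) as Hle.
      rewrite Cpowz_m1, Cmod_inv in Hle by auto.
      assert (1 < Cmod z * / Cmod q)%R.
      { apply Rmult_lt_reg_r with (Cmod q); auto. rewrite Rmult_assoc, Rinv_l; lra. }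
      pose proof (Cmod_ge_0 z). nra.
Qed.

(** For |z| < 1 the term 1 / (1 - z) expands in nonnegative powers and restores the indicator that
    was removed in [ptr]. *)
Lemma lterm_pt (z : C) : (Cmod q < Cmod z < 1)%R ->
  summable (fun k => pt q k * z ^^ k) /\ csum (lterm q z) = csum (fun k => pt q k * z ^^ k).
Proof.
  intros Hz. pose proof (annulus_regular z Hz) as Hr. pose proof (proj1 Hr) as Hz0.
  pose proof (proj1 (Cmod_gt_0 q) Hq) as H0.
  assert (Ha : (Cmod q < Cmod z < / Cmod q)%R).
  { split; [tauto|]. apply Rlt_trans with 1%R; [tauto|]. rewrite <- Rinv_1. apply Rinv_lt_contravar; lra. }
  pose proof (summable_ptr q Hq Hq1 z Hz0 Ha) as Hp.
  destruct (geometric_series z) as [Hg Eg]; [tauto|].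
  set (h := fun k : Z => if (0 <=? k)%Z then z ^^ k else 0).
  assert (Hh : summable h).
  { apply summable_of_inj with (phi := Z.of_nat).
    - intros; lia.
    - intros k Hk. unfold h in Hk. destruct (Z.leb_spec 0 k); [|tauto]. exists (Z.to_nat k). lia.
    - apply summable_ext with (2 := Hg). intros n. unfold h. destruct (Z.leb_spec 0 (Z.of_nat n)); [|lia].
      rewrite Cpowz_nat. reflexivity. }
  assert (E : forall k, pt q k * z ^^ k = h k + ptr q k * z ^^ k).
  { intros k. unfold h, ptr. destruct (0 <=? k)%Z; ring. }
  split; [apply summable_ext with (2 := summable_plus _ _ Hh Hp); auto|].
  rewrite (csum_ext _ _ E), csum_plus, lterm_expansion by auto. f_equal.
  rewrite <- Eg. rewrite <- (csum_inj h Z.of_nat); auto.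
  - apply csum_ext. intros n. unfold h. destruct (Z.leb_spec 0 (Z.of_nat n)); [|lia]. rewrite Cpowz_nat. reflexivity.
  - intros; lia.
  - intros k Hk. unfold h in Hk. destruct (Z.leb_spec 0 k); [|tauto]. exists (Z.to_nat k). lia.
Qed.

(** Restricted to |q| < |z| < 1, where the partial theta expansion holds and the denominator has no
    zero. One circle in this region determines all Laurent coefficients. *)
Lemma character_expansion r w : (0 < Im w < Im tau)%R ->
  weyl_denominator w tau <> 0 /\
  summable (fun n => hecke q r n * epow w 1 ^^ n) /\
  pinf q q ^ 3 * chi 3 8 (2 * r) w tau
  = epow tau (3 * (2 * IZR r + 1) ^ 2 / 32 - / 8) * csum (fun n => hecke q r n * epow w 1 ^^ n).
Proof.
  intros Hw. set (z := epow w 1).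
  assert (Hz : (Cmod q < Cmod z < 1)%R).
  { unfold z, q. rewrite !Cmod_epow. pose proof PI_RGT_0. split.
    - apply exp_increasing. nra.
    - apply exp_lt_1. nra. }
  pose proof (annulus_regular z Hz) as Hr. pose proof (proj1 Hr) as Hz0.
  destruct (lterm_pt z Hz) as [SV EV].
  pose proof (inv_jtheta q Hq Hq1 z Hr) as EJ.
  pose proof (pinf_q_neq0 q Hq Hq1) as HP.
  assert (Hj : jtheta z q <> 0).
  { intros H. rewrite H in EJ. apply (Cpow_nz (pinf q q) 3 HP). rewrite <- EJ. ring. }
  assert (Hgood : good q (fun e => z ^^ e)).
  { destruct (powz_bound q Hq Hq1 z Hz0) as [b [Hb0 Hb]]. exists 1%R, b. split; [lra|]. split; auto.
    intros e. rewrite Rmult_1_l. auto. }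
  pose proof (summable_lf1 q Hq Hq1 r _ Hgood) as S1. pose proof (summable_lf2 q Hq Hq1 r _ Hgood) as S2.
  cbv beta in S1, S2.
  destruct (csum_cauchy (lw q r) (fun i => - 8 * i - r)%Z (pt q) z Hz0 S1 SV) as [C1 E1].
  destruct (csum_cauchy (lw q r) (fun i => 8 * i + r + 1)%Z (pt q) z Hz0 S2 SV) as [C2 E2].
  assert (EH : forall n, hecke q r n * z ^^ n
     = csum (fun i => lw q r i * pt q (n - (- 8 * i - r))) * z ^^ n
       - csum (fun i => lw q r i * pt q (n - (8 * i + r + 1))) * z ^^ n).
  { intros n. unfold hecke. rewrite lf_split by auto using good_pt. ring. }
  split; [|split].
  - rewrite theta_denominator. fold z. repeat apply Cmult_neq_0; auto using epow_neq0.
  - apply summable_ext with (2 := summable_minus _ _ C1 C2). intros n. rewrite EH. reflexivity.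
  - rewrite (csum_ext _ _ EH), csum_minus, <- E1, <- E2 by auto.
    unfold chi. rewrite theta_denominator, theta_numerator. fold z. rewrite lf_split by auto.
    rewrite <- EJ, EV.
    replace (epow tau (3 * (2 * IZR r + 1) ^ 2 / 32)) with (epow tau (3 * (2 * IZR r + 1) ^ 2 / 32 - / 8) * epow tau (/ 8))
      by (rewrite <- epow_add; f_equal; ring).
    field. repeat split; auto using epow_neq0.
Qed.

Lemma lsum_bounded_terms (a : nat -> C) l : cv (fun n => lsum a (seq 0 n)) l ->
  exists M, (0 < M)%R /\ forall n, (Cmod (a n) <= M)%R.
Proof.
  intros H. destruct (cv_bounded _ _ H) as [M [H0 HM]]. exists (M + M)%R. split; [lra|].
  intros n. replace (a n) with (lsum a (seq 0 (S n)) + - lsum a (seq 0 n)) by (rewrite lsum_seq_S; ring).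
  eapply Rle_trans; [apply Cmod_triangle|]. rewrite Cmod_opp.
  pose proof (HM n). pose proof (HM (S n)). lra.
Qed.

Lemma is_CZseries_csum (f : Z -> C) l : summable f -> is_CZseries f l -> csum f = l.
Proof.
  intros Hf [l1 [l2 [H1 [H2 ->]]]]. rewrite csum_Z_nat by auto. f_equal.
  - apply is_series_cv in H1. apply (cv_unique _ _ _ (csum_cv _ (summable_inj f Z.of_nat (fun x y => Nat2Z.inj x y) Hf)) H1).
  - apply is_series_cv in H2.
    assert (Hi : forall x y : nat, (- Z.of_nat (S x))%Z = (- Z.of_nat (S y))%Z -> x = y) by (intros; lia).
    apply (cv_unique _ _ _ (csum_cv _ (summable_inj f (fun n => (- Z.of_nat (S n))%Z) Hi Hf)) H2).
Qed.

(** The hypothesis yields only convergence of two one-sided series. Their terms are bounded on the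
    circles Im w + Im tau / 4 and Im w - Im tau / 4, and passing to the circle in the middle gains a
    geometric factor, the first for i -> +oo and the second for i -> -oo. *)
Lemma string_functions_summable r (c : Z -> C) (hc : is_string_functions 3 8 (2 * r) tau c) w :
  Im w = (Im tau / 2)%R ->
  let H := fun w i => normalized_string 3 8 (2 * r) tau c (2 * (i + r)) * epow w 1 ^^ (- (i + r)) in
  summable (H w) /\
  csum (H w) = epow tau (/ 8 - 3 * (2 * IZR r + 1) ^ 2 / 32) * chi 3 8 (2 * r) w tau.
Proof.
  intros Hw H.
  (* [kap] is q^(-s) divided by q^(m^2/(4 N)), and it does not depend on m. Hence the normalised
     string functions are the Laurent coefficients of [kap] times the character. *)
  set (kap := epow tau (/ 8 - 3 * (2 * IZR r + 1) ^ 2 / 32)).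
  set (F := fun w i => let m := (2 * i + 2 * r)%Z in
         c m * epow tau (IZR m ^ 2 / (4 * level 3 8)) * epow w (- (IZR m / 2))).
  assert (HF : forall w i, H w i = kap * F w i).
  { intros v i. unfold H, F, normalized_string. cbv zeta.
    replace (2 * (i + r))%Z with (2 * i + 2 * r)%Z by ring. set (m := (2 * i + 2 * r)%Z).
    replace (- (IZR m / 2))%R with (IZR (- (i + r))) by (unfold m; rewrite opp_IZR, !plus_IZR, !mult_IZR; field).
    rewrite (epow_IZR v (- (i + r))).
    rewrite (epow_split tau (- s_exponent 3 8 (2 * r) m) (/ 8 - 3 * (2 * IZR r + 1) ^ 2 / 32) (IZR m ^ 2 / (4 * level 3 8))).
    - fold kap. ring.
    - unfold s_exponent, level. rewrite !mult_IZR. field. }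
  assert (Hk : kap <> 0) by apply epow_neq0.
  assert (Hconv : forall v, (0 < Im v < Im tau)%R -> is_CZseries (F v) (chi 3 8 (2 * r) v tau)).
  { intros v Hv. apply hc.
    - rewrite !Cmod_epow, <- exp_Ropp. pose proof PI_RGT_0. split; apply exp_increasing; nra.
    - apply (character_expansion r v Hv). }
  set (up := (0, (Im tau / 4)%R) : C).
  assert (Hup : forall v i, H (v + up) i = H v i * epow up 1 ^^ (- (i + r))).
  { intros v i. unfold H. rewrite epow_plus_base, Cpowz_mult_base by apply epow_neq0. ring. }
  set (th := Cmod (epow up 1)).
  assert (Hth : (0 < th < 1)%R).
  { unfold th. rewrite Cmod_epow. simpl (Im up). split; [apply exp_pos|].
    apply exp_lt_1. pose proof PI_RGT_0. nra. }
  assert (Hsum : summable (H w)).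
  { destruct (Hconv (w + up)) as [l1 [_ [C1 _]]].
    { change (Im (w + up)) with (Im w + Im tau / 4)%R. lra. }
    destruct (Hconv (w + - up)) as [_ [l2 [_ [C2 _]]]].
    { change (Im (w + - up)) with (Im w + - (Im tau / 4))%R. lra. }
    apply is_series_cv, lsum_bounded_terms in C1. apply is_series_cv, lsum_bounded_terms in C2.
    destruct C1 as [M1 [P1 B1]]. destruct C2 as [M2 [P2 B2]].
    assert (Hu0 : epow up 1 <> 0) by apply epow_neq0.
    assert (Hpow : forall n : nat, Cmod (epow up 1 ^^ (Z.of_nat n)) = (th ^ n)%R).
    { intros n. rewrite Cpowz_nat, Cmod_pow. reflexivity. }
    apply rsummable_Z.
    - intros; apply Cmod_ge_0.
    - apply rsummable_le with (fun n => (Cmod kap * M1 * Cmod (epow up 1 ^^ r)) * th ^ n)%R.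
      + intros n. specialize (B1 n). rewrite <- Hpow.
        replace (H w (Z.of_nat n)) with (H (w + up) (Z.of_nat n) * (epow up 1 ^^ r * epow up 1 ^^ (Z.of_nat n))).
        * rewrite HF, !Cmod_mult.
          replace (Cmod kap * M1 * Cmod (epow up 1 ^^ r) * Cmod (epow up 1 ^^ Z.of_nat n))%R
            with (Cmod kap * M1 * (Cmod (epow up 1 ^^ r) * Cmod (epow up 1 ^^ Z.of_nat n)))%R by ring.
          apply Rmult_le_compat_r; [apply Rmult_le_pos; apply Cmod_ge_0|].
          apply Rmult_le_compat_l; [apply Cmod_ge_0 | exact B1].
        * rewrite Hup, <- Cpowz_add, Cpowz_opp by auto. replace (r + Z.of_nat n)%Z with (Z.of_nat n + r)%Z by ring.
          field. apply Cpowz_neq0; auto.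
      + apply rsummable_scal; [|apply rsummable_geom; lra].
        repeat apply Rmult_le_pos; auto using Cmod_ge_0; lra.
    (* The negative half of the hypothesis starts at index -1, whereas [rsummable_Z] includes 0 in
       both halves; the term [H w 0] fills the gap. *)
    - apply rsummable_le with (fun n => (Cmod (H w 0%Z) + Cmod kap * M2 * Cmod (epow up 1 ^^ (- r)) * / th) * th ^ n)%R.
      + intros [|n].
        * change (- Z.of_nat 0)%Z with 0%Z. rewrite pow_O.
          assert (0 <= Cmod kap * M2 * Cmod (epow up 1 ^^ (- r)) * / th)%R.
          { repeat apply Rmult_le_pos; auto using Cmod_ge_0; [lra | left; apply Rinv_0_lt_compat; lra]. }
          lra.
        * specialize (B2 n).
          replace (H w (- Z.of_nat (S n))%Z) with (H (w + - up) (- Z.of_nat (S n))%Z * (epow up 1 ^^ (- r) * epow up 1 ^^ (Z.of_nat (S n)))).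
          -- rewrite HF, !Cmod_mult, Hpow.
             apply Rle_trans with (Cmod kap * M2 * Cmod (epow up 1 ^^ (- r)) * / th * (th ^ S n))%R.
             ++ apply Rle_trans with (Cmod kap * M2 * (Cmod (epow up 1 ^^ (- r)) * th ^ S n))%R.
                ** apply Rmult_le_compat_r; [apply Rmult_le_pos; [apply Cmod_ge_0 | apply pow_le; lra]|].
                   apply Rmult_le_compat_l; [apply Cmod_ge_0 | exact B2].
                ** replace (Cmod kap * M2 * (Cmod (epow up 1 ^^ (- r)) * th ^ S n))%R
                     with (Cmod kap * M2 * Cmod (epow up 1 ^^ (- r)) * th ^ S n)%R by ring.
                   apply Rmult_le_compat_r; [apply pow_le; lra|].
                   assert (0 <= Cmod kap * M2 * Cmod (epow up 1 ^^ (- r)))%R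
                     by (repeat apply Rmult_le_pos; auto using Cmod_ge_0; lra).
                   assert (1 <= / th)%R by (rewrite <- Rinv_1; apply Rinv_le_contravar; lra). nra.
             ++ apply Rmult_le_compat_r; [apply pow_le; lra|]. pose proof (Cmod_ge_0 (H w 0%Z)). lra.
          -- replace w with (w + - up + up) at 2 by ring. rewrite (Hup (w + - up)), <- Cpowz_add by auto.
             f_equal. f_equal. ring.
      + apply rsummable_scal; [|apply rsummable_geom; lra].
        apply Rplus_le_le_0_compat; [apply Cmod_ge_0|].
        repeat apply Rmult_le_pos; auto using Cmod_ge_0; [lra | left; apply Rinv_0_lt_compat; lra]. }
  split; auto.
  assert (HsF : summable (F w)).
  { apply summable_ext with (2 := summable_scal (/ kap) _ Hsum). intros i. rewrite HF. field. auto. }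
  rewrite (csum_ext _ _ (HF w)), csum_scal by auto. f_equal.
  apply is_CZseries_csum; auto. apply Hconv. lra.
Qed.

(** Both sides are Laurent coefficients of the same multiple of the character on the circle Im w =
    Im tau / 2, so [fourier_uniqueness] identifies them. The index m = 2 belongs to z^(-1), and
    [hecke_sym] replaces -1 by 1. *)
Lemma normalized_string_hecke r (c : Z -> C) (hc : is_string_functions 3 8 (2 * r) tau c) :
  pinf q q ^ 3 * normalized_string 3 8 (2 * r) tau c 2 = hecke q r 1.
Proof.
  set (b := fun n => normalized_string 3 8 (2 * r) tau c (2 * n)).
  set (w0 := (0, (Im tau / 2)%R) : C). set (z0 := epow w0 1).
  assert (Hz0 : z0 <> 0) by apply epow_neq0.
  set (a := fun n => (pinf q q ^ 3 * b (- n)%Z - hecke q r n) * z0 ^^ n).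
  assert (HW : forall t : R, summable (fun n => b (- n)%Z * (epow (w0 + t) 1) ^^ n) /\
     csum (fun n => b (- n)%Z * (epow (w0 + t) 1) ^^ n)
      = epow tau (/ 8 - 3 * (2 * IZR r + 1) ^ 2 / 32) * chi 3 8 (2 * r) (w0 + t) tau).
  { intros t. destruct (string_functions_summable r c hc (w0 + t)) as [S1 E1].
    { change (Im (w0 + t)) with (Im tau / 2 + 0)%R. ring. }
    cbv zeta in S1, E1.
    pose proof (summable_reflect (- r) _ S1) as S2. cbv beta in S2.
    split.
    - apply summable_ext with (2 := S2). intros n. unfold b. replace (- r - n + r)%Z with (- n)%Z by ring.
      rewrite Z.opp_involutive. reflexivity.
    - rewrite <- E1, <- (csum_reflect (- r) _ S1). apply csum_ext. intros n. unfold b.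
      replace (- r - n + r)%Z with (- n)%Z by ring. rewrite Z.opp_involutive. reflexivity. }
  assert (HX : forall t : R, (0 < Im (w0 + t) < Im tau)%R) by (intros t; change (Im (w0 + t)) with (Im tau / 2 + 0)%R; lra).
  assert (Hterm : forall (t : R) n, a n * epow t 1 ^^ n
     = pinf q q ^ 3 * (b (- n)%Z * (epow (w0 + t) 1) ^^ n) - hecke q r n * (epow (w0 + t) 1) ^^ n).
  { intros t n. unfold a. rewrite epow_plus_base, Cpowz_mult_base by apply epow_neq0. fold z0. ring. }
  assert (Hsum : forall t : R, summable (fun n => a n * epow t 1 ^^ n)).
  { intros t. destruct (HW t) as [S1 _]. destruct (character_expansion r (w0 + t) (HX t)) as [_ [S2 _]].
    apply summable_ext with (2 := summable_minus _ _ (summable_scal (pinf q q ^ 3) _ S1) S2).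
    intros n. rewrite Hterm. reflexivity. }
  assert (Ha : summable a).
  { apply summable_ext with (2 := Hsum 0%R). intros n. unfold epow at 1.
    replace (2 * PI * Ci * 1 * 0) with (0 : C) by ring. rewrite Cexp_0, Cpowz_1. ring. }
  assert (H0 : forall n, a n = 0).
  { apply fourier_uniqueness; auto. intros t.
    destruct (HW t) as [S1 E1]. destruct (character_expansion r (w0 + t) (HX t)) as [_ [S2 E2]].
    rewrite (csum_ext _ _ (Hterm t)), csum_minus, csum_scal, E1 by auto using summable_scal.
    transitivity (epow tau (/ 8 - 3 * (2 * IZR r + 1) ^ 2 / 32) * (pinf q q ^ 3 * chi 3 8 (2 * r) (w0 + t) tau)
       - csum (fun n => hecke q r n * epow (w0 + t) 1 ^^ n)); [ring|].
    rewrite E2, Cmult_assoc, <- epow_add.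
    replace (/ 8 - 3 * (2 * IZR r + 1) ^ 2 / 32 + (3 * (2 * IZR r + 1) ^ 2 / 32 - / 8))%R with 0%R by ring.
    rewrite epow_0. ring. }
  specialize (H0 (-1)%Z). unfold a in H0.
  assert (H1 : pinf q q ^ 3 * b (- -1)%Z - hecke q r (-1) = 0).
  { transitivity ((pinf q q ^ 3 * b (- -1)%Z - hecke q r (-1)) * z0 ^^ (-1) * z0 ^^ 1).
    - rewrite <- Cmult_assoc, <- Cpowz_add by auto. simpl (-1 + 1)%Z. simpl (z0 ^^ 0). ring.
    - rewrite H0. ring. }
  rewrite <- (hecke_sym q Hq Hq1 r 1). change (- (1))%Z with (-1)%Z.
  change (normalized_string 3 8 (2 * r) tau c 2) with (b (- -1)%Z).
  replace (hecke q r (-1)) with (pinf q q ^ 3 * b (- -1)%Z - (pinf q q ^ 3 * b (- -1)%Z - hecke q r (-1))) by ring.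
  rewrite H1. ring.
Qed.

End Character.

Theorem theorem2p8 (tau : C) (htau : (0 < Im tau)%R) (r : Z) (hr : (0 <= r <= 3)%Z)
    (c : Z -> C) (hc : is_string_functions 3 8 (2 * r) tau c) :
  let q := epow tau 1 in
  qinf q ^ 3 * normalized_string 3 8 (2 * r) tau c 2
  = (-1) ^^ ((r + 1) / 2) * (q ^^ (3 - 2 * r) / 2)
      * (J 1 q ^ 2 * J 2 q / (J 4 q ^ 2 * J 32 q))
      * jtheta (q ^^ (2 + 4 * r)) (q ^ 32) * jtheta (q ^^ (7 - 2 * r)) (q ^ 16)
    - q ^^ (3 - 2 * r)
      * (jtheta (q ^^ (7 - 2 * r)) (q ^ 16) * jtheta (q ^^ (30 - 4 * r)) (q ^ 32)
         / J 32 q)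
      * (1 - 1 / 2 * f3 (q ^ 4))
    + q ^^ (1 - r)
      * (jtheta (q ^^ (1 + 2 * r)) (q ^ 16) * jtheta (q ^^ (18 + 4 * r)) (q ^ 32)
         / J 32 q)
      * (1 - q ^ 2 * omega3 (- q ^ 2)).
Proof.
  intros q.
  pose proof (nome_neq0 tau) as Hq. pose proof (nome_lt1 tau htau) as Hq1. fold q in Hq, Hq1.
  destruct (qpow_facts q Hq Hq1 4 ltac:(lia)) as [H4 H41].
  destruct (qpow_facts q Hq Hq1 32 ltac:(lia)) as [H32 H321].
  pose proof (pinf_q_neq0 _ H4 H41) as P4. pose proof (pinf_q_neq0 _ H32 H321) as P32.
  rewrite qinf_pinf. unfold q at 1 2. rewrite normalized_string_hecke by auto. fold q.
  (* The string function is the coefficient at 1 for spin [2 r], so the formula is used with [3 - r]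
     in place of [r]. *)
  pose proof (hecke_1_formula q Hq Hq1 (3 - r)) as E.
  replace (3 - (3 - r))%Z with r in E by ring.
  pose proof (lp_1_product q Hq Hq1 (3 - r)) as X. pose proof (lp_2_product q Hq Hq1 (3 - r)) as Y.
  replace (2 * (3 - r) + 1)%Z with (7 - 2 * r)%Z in X by ring.
  replace (4 * (3 - r) + 18)%Z with (30 - 4 * r)%Z in X by ring.
  replace (7 - 2 * (3 - r))%Z with (1 + 2 * r)%Z in Y by ring.
  replace (30 - 4 * (3 - r))%Z with (18 + 4 * r)%Z in Y by ring.
  (* By j(x; q) = j(q/x; q), the theta product in the first term of the statement is also the one of
     [lp_1_product]. *)
  replace (jtheta (q ^^ (2 + 4 * r)) (q ^ 32)) with (jtheta (q ^^ (30 - 4 * r)) (q ^ 32)).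
  2:{ rewrite <- (jtheta_inv (q ^ 32) H32 H321 (q ^^ (2 + 4 * r))) by (apply Cpowz_neq0; auto).
      f_equal. unfold Cdiv. rewrite <- Cpowz_opp by auto. change (q ^ 32) with (q ^^ 32).
      rewrite <- Cpowz_add by auto. f_equal. ring. }
  rewrite <- (Cmult_assoc _ (jtheta (q ^^ (30 - 4 * r)) _)), (Cmult_comm (jtheta (q ^^ (30 - 4 * r)) _)).
  rewrite <- X, <- Y, !J_pinf. rewrite !Cpow_1_r. unfold phi_const in E.
  (* The floors of (4 - r)/2 and (r + 1)/2 add up to 2, hence have the same parity. *)
  rewrite (sgn_eq (1 - (r + 1) / 2) ((3 - r + 1) / 2) ((r + 1) / 2)) in E by lia.
  transitivity (/ pinf (q ^ 4) (q ^ 4) * (pinf (q ^ 4) (q ^ 4) * hecke q r 1)); [field; auto|].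
  rewrite E. rewrite J_pinf in X, Y.
  replace (q ^^ (3 * (3 - r) - 3)) with (q ^^ (3 - 2 * r) * q ^^ (3 - r)) by (rewrite <- Cpowz_add by auto; f_equal; ring).
  assert (E2 : q ^^ (3 - 2 * r) * q ^^ (3 - r) * q = q ^^ (1 - r) * q ^^ (2 * (3 - r))).
  { rewrite <- !Cpowz_add, <- Cpowz_S by auto. f_equal. ring. }
  set (A := lp q (3 - r) 1) in *. set (B := lp q (3 - r) 2) in *.
  set (p1 := pinf q q) in *. set (p2 := pinf (q ^ 2) (q ^ 2)) in *. set (p4 := pinf (q ^ 4) (q ^ 4)) in *.
  set (p32 := pinf (q ^ 32) (q ^ 32)) in *.
  transitivity (q ^^ (3 - 2 * r) * q ^^ (3 - r) * ((-1) ^^ ((r + 1) / 2) / 2 * (p1 ^ 2 * p2 / p4) * A / p4 - A * (1 - 1 / 2 * f3 (q ^ 4)))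
     + (q ^^ (3 - 2 * r) * q ^^ (3 - r) * q) * B * (1 - q ^ 2 * omega3 (- q ^ 2))).
  - field. repeat split; auto using C2_neq0.
  - rewrite E2. field. repeat split; auto using C2_neq0.
Qed.
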